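(* Let $\mathfrak{s}$ be a solvable Lie algebra with codimension-one nilradical $\mathfrak{n}=[\mathfrak{s},\mathfrak{s}]$. If a $\lambda$-Einstein metric on $\mathfrak{s}$ satisfies $\langle\mathring{R}h,h\rangle<-\lambda|h|^2$ for all nonzero symmetric 2-tensors $h$, then a sufficient condition for the nilsoliton on $\mathfrak{n}$ to be strictly linearly stable is that $$\max\{d_i\}<\frac{1}{2+\sqrt2}\operatorname{tr}D,$$ where $d_1,\dots,d_n$ are the eigenvalues of the nilsoliton derivation $D$.
   Context: Inner products on a solvable Lie algebra are identified with left-invariant metrics on the corresponding simply connected Lie group; a symmetric 2-tensor $h$ in the hypothesis is a symmetric bilinear form on $\mathfrak{s}$, and $\langle\cdot,\cdot\rangle,|\cdot|$ denote the induced inner product and norm on such forms. A metric is $\lambda$-Einstein if $\mathrm{Rc}=\lambda g$. The operator $\mathring{R}$ is $(\mathring{R}h)_{ij}=R_{ipqj}h^{pq}$ (sign convention: $R_{ijji}$ is the sectional curvature of an orthonormal pair $e_i,e_j$). By results of Heber and Lauret, the restriction to $\mathfrak{n}$ of the Einstein inner product on $\mathfrak{s}$ (with $\lambda<0$) is a nilsoliton, i.e. $\operatorname{Ric}_{\mathfrak{n}}=\lambda\,\mathrm{id}_{\mathfrak{n}}+D$ with $D$ a (symmetric) derivation of $\mathfrak{n}$, the nilsoliton derivation; here $n=\dim\mathfrak{n}$. A nilsoliton with $\operatorname{Ric}=\lambda\,\mathrm{id}+D$ is a Ricci soliton $\mathrm{Rc}=\lambda g+\frac12\mathcal{L}_Xg$,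 where $X$ is the vector field generated by the automorphisms $\varphi_t$ with $d\varphi_t|_e=e^{tD}$. It is strictly linearly stable if there is $\epsilon>0$ with $(\mathbf{L}h,h)\le-\epsilon\|h\|^2$ (in $L^2$) for all smooth compactly supported symmetric 2-tensors $h$ on the nilpotent group, where $\mathbf{L}h=\Delta_Lh+2\lambda h+\mathcal{L}_Xh$, $\Delta_Lh=\Delta h+2\mathring{R}h-\operatorname{Ric}\circ h-h\circ\operatorname{Ric}$, $\Delta h=\operatorname{tr}_g\nabla^2h$, $(\operatorname{Ric}\circ h)_{ij}=R_i^kh_{kj}$, and $(h\circ\operatorname{Ric})_{ij}=R_j^kh_{ki}$. *)

(* Defs.v *)
From HB Require Import structures.
From mathcomp Require Import all_boot all_order all_algebra.
From mathcomp Require Import all_classical all_reals all_analysis.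

Set Implicit Arguments.
Unset Strict Implicit.
Unset Printing Implicit Defensive.

Import Order.TTheory GRing.Theory Num.Theory.
Import numFieldNormedType.Exports.

Local Open Scope classical_set_scope.
Local Open Scope ring_scope.

(** * Lie algebras *)

Section LieAlgebra.
Context {F : fieldType} {V : vectType F}.
Implicit Types (br : {bilinear V -> V -> V}) (U W : {vspace V}).

Definition lie_bracket br : Prop :=
  (forall x, br x x = 0) /\
  (forall x y z, br x (br y z) + br y (br z x) + br z (br x y) = 0).

(* [U, W]: by bilinearity, the brackets of basis vectors suffice. *)
Definition lie_prod br U W : {vspace V} :=
  (<<[seq br u w | u <- vbasis U, w <- vbasis W]>>)%VS.

Definition lie_solvable br U : Prop :=
  exists k, iter k (fun W => lie_prod br W W) U = 0%VS.

Definition lie_nilpotent br U : Prop :=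
  exists k, iter k (lie_prod br U) U = 0%VS.

Definition lie_ideal br U : Prop := (lie_prod br fullv U <= U)%VS.

Definition nilradical br U : Prop :=
  [/\ lie_ideal br U, lie_nilpotent br U &
      forall W, lie_ideal br W -> lie_nilpotent br W -> (W <= U)%VS].

End LieAlgebra.

(* ip : an inner product; e : an orthonormal basis of the subspace U. *)
Definition orthonormal_basis {R : realType} {V : vectType R}
    (ip : {dot V for idfun}) (U : {vspace V}) n (e : n.-tuple V) : Prop :=
  basis_of U e /\ orthonormal ip e.

Definition structure_constants {R : realType} {V : vectType R}
    (br : {bilinear V -> V -> V}) (ip : {dot V for idfun})
    n (e : n.-tuple V) (i j k : 'I_n) : R :=
  ip (br (tnth e i) (tnth e j)) (tnth e k).

(** * Left-invariant metrics

  A metric Lie algebra is handled through its structure constants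
  [e_i, e_j] = \sum_k c i j k e_k in an orthonormal basis e, so indices need
  not be raised or lowered. Bilinear forms and endomorphisms are n x n
  matrices, with (T e_i, e_j) = T i j for an endomorphism T. *)

Section LeftInvariantMetric.
Context {R : realType} {n : nat}.
Implicit Types (c : 'I_n -> 'I_n -> 'I_n -> R) (h : 'M[R]_n).

(* nabla_(e_i) e_j = \sum_k connection c i j k e_k (Koszul formula) *)
Definition connection c i j k : R := (c i j k - c j k i + c k i j) / 2.

(* R_ijkl = (R(e_i, e_j) e_k, e_l), where
   R(x, y) = nabla_x nabla_y - nabla_y nabla_x - nabla_[x, y];
   thus R_ijji is the sectional curvature of the plane (e_i, e_j). *)
Definition riemann c i j k l : R :=
  \sum_p (connection c j k p * connection c i p l
          - connection c i k p * connection c j p l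
          - c i j p * connection c p k l).

Definition ricci c : 'M[R]_n := \matrix_(j, k) \sum_i riemann c i j k i.

Definition einstein c (lambda : R) : Prop := ricci c = lambda%:M.

Definition form_dot h h' : R := \sum_i \sum_j h i j * h' i j.

Definition curvature_op c h : 'M[R]_n :=
  \matrix_(i, j) \sum_p \sum_q riemann c i p q j * h p q.

Definition derivation c (D : 'M[R]_n) : Prop :=
  forall i j l, \sum_k c i j k * D k l =
    \sum_k D i k * c k j l + \sum_k D j k * c i k l.

Definition nilsoliton c (lambda : R) (D : 'M[R]_n) : Prop :=
  [/\ ricci c = lambda%:M + D, D^T = D & derivation c D].

End LeftInvariantMetric.

(** * Calculus on R^n *)

Section Calculus.
Context {R : realType}.

(* All iterated directional derivatives exist and are differentiable; for
   finite-dimensional V this is C^infinity. *)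
Definition smooth {V W : normedModType R} (f : V -> W) : Prop :=
  forall (s : seq V) (x : V),
    differentiable (foldr (fun v g => 'D_v g) f s) x.

Definition compactly_supported {V W : normedModType R} (f : V -> W) : Prop :=
  compact (closure [set x | f x != 0]).

(* Iterated integral over R^n, only used for continuous functions with compact
   support, where it is the Lebesgue integral by Fubini's theorem. *)
Fixpoint integral_rV n : ('rV[R]_n -> R) -> R :=
  match n with
  | 0 => fun f => f 0
  | n'.+1 => fun f =>
      Rintegral (@lebesgue_measure R) setT
        (fun t => integral_rV (fun v : 'rV[R]_n' => f (row_mx t%:M v)))
  end.

(* The Lie bracket XY - YX of vector fields on R^n. *)
Definition vf_bracket n (X Y : 'rV[R]_n -> 'rV[R]_n) (x : 'rV[R]_n) :=
  'D_(X x) Y x - 'D_(Y x) X x.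

Definition expmx n (A : 'M[R]_n) : 'M[R]_n :=
  \matrix_(i, j) limn (series (fun k => (A ^+ k) i j / k`!%:R)).

End Calculus.

(** * Simply connected nilpotent Lie groups

  Every simply connected nilpotent Lie group is diffeomorphic to R^n, so it is
  given by a smooth group law on R^n; the chart is chosen with the identity at
  0 and with a prescribed basis e_i of the Lie algebra as the standard basis of
  the tangent space at 0. *)

Section LieGroup.
Context {R : realType} {n : nat}.
Implicit Types (mul : 'rV[R]_n -> 'rV[R]_n -> 'rV[R]_n)
  (c : 'I_n -> 'I_n -> 'I_n -> R) (x : 'rV[R]_n).

Record lie_group_law mul : Prop := {
  mul_smooth : smooth (fun p : 'rV[R]_n * 'rV[R]_n => mul p.1 p.2);
  mul_assoc : associative mul;
  mul_0l : left_id 0 mul;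
  mul_0r : right_id 0 mul;
  mul_inv : exists inv : 'rV[R]_n -> 'rV[R]_n,
    [/\ smooth inv, left_inverse 0 inv mul & right_inverse 0 inv mul]
}.

(* The left-invariant vector field E_i with value e_i at the identity. *)
Definition left_field mul (i : 'I_n) x : 'rV[R]_n :=
  'D_(delta_mx 0 i : 'rV[R]_n) (mul x) 0.

Definition has_lie_algebra mul c : Prop :=
  forall i j, vf_bracket (left_field mul i) (left_field mul j) 0 =
    \sum_k c i j k *: (delta_mx 0 k : 'rV[R]_n).

Definition frame mul x : 'M[R]_n := \matrix_i left_field mul i x.

(* The coordinates of a tangent vector w at x in the frame (E_i(x))_i. *)
Definition frame_coord mul x (w : 'rV[R]_n) (i : 'I_n) : R :=
  (w *m invmx (frame mul x)) 0 i.

(* The integral for the Riemannian volume of the left-invariant metric with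
   (E_i) orthonormal, whose density is sqrt (det g) = 1 / |det (E_i^j)|. *)
Definition integral_vol mul (f : 'rV[R]_n -> R) : R :=
  integral_rV (fun x => f x / `|\det (frame mul x)|).

(* The one-parameter group of automorphisms phi_t with d(phi_t)_e = exp(t D). *)
Record automorphism_flow mul (D : 'M[R]_n) (phi : R -> 'rV[R]_n -> 'rV[R]_n)
    : Prop := {
  flow_smooth : smooth (fun p : R^o * 'rV[R]_n => phi p.1 p.2);
  flow_0 : forall x, phi 0 x = x;
  flow_add : forall s t x, phi (s + t) x = phi s (phi t x);
  flow_morph : forall t x y, phi t (mul x y) = mul (phi t x) (phi t y);
  flow_diff : forall t v, 'D_v (phi t) 0 = v *m expmx (t *: D)
}.

Definition generator (phi : R -> 'rV[R]_n -> 'rV[R]_n) x : 'rV[R]_n :=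
  derive1 (fun t : R => phi t x) 0.

End LieGroup.

(** * The linearized soliton operator

  A 2-tensor on the group is given by its components in the left-invariant
  orthonormal frame: h x j k = h(E_j, E_k)(x). *)

Section LinearStability.
Context {R : realType} {n : nat}.
Implicit Types (mul : 'rV[R]_n -> 'rV[R]_n -> 'rV[R]_n)
  (c : 'I_n -> 'I_n -> 'I_n -> R) (h : 'rV[R]_n -> 'M[R]_n)
  (X : 'rV[R]_n -> 'rV[R]_n).

Definition frame_deriv mul (i : 'I_n) (f : 'rV[R]_n -> R) (x : 'rV[R]_n) : R :=
  'D_(left_field mul i x) f x.

(* (nabla_(E_i) h)(E_j, E_k) *)
Definition cov_deriv mul c h (i : 'I_n) (x : 'rV[R]_n) : 'M[R]_n :=
  \matrix_(j, k) (frame_deriv mul i (fun y => h y j k) x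
    - \sum_l connection c i j l * h x l k
    - \sum_l connection c i k l * h x j l).

(* (nabla^2_(E_p, E_i) h)(E_j, E_k), where
   nabla^2_(Y, Z) h = nabla_Y (nabla_Z h) - nabla_(nabla_Y Z) h *)
Definition cov_deriv2 mul c h (p i : 'I_n) (x : 'rV[R]_n) : 'M[R]_n :=
  cov_deriv mul c (cov_deriv mul c h i) p x
  - \sum_l connection c p i l *: cov_deriv mul c h l x.

Definition rough_laplacian mul c h (x : 'rV[R]_n) : 'M[R]_n :=
  \sum_p cov_deriv2 mul c h p p x.

Definition lichnerowicz mul c h (x : 'rV[R]_n) : 'M[R]_n :=
  rough_laplacian mul c h x + 2 *: curvature_op c (h x)
  - \matrix_(i, j) (\sum_k ricci c i k * h x k j)
  - \matrix_(i, j) (\sum_k ricci c j k * h x k i).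

(* (L_X h)(Y, Z) = X(h(Y, Z)) - h([X, Y], Z) - h(Y, [X, Z]) *)
Definition lie_deriv mul X h (x : 'rV[R]_n) : 'M[R]_n :=
  let adX j := frame_coord mul x (vf_bracket X (left_field mul j) x) in
  \matrix_(j, k) ('D_(X x) (fun y => h y j k) x
    - \sum_l adX j l * h x l k
    - \sum_l adX k l * h x j l).

Definition soliton_op mul c (lambda : R) X h (x : 'rV[R]_n) : 'M[R]_n :=
  lichnerowicz mul c h x + (2 * lambda) *: h x + lie_deriv mul X h x.

Definition L2_dot mul h h' : R :=
  integral_vol mul (fun x => form_dot (h x) (h' x)).

(* The nilsoliton Ric = lambda id + D is strictly linearly stable. The simply
   connected group mul and the automorphisms phi exist, and are unique up to
   isomorphism, for every nilpotent Lie algebra c and derivation D. *)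
Definition strictly_linearly_stable c (lambda : R) (D : 'M[R]_n) : Prop :=
  nilsoliton c lambda D /\
  forall mul phi,
    lie_group_law mul -> has_lie_algebra mul c ->
    automorphism_flow mul D phi ->
    exists2 eps : R, 0 < eps &
      forall h : 'rV[R]_n -> 'M[R]_n,
        smooth h -> compactly_supported h -> (forall x, (h x)^T = h x) ->
        L2_dot mul (soliton_op mul c lambda (generator phi) h) h
          <= - eps * L2_dot mul h h.

End LinearStability.

(* Main.v *)
Require Import Defs.
From mathcomp Require Import all_boot all_order all_algebra.
From mathcomp Require Import all_classical all_reals all_analysis.
From mathcomp Require Import perm ring lra.
From mathcomp Require complex.

(** The proof has an algebraic and an analytic half.

    Algebra. Let A be a unit normal to the nilradical, let c be the structure
    constants of the nilradical and a = ad A restricted to it, with symmetric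
    part S. The Gauss equations of the nilradical turn the Einstein equation
    into
      Ric = lambda + 1/2 [a, a^T] + (tr S) S
    (einstein_hyperplane). As a is a derivation, the trace of Ric against
    [a, a^T] equals - 1/4 |a^T . c|^2 (derivation_ricci), where a^T . c is the
    infinitesimal action of a^T on the bracket; both [a, a^T] and a^T . c
    must therefore vanish (normal_ad_normal). Hence D = (tr S) S is a symmetric
    derivation, tr D = (tr S)^2, and the eigenvalues of D are nonnegative. The
    Gauss equation restricted to forms on the nilradical turns the hypothesis
    on the curvature operator into
      <R h, h> <= - lambda |h|^2 + <S, h>^2 - tr (S h S h)
    (einstein_nilradical). If E = tr D - D, the Cauchy-Schwarz inequality
    <D, h>^2 <= tr D tr (D h^2) gives
      <S, h>^2 - tr (S h S h) + tr (D h^2) - (tr D / 2) |h|^2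
        <= (tr D)^-1 ((tr D)^2 / 2 |h|^2 - tr (E h E h)).
    Since 1 / (2 + sqrt 2) = 1 - 1 / sqrt 2, the hypothesis on the eigenvalues
    says exactly that E > tr D / sqrt 2, so the right-hand side is at most
    - eps |h|^2 (stability_quadratic_form).

    Analysis. For a symmetric h with compact support the Ricci terms and the
    Lie derivative in the soliton operator L combine to
      (L h, h) = - ||nabla h||^2 + 2 (R h, h) - (tr D / 2) ||h||^2,
    the last term coming from the divergence tr D of the soliton field. The first
    term is controlled by a Bochner argument: integrating the divergence of
      Y_k = sum_ij (h_ij (nabla_i h)_kj - h_kj (nabla_i h)_ij)
    and commuting covariant derivatives gives
      ||nabla h||^2 >= (R h, h) - (Ric h, h)
    (bochner_field_divergence_le). As Ric = lambda + D, this yields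
      (L h, h) <= (R h, h) + lambda ||h||^2 + (D h, h) - (tr D / 2) ||h||^2,
    whose integrand is at most - eps |h|^2 by the algebraic half.

    The integrations by parts take place in the global chart. Left-invariant
    fields preserve the volume because the adjoint maps of a nilpotent algebra
    are trace-free, and the soliton field X, which satisfies
    [X, E_j] = - sum_k D_jk E_k, has divergence tr D; both facts are instances
    of one divergence formula (integral_vol_along). *)

Set Implicit Arguments.
Unset Strict Implicit.
Unset Printing Implicit Defensive.

Import Order.TTheory GRing.Theory Num.Theory.
Local Open Scope ring_scope.

(** * Tensors, derivations and Ricci curvature *)

(** A singular A factors through its row space as A = C R, and R C is a
    nilpotent matrix of smaller size with the same trace. *)
Lemma mxtrace_nilpotent (F : fieldType) n (A : 'M[F]_n) k :
  A ^+ k = 0 -> \tr A = 0.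
Proof.
have [m] := ubnP n; elim: m n A k => // m IHm n A k; rewrite ltnS => le_nm Ak0.
have [Afull|] := boolP (row_free A).
  have A1k : A ^+ k \in unitmx.
    by elim: k {Ak0} => [|k IHk]; rewrite ?expr0 ?unitmx1 // exprS unitmx_mul
      -row_free_unit Afull.
  have n0 : n = 0%N.
    apply/eqP; rewrite -(mxrank_unit A1k) Ak0 mxrank0 //.
  by rewrite /mxtrace big1 // => i; move: (ltn_ord i); rewrite [X in (_ < X)%N]n0.
move=> Anfree.
have rn : (\rank A < n)%N by rewrite ltn_neqAle rank_leq_row andbT.
have trE : \tr A = \tr (row_base A *m col_base A).
  by rewrite -{1}(mulmx_base A) mxtrace_mulC.
rewrite trE; apply: (IHm _ _ k.+1); first exact: leq_trans rn le_nm.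
have powE j : (row_base A *m col_base A) ^+ j.+1 = row_base A *m A ^+ j *m col_base A.
  elim: j => [|j IHj]; first by rewrite expr1 expr0 mulmx1.
  rewrite exprSr IHj -[LHS]/(_ *m _ *m _ *m (_ *m _)) [A ^+ j.+1]exprSr -[_ * A]/(_ *m _).
  have -> : A ^+ j *m A = A ^+ j *m (col_base A *m row_base A) by rewrite mulmx_base.
  by rewrite !mulmxA.
by rewrite powE Ak0 mulmx0 mul0mx.
Qed.

Section TensorAlgebra.
Context {R : realType} {n : nat}.
Implicit Types (c : 'I_n -> 'I_n -> 'I_n -> R) (E h : 'M[R]_n).
Implicit Types (a b : 'I_n -> 'M[R]_n).

Lemma sum_antisym (A : 'I_n -> 'I_n -> R) :
  (forall i p, A i p = - A p i) -> \sum_i \sum_p A i p = 0.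
Proof.
move=> Aa; set S := \sum_i _.
have : S = - S; last by lra.
rewrite [in RHS]/S exchange_big /= -sumrN; apply: eq_bigr => i _.
by rewrite -sumrN; apply: eq_bigr => p _; rewrite Aa.
Qed.

Lemma form_dotE h h' : form_dot h h' = \tr (h *m h'^T).
Proof.
rewrite /form_dot /mxtrace; apply: eq_bigr => i _; rewrite mxE.
by apply: eq_bigr => j _; rewrite mxE.
Qed.

Lemma form_dot_ge0 h : 0 <= form_dot h h.
Proof. by apply: sumr_ge0 => i _; apply: sumr_ge0 => j _; rewrite -expr2 sqr_ge0. Qed.

Lemma form_dot_eq0 h : form_dot h h = 0 -> h = 0.
Proof.
move=> h0; apply/matrixP => i j; rewrite mxE; apply/eqP.
suff : h i j * h i j = 0 by move/eqP; rewrite mulf_eq0 orbb.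
have ge0 (k l : 'I_n) : 0 <= h k l * h k l by rewrite -expr2 sqr_ge0.
have : \sum_j h i j * h i j = 0.
  by have /psumr_eq0P := h0; apply=> // k _; apply: sumr_ge0 => l _.
by move=> /psumr_eq0P; apply.
Qed.

Definition ad_mx c i : 'M[R]_n := \matrix_(j, l) c i j l.

(** The inner product of 3-tensors, a tensor being the family of its slices. *)
Definition family_dot a b : R := \sum_i \tr (a i *m (b i)^T).

(** The infinitesimal action of an endomorphism E on the tensor of structure
    constants: it measures how far E is from being a derivation. *)
Definition slot_action E a i : 'M[R]_n :=
  \sum_k E i k *: a k + E *m a i - a i *m E.

Lemma derivation_slot c D : derivation c D <-> slot_action D (ad_mx c) =1 (fun=> 0).
Proof.
have entry i j l : (slot_action D (ad_mx c) i) j l =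
  \sum_k D i k * c k j l + \sum_k D j k * c i k l - \sum_k c i j k * D k l.
  rewrite /slot_action !mxE summxE; congr (_ + _ - _).
  - by apply: eq_bigr => k _; rewrite !mxE.
  - by apply: eq_bigr => k _; rewrite !mxE.
  - by apply: eq_bigr => k _; rewrite !mxE.
split=> [H i|H i j l]; last by apply/esym/eqP; rewrite -subr_eq0 -entry H mxE.
by apply/matrixP => j l; rewrite entry H subrr mxE.
Qed.

Lemma family_dotC a b : family_dot a b = family_dot b a.
Proof. by apply: eq_bigr => i _; rewrite -mxtrace_tr trmx_mul trmxK. Qed.

Lemma family_dot_ge0 a : 0 <= family_dot a a.
Proof. by apply: sumr_ge0 => i _; rewrite -form_dotE form_dot_ge0. Qed.

Lemma family_dot_eq0 a : family_dot a a = 0 -> a =1 (fun=> 0).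
Proof.
move=> a0 i; apply: form_dot_eq0; rewrite form_dotE.
have /psumr_eq0P := a0; apply=> // k _.
by rewrite -form_dotE form_dot_ge0.
Qed.

Lemma slot_action_adj E a b :
  family_dot (slot_action E a) b = family_dot a (slot_action E^T b).
Proof.
rewrite /family_dot /slot_action.
under eq_bigr do rewrite mulmxBl mulmxDl !linearD /= linearN /=.
under [in RHS]eq_bigr do rewrite [(_ - _)^T]linearB /= [(_ + _)^T]linearD /= mulmxBr mulmxDr !linearD /= linearN /=.
rewrite !big_split /=; congr (_ + _ + _).
- under eq_bigr do rewrite mulmx_suml linear_sum /=.
  under [in RHS]eq_bigr do rewrite linear_sum mulmx_sumr linear_sum /=.
  rewrite exchange_big /=; apply: eq_bigr => i _; apply: eq_bigr => j _.
  by rewrite -scalemxAl linearZ /= mxE linearZ /= -scalemxAr linearZ.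
- apply: eq_bigr => i _.
  by rewrite trmx_mul trmxK -mulmxA mxtrace_mulC mulmxA.
- apply: eq_bigr => i _; congr (- _).
  by rewrite trmx_mul trmxK mulmxA.
Qed.

(** The action of endomorphisms on tensors is a representation of the
    commutator Lie algebra. *)
Lemma slot_action_comm E E' a i :
  slot_action E (slot_action E' a) i - slot_action E' (slot_action E a) i =
  slot_action (E *m E' - E' *m E) a i.
Proof.
have key E1 E2 : slot_action E1 (slot_action E2 a) i =
   \sum_k (E1 *m E2) i k *: a k + E1 *m (E2 *m a i) + a i *m (E2 *m E1) +
   (\sum_k E1 i k *: (E2 *m a k) - \sum_k E1 i k *: (a k *m E2)
    + \sum_k E2 i k *: (E1 *m a k) - \sum_k E2 i k *: (a k *m E1)
    - E1 *m a i *m E2 - E2 *m a i *m E1).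
  rewrite /slot_action.
  under eq_bigr do rewrite scalerBr scalerDr.
  rewrite !big_split /= sumrN.
  have -> : \sum_k (E1 *m E2) i k *: a k =
      \sum_k E1 i k *: (\sum_l E2 k l *: a l).
    under [RHS]eq_bigr do rewrite scaler_sumr.
    rewrite exchange_big /=; apply: eq_bigr => k _.
    rewrite mxE scaler_suml; apply: eq_bigr => l _.
    by rewrite scalerA.
  rewrite !mulmxBr !mulmxDr !mulmxBl !mulmxDl mulmx_sumr mulmx_suml.
  under [\sum_(_ < n) E1 *m _]eq_bigr do rewrite -scalemxAr.
  under [\sum_(_ < n) _ *m E1]eq_bigr do rewrite -scalemxAl.
  rewrite !mulmxA.
  move: (\sum_k _) (\sum_k _) (\sum_k _) (\sum_k _) (\sum_k _).
  move: (E1 *m E2 *m a i) (E1 *m a i *m E2) (E2 *m a i *m E1) (a i *m E2 *m E1).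
  move=> x1 x2 x3 x4 x5 x6 x7 x8 x9.
  by apply/matrixP => j l; rewrite !mxE; ring.
rewrite !key /slot_action mulmxBl mulmxBr.
have -> : \sum_k (E *m E' - E' *m E) i k *: a k =
    \sum_k (E *m E') i k *: a k - \sum_k (E' *m E) i k *: a k.
  rewrite -sumrB; apply: eq_bigr => k _.
  by rewrite [(E *m E' - E' *m E) i k]mxE [(- (E' *m E)) i k]mxE scalerBl.
rewrite !mulmxA.
move: (\sum_k _) (\sum_k _) (\sum_k _) (\sum_k _) (\sum_k _) (\sum_k _).
move: (E *m E' *m a i) (E' *m E *m a i) (E *m a i *m E') (E' *m a i *m E).
move: (a i *m E' *m E) (a i *m E *m E').
move=> x1 x2 x3 x4 x5 x6 x7 x8 x9 x10 x11 x12.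
by apply/matrixP => j l; rewrite !mxE; ring.
Qed.

Section NilpotentRicci.
Variable c : 'I_n -> 'I_n -> 'I_n -> R.
Hypothesis c_anti : forall i j k, c i j k = - c j i k.
Hypothesis ad_tr : forall i, \tr (ad_mx c i) = 0.
Hypothesis killing0 : forall i j, \tr (ad_mx c i *m ad_mx c j) = 0.

Lemma c_diag i k : c i i k = 0.
Proof. by have := c_anti i i k; lra. Qed.

Lemma c_tr i : \sum_j c i j j = 0.
Proof. by rewrite -[RHS](ad_tr i) /mxtrace; apply: eq_bigr => j _; rewrite mxE. Qed.

Lemma c_killing j k : \sum_i \sum_p c j i p * c k p i = 0.
Proof.
rewrite -[RHS](killing0 j k) /mxtrace; apply: eq_bigr => i _; rewrite mxE.
by apply: eq_bigr => p _; rewrite !mxE.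
Qed.

(** For a general metric Lie algebra, the Ricci curvature also involves the
    Killing form and the mean curvature vector (tr ad e_i)_i; for a nilpotent
    algebra both vanish and only two quadratic sums in c remain. *)
Lemma ricci_nilpotent j k : ricci c j k =
  \sum_i \sum_p (4^-1 * (c i p j * c i p k) - 2^-1 * (c j i p * c k i p)).
Proof.
rewrite mxE /riemann.
pose T i p := - (connection c i k p * connection c j p i)
   - c i j p * connection c p k i.
have -> : \sum_i \sum_p (connection c j k p * connection c i p i -
     connection c i k p * connection c j p i - c i j p * connection c p k i)
   = \sum_i \sum_p T i p.
  transitivity (\sum_i \sum_p (connection c j k p * connection c i p i + T i p)).
    by apply: eq_bigr => i _; apply: eq_bigr => p _; rewrite /T addrA.
  under eq_bigr do rewrite big_split /=.
  rewrite big_split /= exchange_big /= big1 ?add0r// => p _.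
  rewrite -mulr_sumr; have -> : \sum_i connection c i p i = - \sum_i c p i i.
    rewrite -sumrN; apply: eq_bigr => i _.
    by rewrite /connection (c_anti i p i) c_diag; field.
  by rewrite c_tr oppr0 mulr0.
apply/eqP; rewrite -subr_eq0 -sumrB; apply/eqP.
under eq_bigr do rewrite -sumrB.
(* What is left is skew in (i, p) up to multiples of the Killing form. *)
pose A i p := (- c k i p * c p i j - c k p i * c p i j - c p i k * c j p i
   - c p i k * c j i p + c k p i * c j p i - c k i p * c j i p) / 4.
transitivity (\sum_i \sum_p (A i p + (c j p i * c k i p / 4 - 3 / 4 * (c j i p * c k p i)))).
  apply: eq_bigr => i _; apply: eq_bigr => p _.
  rewrite /T /A /connection (c_anti i k p) (c_anti i j p) (c_anti p k i) (c_anti i p k) (c_anti i p j).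
  by field.
under eq_bigr do rewrite big_split /= sumrB.
rewrite big_split /= sum_antisym ?add0r; last first.
  by move=> i p; rewrite /A (c_anti i p j) (c_anti i p k); field.
rewrite sumrB exchange_big /=.
under eq_bigr do rewrite -mulr_suml.
rewrite -mulr_suml c_killing mul0r.
under eq_bigr do rewrite -mulr_sumr.
by rewrite -mulr_sumr c_killing mulr0 subrr.
Qed.

(** The Ricci curvature is the moment map of the action on brackets: the
    quadratic sums in ricci_nilpotent are what contracting E . c with c
    produces. *)
Lemma slot_action_ricci E :
  family_dot (slot_action E (ad_mx c)) (ad_mx c) = - 4 * \tr (E *m ricci c).
Proof.
have T1 j k : \tr (ad_mx c j *m (ad_mx c k)^T) = \sum_i \sum_p c j i p * c k i p.
  apply: eq_bigr => i _; rewrite mxE; apply: eq_bigr => p _.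
  by rewrite !mxE.
have T2 j k : (\sum_i ad_mx c i *m (ad_mx c i)^T) j k = \sum_i \sum_p c j i p * c k i p.
  rewrite summxE; apply: eq_bigr => i _; rewrite mxE; apply: eq_bigr => p _.
  by rewrite !mxE (c_anti i j) (c_anti i k) mulrNN.
have T3 j k : (\sum_i (ad_mx c i)^T *m ad_mx c i) j k = \sum_i \sum_p c i p j * c i p k.
  rewrite summxE; apply: eq_bigr => i _; rewrite mxE; apply: eq_bigr => p _.
  by rewrite !mxE.
have -> : family_dot (slot_action E (ad_mx c)) (ad_mx c) =
   \sum_i \sum_k E i k * \tr (ad_mx c k *m (ad_mx c i)^T)
   + \tr (E *m \sum_i ad_mx c i *m (ad_mx c i)^T)
   - \tr (E *m \sum_i (ad_mx c i)^T *m ad_mx c i).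
  rewrite /family_dot /slot_action.
  under eq_bigr do rewrite mulmxBl mulmxDl !linearD /= linearN /=.
  rewrite !big_split /= sumrN.
  have tr_sum F : \tr (E *m (\sum_i F i)) = \sum_(i < n) \tr (E *m F i).
    by rewrite mulmx_sumr raddf_sum.
  rewrite !tr_sum; congr (_ + _ - _).
  - apply: eq_bigr => i _; rewrite mulmx_suml linear_sum; apply: eq_bigr => k _.
    by rewrite -scalemxAl linearZ.
  - by apply: eq_bigr => i _; rewrite mulmxA.
  - by apply: eq_bigr => i _; rewrite -mulmxA mxtrace_mulC -mulmxA.
rewrite /mxtrace.
under [X in _ + X - _]eq_bigr do rewrite mxE.
under [X in _ + _ - X]eq_bigr do rewrite mxE.
under [X in _ = _ * X]eq_bigr do rewrite mxE.
rewrite mulr_sumr -big_split -sumrB /=; apply: eq_bigr => i _.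
rewrite mulr_sumr -big_split -sumrB /=; apply: eq_bigr => k _.
rewrite -/(mxtrace _) T1 T2 T3 ricci_nilpotent.
have -> : \sum_i0 \sum_p (4^-1 * (c i0 p k * c i0 p i) - 2^-1 * (c k i0 p * c i i0 p)) =
    4^-1 * \sum_i0 \sum_p c i0 p k * c i0 p i - 2^-1 * \sum_i0 \sum_p c k i0 p * c i i0 p.
  rewrite !mulr_sumr -sumrB; apply: eq_bigr => q _.
  by rewrite !mulr_sumr -sumrB; apply: eq_bigr => p _.
move: (\sum_q _) (\sum_q _) => s1 s2.
by field.
Qed.

(** The reason why Ric detects derivations: A . c = 0, and A^T acts as the
    adjoint of A, so |A^T . c|^2 = <[A, A^T] . c, c>. *)
Lemma derivation_ricci A : derivation c A ->
  4 * \tr ((A *m A^T - A^T *m A) *m ricci c) =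
  - family_dot (slot_action A^T (ad_mx c)) (slot_action A^T (ad_mx c)).
Proof.
move/derivation_slot/funext => A0.
have -> : family_dot (slot_action A^T (ad_mx c)) (slot_action A^T (ad_mx c)) =
    family_dot (slot_action (A *m A^T - A^T *m A) (ad_mx c)) (ad_mx c).
  rewrite slot_action_adj trmxK family_dotC; apply: eq_bigr => i _.
  rewrite -slot_action_comm [slot_action A^T (slot_action A _) i](_ : _ = 0) ?subr0 //.
  rewrite A0 /slot_action mulmx0 mul0mx subr0 addr0 big1 // => k _.
  by rewrite scaler0.
by rewrite slot_action_ricci mulNr opprK.
Qed.

End NilpotentRicci.

End TensorAlgebra.

(** * The Gauss equations of a codimension-one ideal *)

Section Gauss.
Context {R : realType} {n : nat}.
Implicit Types (cs : 'I_n.+1 -> 'I_n.+1 -> 'I_n.+1 -> R) (A : 'M[R]_n).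

(** The index 0 stands for a unit normal to the ideal spanned by the other
    basis vectors. *)
Definition hyperplane_const cs (i j k : 'I_n) : R :=
  cs (lift ord0 i) (lift ord0 j) (lift ord0 k).

(** The matrix of ad e_0 on the ideal; its symmetric part is, up to sign, the
    second fundamental form of the ideal. *)
Definition normal_ad cs : 'M[R]_n :=
  \matrix_(i, j) cs ord0 (lift ord0 i) (lift ord0 j).

Definition sym_part A : 'M[R]_n := 2^-1 *: (A + A^T).

Variable cs : 'I_n.+1 -> 'I_n.+1 -> 'I_n.+1 -> R.
Hypothesis cs_anti : forall i j k, cs i j k = - cs j i k.
Hypothesis cs0 : forall i j, cs i j ord0 = 0.
Local Notation up := (lift ord0).
Local Notation c := (hyperplane_const cs).
Local Notation a := (normal_ad cs).
Local Notation S := (sym_part a).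
Let T : 'M[R]_n := 2^-1 *: (a - a^T).

Let cs_diag i k : cs i i k = 0.
Proof. by have := cs_anti i i k; lra. Qed.

Let con00 k : connection cs ord0 ord0 k = 0.
Proof. by rewrite /connection (cs_anti k) !cs0 cs_diag; lra. Qed.
Let con0i0 i : connection cs ord0 (up i) ord0 = 0.
Proof. by rewrite /connection !cs0 cs_diag subr0 addr0 mul0r. Qed.
Let con0ij i j : connection cs ord0 (up i) (up j) = T i j.
Proof. by rewrite /connection cs0 (cs_anti (up j)) !mxE; field. Qed.
Let coni0j i j : connection cs (up i) ord0 (up j) = - S i j.
Proof. by rewrite /connection cs0 (cs_anti (up i) ord0) !mxE; field. Qed.
Let conij0 i j : connection cs (up i) (up j) ord0 = S i j.
Proof. by rewrite /connection cs0 (cs_anti (up j) ord0) !mxE; field. Qed.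
Let coni00 i : connection cs (up i) ord0 ord0 = 0.
Proof. by rewrite /connection !cs0 cs_diag subr0 addr0 mul0r. Qed.

Let T_skew i j : T i j = - T j i.
Proof. by rewrite !mxE; field. Qed.
Let aE i j : cs ord0 (up i) (up j) = S i j + T i j.
Proof. by rewrite !mxE; field. Qed.

Lemma gauss_equation i j k l :
  riemann cs (up i) (up j) (up k) (up l) =
  riemann c i j k l - S j k * S i l + S i k * S j l.
Proof.
rewrite /riemann big_ord_recl /= !conij0 !coni0j cs0.
by rewrite mul0r subr0 addrC !mulrN opprK addrA.
Qed.

Let commE (X Y : 'M[R]_n) i j :
  (X *m Y - Y *m X) i j = \sum_p (X i p * Y p j - Y i p * X p j).
Proof. by rewrite !mxE -sumrB. Qed.

(** The trace of the Gauss equation, completed by the curvature of the planes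
    containing e_0, where the commutator of a and a^T comes from. *)
Lemma gauss_ricci j k : ricci cs (up j) (up k) =
  (ricci c - 2^-1 *: (a *m a^T - a^T *m a) - \tr S *: S) j k.
Proof.
have -> : (ricci c - 2^-1 *: (a *m a^T - a^T *m a) - \tr S *: S) j k =
    ricci c j k + (S *m T - T *m S) j k - \tr S * S j k.
  have -> : - (2^-1 *: (a *m a^T - a^T *m a)) = S *m T - T *m S.
    rewrite -!scalemxAl -!scalemxAr !mulmxDl !mulmxDr !mulNmx !mulmxN.
    rewrite !scalerA -!scalerBr.
    move: (a *m a) (a *m a^T) (a^T *m a) (a^T *m a^T) => x1 x2 x3 x4.
    by apply/matrixP => ? ?; rewrite !mxE; field.
  by move: (ricci c) (S *m T - T *m S) (\tr S) S => X Y t Z; rewrite !mxE.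
rewrite [ricci cs _ _]mxE [ricci c j k]mxE commE big_ord_recl /= [X in X + _ = _]/riemann big_ord_recl /=.
rewrite con00 con0i0 cs0 mulr0 !mul0r !subr0 add0r.
under eq_bigr do rewrite con0i0 mulr0 con0ij !conij0 aE sub0r.
under [in X in _ + X = _]eq_bigr do rewrite gauss_equation.
rewrite /mxtrace mulr_suml -[in RHS]sumrN -!big_split /=; apply: eq_bigr => p _.
rewrite (T_skew k); ring.
Qed.

Lemma normal_ricci : ricci cs ord0 ord0 = - \tr (S *m S).
Proof.
rewrite mxE big_ord_recl /= [X in X + _ = _]/riemann big1 ?add0r; last first.
  by move=> p _; rewrite subrr cs_diag mul0r subrr.
have -> : - \tr (S *m S) = \sum_i \sum_p - (S i p * S p i).
  by rewrite /mxtrace -sumrN; apply: eq_bigr => i _; rewrite mxE sumrN.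
apply/eqP; rewrite -subr_eq0 -sumrB; apply/eqP.
transitivity (\sum_i \sum_p (S i p * T p i - T i p * S p i)); last first.
  by apply: sum_antisym => i p; ring.
apply: eq_bigr => i _.
rewrite /riemann big_ord_recl /= !con00 coni00 cs0 !mul0r !subrr add0r -sumrB.
apply: eq_bigr => p _; rewrite con00 coni0j con0ij coni0j (cs_anti (up i)) aE; ring.
Qed.

Definition lift_form (h : 'M[R]_n) : 'M[R]_n.+1 := \matrix_(i, j)
  if unlift ord0 i is Some i' then
    (if unlift ord0 j is Some j' then h i' j' else 0) else 0.

Lemma lift_form00 h j : lift_form h ord0 j = 0.
Proof. by rewrite mxE unlift_none. Qed.
Lemma lift_formi0 h i : lift_form h i ord0 = 0.
Proof. by rewrite mxE unlift_none; case: unlift. Qed.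
Lemma lift_formE h i j : lift_form h (up i) (up j) = h i j.
Proof. by rewrite mxE !liftK. Qed.
Lemma lift_form_tr h : (lift_form h)^T = lift_form h^T.
Proof.
apply/matrixP => i j; rewrite !mxE.
by case: unlift => [j'|]; case: unlift => [i'|]//=; rewrite mxE.
Qed.

Lemma form_dot_lift h (k : 'M[R]_n.+1) :
  form_dot k (lift_form h) = \sum_i \sum_j k (up i) (up j) * h i j.
Proof.
rewrite /form_dot big_ord_recl big1 ?add0r => [|j _]; last by rewrite lift_form00 mulr0.
apply: eq_bigr => i _; rewrite big_ord_recl lift_formi0 mulr0 add0r.
by apply: eq_bigr => j _; rewrite lift_formE.
Qed.

(** The second fundamental form S contributes <S, h>^2 and tr (S h S h) to the
    curvature operator; this is where the bound assumed on the solvable algebra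
    descends to the ideal. *)
Lemma gauss_curvature h : h^T = h ->
  form_dot (curvature_op cs (lift_form h)) (lift_form h) =
  form_dot (curvature_op c h) h - (form_dot S h) ^+ 2 + \tr (S *m h *m S *m h).
Proof.
move=> hT; rewrite form_dot_lift.
have E i j : curvature_op cs (lift_form h) (up i) (up j) =
  curvature_op c h i j - S i j * form_dot S h + (S *m h *m S) i j.
  rewrite mxE big_ord_recl /= [X in X + _ = _]big1 ?add0r; last first.
    by move=> q _; rewrite lift_form00 mulr0.
  rewrite [curvature_op c h i j]mxE /form_dot mulr_sumr -sumrN -big_split /=.
  have -> : (S *m h *m S) i j = \sum_p \sum_q S i q * S p j * h p q.
    rewrite mxE; under eq_bigr do rewrite mxE mulr_suml.
    apply: eq_bigr => p _; apply: eq_bigr => q _.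
    have -> : h q p = h p q by rewrite -{1}hT mxE.
    ring.
  rewrite -big_split /=; apply: eq_bigr => p _.
  rewrite big_ord_recl lift_formi0 mulr0 add0r mulr_sumr -sumrN -!big_split /=.
  apply: eq_bigr => q _; rewrite lift_formE gauss_equation; ring.
have -> : \tr (S *m h *m S *m h) = \sum_i \sum_j (S *m h *m S) i j * h i j.
  rewrite /mxtrace; apply: eq_bigr => i _; rewrite mxE; apply: eq_bigr => j _.
  by congr (_ * _); rewrite -[in LHS]hT mxE.
rewrite expr2 {1 3}/form_dot mulr_sumr -sumrN -!big_split; apply: eq_bigr => i _.
rewrite mulr_sumr -sumrN -!big_split; apply: eq_bigr => j _ /=.
rewrite E; ring.
Qed.
End Gauss.

(** * Einstein algebras with nilpotent derived algebra *)

Definition jacobi {R : realType} {n} (c : 'I_n -> 'I_n -> 'I_n -> R) : Prop :=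
  forall i j k l, \sum_p (c j k p * c i p l + c k i p * c j p l + c i j p * c k p l) = 0.

Section Derivations.
Context {R : realType} {n : nat}.
Implicit Types (c : 'I_n -> 'I_n -> 'I_n -> R) (D A : 'M[R]_n).

Lemma derivation_tr c A : slot_action A^T (ad_mx c) =1 (fun=> 0) -> derivation c A^T.
Proof. by move=> /derivation_slot. Qed.

Lemma derivation_comb c A B (x y : R) : derivation c A -> derivation c B ->
  derivation c (x *: A + y *: B).
Proof.
move=> dA dB i j l.
under eq_bigr do rewrite !mxE mulrDr !(mulrCA (c _ _ _)).
under [in RHS]eq_bigr do rewrite !mxE mulrDl -!mulrA.
under [X in _ = _ + X]eq_bigr do rewrite !mxE mulrDl -!mulrA.
by rewrite !big_split /= -!mulr_sumr dA dB; ring.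
Qed.

Definition ad_vector c (v : 'rV[R]_n) : 'M[R]_n := \sum_p v 0 p *: ad_mx c p.

Lemma ad_vectorE c v j l : ad_vector c v j l = \sum_p v 0 p * c p j l.
Proof. by rewrite summxE; apply: eq_bigr => p _; rewrite !mxE. Qed.

(** Inner derivations are derivations: this is the Jacobi identity. *)
Lemma ad_vector_derivation c v : (forall i j k, c i j k = - c j i k) -> jacobi c ->
  derivation c (ad_vector c v).
Proof.
move=> anti jac i j l.
under eq_bigr do rewrite ad_vectorE mulr_sumr.
under [in RHS]eq_bigr do rewrite ad_vectorE mulr_suml.
under [X in _ = _ + X]eq_bigr do rewrite ad_vectorE mulr_suml.
rewrite exchange_big [X in _ = X + _]exchange_big [X in _ = _ + X]exchange_big /= -big_split /=. apply: eq_bigr => p _.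
apply/eqP; rewrite -subr_eq0 opprD addrA -!sumrB; apply/eqP.
transitivity (v 0 p * 0); last by rewrite mulr0.
rewrite -[in RHS](jac p i j l) mulr_sumr; apply: eq_bigr => k _.
rewrite (anti j p) (anti j k); ring.
Qed.
End Derivations.

Section Heber.
Context {R : realType} {n : nat}.
Variable cs : 'I_n.+1 -> 'I_n.+1 -> 'I_n.+1 -> R.
Hypothesis cs_anti : forall i j k, cs i j k = - cs j i k.
Hypothesis cs0 : forall i j, cs i j ord0 = 0.
Hypothesis cs_jacobi : jacobi cs.
Local Notation c := (hyperplane_const cs).
Local Notation a := (normal_ad cs).
Local Notation S := (sym_part a).
Hypothesis ad_tr : forall i, \tr (ad_mx c i) = 0.
Hypothesis killing0 : forall i j, \tr (ad_mx c i *m ad_mx c j) = 0.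
Variable lambda : R.
Hypothesis cs_einstein : einstein cs lambda.

Let c_anti i j k : c i j k = - c j i k.
Proof. exact: cs_anti. Qed.

Let c_jacobi : jacobi c.
Proof.
move=> i j k l; rewrite -[RHS](cs_jacobi (lift ord0 i) (lift ord0 j) (lift ord0 k) (lift ord0 l)).
by rewrite big_ord_recl !cs0 !mul0r !addr0 add0r.
Qed.

Lemma normal_ad_derivation : derivation c a.
Proof.
move=> i j l.
have := cs_jacobi ord0 (lift ord0 i) (lift ord0 j) (lift ord0 l).
rewrite big_ord_recl !cs0 !mul0r !addr0 add0r => jac.
apply/eqP; rewrite -subr_eq0 opprD addrA -!sumrB -[X in _ == X]jac; apply/eqP.
apply: eq_bigr => k _; rewrite !mxE /hyperplane_const.
rewrite (cs_anti (lift ord0 j) ord0) (cs_anti (lift ord0 j) (lift ord0 k)); ring.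
Qed.

Lemma einstein_normal : lambda = - \tr (S *m S).
Proof. by rewrite -(normal_ricci cs_anti cs0) cs_einstein mxE eqxx. Qed.

Lemma sym_part_sym : S^T = S.
Proof. by rewrite /sym_part linearZ /= linearD /= trmxK addrC. Qed.

(** The Ricci curvature of the unit normal is - |S|^2. *)
Lemma einstein_lambda_le0 : lambda <= 0.
Proof.
by rewrite einstein_normal oppr_le0 -{2}sym_part_sym -form_dotE form_dot_ge0.
Qed.

Lemma einstein_hyperplane :
  ricci c = lambda%:M + 2^-1 *: (a *m a^T - a^T *m a) + \tr S *: S.
Proof.
apply/matrixP => j k; have := gauss_ricci cs_anti cs0 j k.
rewrite cs_einstein [lambda%:M _ _]mxE (inj_eq lift_inj).
move: (ricci c) (a *m a^T) (a^T *m a) (S) (\tr S) => X1 X2 X3 X4 X5.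
by rewrite !mxE => ->; ring.
Qed.

(** Pair the formula for Ric with B = [a, a^T]. As tr B = tr (B S) = 0, only
    |B|^2 / 2 survives, while derivation_ricci gives - |a^T . c|^2 / 4, so both
    vanish. *)
Lemma normal_ad_normal : a *m a^T - a^T *m a = 0 /\ derivation c a^T.
Proof.
set B := a *m a^T - a^T *m a.
have BT : B^T = B by rewrite /B linearB /= !trmx_mul trmxK.
have trB : \tr B = 0 by rewrite /B linearB /= mxtrace_mulC subrr.
have trBS : \tr (B *m S) = 0.
  rewrite /B /sym_part -scalemxAr mxtraceZ mulmxDr !mulmxBl.
  rewrite (linearD mxtrace) !(linearB mxtrace) /=.
  rewrite (mxtrace_mulC (a *m a^T) a) (mxtrace_mulC (a *m a^T) a^T) !mulmxA.
  rewrite (mxtrace_mulC (a *m a) a^T) !mulmxA.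
  by rewrite subrr add0r subrr mulr0.
have := derivation_ricci c_anti ad_tr killing0 normal_ad_derivation.
have := einstein_hyperplane; rewrite -/B => ->; clearbody B.
rewrite !mulmxDr mul_mx_scalar -(scalemxAr 2^-1) -(scalemxAr (\tr S)).
rewrite !(linearD mxtrace) /= !mxtraceZ trB trBS mulr0 add0r mulr0 addr0 => key.
have Bge : 0 <= \tr (B *m B) by rewrite -{2}BT -form_dotE form_dot_ge0.
have Tge := family_dot_ge0 (slot_action a^T (ad_mx c)).
split; first by apply: form_dot_eq0; rewrite form_dotE BT; lra.
by apply: derivation_tr; apply: family_dot_eq0; lra.
Qed.

Lemma einstein_nilsoliton D : ricci c = lambda%:M + D ->
  [/\ nilsoliton c lambda D, D = \tr S *: S & \tr D = (\tr S) ^+ 2].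
Proof.
move=> ricD; have [B0 da] := normal_ad_normal.
have DE : D = \tr S *: S.
  apply: (addrI lambda%:M); rewrite -ricD einstein_hyperplane B0 scaler0 addr0.
  by [].
split=> //; last by rewrite DE mxtraceZ expr2.
split=> //; first by rewrite DE linearZ /= sym_part_sym.
have -> : D = (\tr S / 2) *: a + (\tr S / 2) *: a^T.
  by rewrite DE /sym_part scalerA -scalerDr.
exact: derivation_comb normal_ad_derivation da.
Qed.

(** Test derivation_ricci on the inner derivation ad v: since D is a
    derivation, [D, ad v] = d ad v, and the trace becomes - d |ad v|^2. If v is
    central, then <Ric v, v> is a sum of squares and equals (lambda + d) |v|^2
    with lambda <= 0. *)
Lemma nilsoliton_eigenvalue_ge0 D (v : 'rV[R]_n) d : nilsoliton c lambda D ->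
  v != 0 -> v *m D = d *: v -> 0 <= d.
Proof.
move=> [ricD DT dD] v0 vD.
have := derivation_ricci c_anti ad_tr killing0 (ad_vector_derivation v c_anti c_jacobi).
set A := ad_vector c v => key.
have comm : D *m A - A *m D = - d *: A.
  have -> : D *m A - A *m D = \sum_i v 0 i *: (D *m ad_mx c i - ad_mx c i *m D).
    rewrite /A /ad_vector mulmx_sumr mulmx_suml -sumrB; apply: eq_bigr => i _.
    by rewrite -scalemxAr -scalemxAl scalerBr.
  transitivity (- (\sum_i v 0 i *: \sum_k D i k *: ad_mx c k)).
    rewrite -sumrN; apply: eq_bigr => i _; rewrite -scalerN; congr (_ *: _).
    by move/derivation_slot: dD => /(_ i) /eqP; rewrite /slot_action -addrA addr_eq0 => /eqP ->; rewrite opprK.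
  rewrite scaleNr; congr (- _); rewrite /A /ad_vector scaler_sumr.
  under eq_bigr do rewrite scaler_sumr.
  rewrite exchange_big /=; apply: eq_bigr => k _.
  under eq_bigr do rewrite scalerA.
  by rewrite -scaler_suml scalerA; congr (_ *: _); move/rowP: vD => /(_ k); rewrite !mxE.
have trA : \tr ((A *m A^T - A^T *m A) *m ricci c) = - d * form_dot A A.
  rewrite ricD mulmxDr mul_mx_scalar linearD /= mxtraceZ linearB /= [\tr (A^T *m A)]mxtrace_mulC.
  rewrite subrr mulr0 add0r mulmxBl linearB /= mxtrace_mulC mulmxA -[A^T *m A *m D]mulmxA.
  by rewrite [\tr (A^T *m _)]mxtrace_mulC -linearB /= -mulmxBl comm -scalemxAl mxtraceZ form_dotE.
rewrite trA in key.
have [A0|A0] := eqVneq A 0; last first.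
  have Apos : 0 < form_dot A A.
    by rewrite lt_neqAle form_dot_ge0 andbT eq_sym; apply: contra A0 => /eqP /form_dot_eq0 ->.
  have := family_dot_ge0 (slot_action A^T (ad_mx c)).
  by move=> tge; rewrite -(pmulr_lge0 _ Apos); lra.
pose N := \sum_j v 0 j ^+ 2.
have vv : v *m v^T = N%:M.
  apply/matrixP => i j; rewrite !ord1 !mxE eqxx mulr1n.
  by apply: eq_bigr => k _; rewrite !mxE expr2.
have Npos : 0 < N.
  rewrite lt_neqAle eq_sym sumr_ge0 ?andbT => [|j _]; last exact: sqr_ge0.
  apply: contra v0 => /eqP N0; apply/eqP/rowP => j; rewrite mxE; apply/eqP.
  rewrite -sqrf_eq0; apply/eqP; have /psumr_eq0P := N0; apply=> // k _.
  exact: sqr_ge0.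
have vRv : (v *m ricci c *m v^T) 0 0 = (lambda + d) * N.
  rewrite ricD mulmxDr vD mul_mx_scalar -scalerDl -scalemxAl vv.
  by rewrite !mxE eqxx mulr1n.
have Rge : 0 <= (v *m ricci c *m v^T) 0 0.
  have -> : (v *m ricci c *m v^T) 0 0 = \sum_i \sum_p
      (4^-1 * (\sum_j v 0 j * c i p j) ^+ 2 - 2^-1 * (\sum_j v 0 j * c j i p) ^+ 2).
    rewrite mxE; under eq_bigr do rewrite !mxE mulr_suml.
    transitivity (\sum_k \sum_j \sum_i \sum_p (v 0 j * v 0 k *
       (4^-1 * (c i p j * c i p k) - 2^-1 * (c j i p * c k i p)))).
      apply: eq_bigr => k _; apply: eq_bigr => j _.
      rewrite (ricci_nilpotent c_anti ad_tr killing0).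
      rewrite mulrAC mulr_sumr; apply: eq_bigr => i _.
      by rewrite mulr_sumr.
    under eq_bigr do rewrite exchange_big /=.
    rewrite exchange_big /=; apply: eq_bigr => i _.
    under eq_bigr do rewrite exchange_big /=.
    rewrite exchange_big /=; apply: eq_bigr => p _.
    rewrite !expr2 !mulr_suml !mulr_sumr -sumrB; apply: eq_bigr => k _.
    rewrite !mulr_sumr -sumrB; apply: eq_bigr => j _; ring.
  apply: sumr_ge0 => i _; apply: sumr_ge0 => p _.
  have -> : \sum_j v 0 j * c j i p = 0 by rewrite -ad_vectorE -/A A0 mxE.
  by rewrite expr0n mulr0 subr0 mulr_ge0 ?sqr_ge0 ?invr_ge0.
have := einstein_lambda_le0.
rewrite vRv (pmulr_lge0 _ Npos) in Rge; lra.
Qed.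
End Heber.

(** * Orthonormal bases *)

Section Orthonormal.
Context {R : realType} {V : vectType R}.
Variable ip : {dot V for idfun}.
Implicit Types (u v w x y z : V) (U : {vspace V}).

Lemma ipC u v : ip u v = ip v u.
Proof. by have := @hermC R false idfun V ip u v; rewrite expr0 mul1r. Qed.

Lemma ip_suml u I (r : seq I) (P : pred I) (E : I -> V) :
  ip (\sum_(i <- r | P i) E i) u = \sum_(i <- r | P i) ip (E i) u.
Proof. by rewrite linear_sumlz. Qed.

Lemma ipZl (a : R) u v : ip (a *: u) v = a * ip u v.
Proof. by rewrite linearZl_LR. Qed.

Lemma ipZr (a : R) u v : ip u (a *: v) = a * ip u v.
Proof. by rewrite linearZr_LR. Qed.

Lemma orthonormal_gram (s : seq V) i j : orthonormal ip s ->
  (i < size s)%N -> (j < size s)%N -> ip s`_i s`_j = (i == j)%:R.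
Proof.
case/andP=> /allP nrm orth.
have lt_orth k l : (k < l < size s)%N -> ip s`_k s`_l = 0.
  elim: s k l orth {nrm} => [|v s IHs] k l; first by rewrite andbF.
  move=> /= /andP[/andP[/allP vs _] orth].
  case: l => [|l]; first by rewrite ltn0.
  case: k => [|k] /andP[kl ls]; last by apply: IHs; rewrite // -ltnS kl.
  by apply/eqP/vs/mem_nth.
move=> si sj; case: ltngtP => [ij|ji|<-].
- by rewrite lt_orth ?ij.
- by rewrite ipC lt_orth ?ji.
- by apply/eqP/nrm/mem_nth.
Qed.

Section Basis.
Context (U : {vspace V}) (n : nat) (e : n.-tuple V).
Hypothesis e_onb : orthonormal_basis ip U e.

Lemma onb_gram i j : ip (tnth e i) (tnth e j) = (i == j)%:R.
Proof.
by case: e_onb => _ eo; rewrite !(tnth_nth 0) orthonormal_gram ?size_tuple.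
Qed.

Lemma onb_mem i : tnth e i \in U.
Proof. by case: e_onb => /basis_mem eU _; rewrite eU ?mem_tnth. Qed.

Lemma onb_dim : \dim U = n.
Proof. by case: e_onb => /size_basis -> _. Qed.

Lemma onb_expand v : v \in U -> v = \sum_i ip v (tnth e i) *: tnth e i.
Proof.
case: e_onb => eU _ vU; rewrite {1}(coord_basis eU vU).
apply: eq_bigr => i _; rewrite -tnth_nth; congr (_ *: _).
rewrite {2}(coord_basis eU vU) ip_suml (bigD1 i) //= -tnth_nth ipZl onb_gram eqxx mulr1.
by rewrite big1 ?addr0// => j ji; rewrite -tnth_nth ipZl onb_gram (negPf ji) mulr0.
Qed.

Lemma onb_parseval u v : u \in U ->
  ip u v = \sum_i ip u (tnth e i) * ip v (tnth e i).
Proof.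
move=> uU; rewrite {1}(onb_expand uU) ip_suml; apply: eq_bigr => i _.
by rewrite ipZl (ipC v).
Qed.
End Basis.

Lemma gram_onb U n (e : n.-tuple V) : (forall i, tnth e i \in U) -> \dim U = n ->
  (forall i j, ip (tnth e i) (tnth e j) = (i == j)%:R) -> orthonormal_basis ip U e.
Proof.
move=> eU dimU gram.
have gramn i j (ni : (i < n)%N) (nj : (j < n)%N) : ip e`_i e`_j = (i == j)%:R.
  by have := gram (Ordinal ni) (Ordinal nj); rewrite !(tnth_nth 0).
split; last first.
  apply/andP; split.
    by apply/allP => v /tnthP[i ->]; rewrite /= gram eqxx.
  have: forall i j, (i < size e)%N -> (j < size e)%N -> ip e`_i e`_j = (i == j)%:R.
    by rewrite size_tuple => i j; apply: gramn.
  elim: (tval e) => //= v s IHs H; apply/andP; split; last first.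
    by apply: IHs => i j si sj; have := H i.+1 j.+1 si sj.
  rewrite /ortho_rec /= andbT; apply/allP => w ws /=; apply/eqP.
  by have := H 0%N (index w s).+1 isT; rewrite /= ltnS index_mem nth_index // => ->.
rewrite basisEdim dimU size_tuple leqnn andbT.
suff fr : free e.
  have sub : (<<e>> <= U)%VS by apply/span_subvP => v /tnthP[i ->].
  have [_ eqd] := dimv_leqif_eq sub.
  suff /eqP -> : (<<e>> == U)%VS by rewrite subvv.
  by rewrite -eqd dimU; move: fr; rewrite /free size_tuple.
apply/freeP => k k0 i.
have := congr1 (fun v => ip v (tnth e i)) k0.
rewrite linear0l ip_suml (bigD1 i)//= -tnth_nth ipZl gram eqxx mulr1 big1 ?addr0//.
by move=> j ji; rewrite -tnth_nth ipZl gram (negPf ji) mulr0.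
Qed.

Lemma unit_normal U n (e : n.-tuple V) : orthonormal_basis ip U e ->
  \dim {:V} = (\dim U).+1 -> exists A, [/\ ip A A = 1 & forall x, x \in U -> ip A x = 0].
Proof.
move=> eU dimV.
have [v vU] : exists v, v \notin U.
  apply: contrapT => /forallNP H.
  have : (fullv <= U)%VS by apply/subvP => v _; have /negP := H v; rewrite negbK.
  by move/dimvS; rewrite dimV ltnn.
pose w := v - \sum_i ip v (tnth e i) *: tnth e i.
have wU x : x \in U -> ip w x = 0.
  move=> xU; rewrite linearBl /= ip_suml ipC (onb_parseval eU _ xU).
  apply/eqP; rewrite subr_eq0; apply/eqP; apply: eq_bigr => i _.
  by rewrite ipZl (ipC x) mulrC.
have w0 : w != 0.
  apply: contra vU; rewrite subr_eq0 => /eqP ->.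
  by apply: rpred_sum => i _; rewrite rpredZ // (onb_mem eU).
have wpos : 0 < ip w w by apply: neq0_dnorm_gt0.
exists ((Num.sqrt (ip w w))^-1 *: w); split; last first.
  by move=> x xU; rewrite ipZl (wU _ xU) mulr0.
rewrite ipZl ipZr mulrA -expr2 exprVn sqr_sqrtr ?ltW // mulVf //.
by rewrite gt_eqF.
Qed.

Lemma onb_cons U n (e : n.-tuple V) A : orthonormal_basis ip U e ->
  \dim {:V} = (\dim U).+1 -> ip A A = 1 -> (forall x, x \in U -> ip A x = 0) ->
  orthonormal_basis ip fullv [tuple of A :: e].
Proof.
move=> eU dimV AA AU; apply: gram_onb.
- by move=> i; rewrite memvf.
- by rewrite dimV (onb_dim eU).
move=> i j; case: (unliftP ord0 i) => [i'|] ->; case: (unliftP ord0 j) => [j'|] ->.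
- by rewrite !tnthS (onb_gram eU) (inj_eq lift_inj).
- by rewrite tnthS tnth0 ipC AU ?(onb_mem eU).
- by rewrite tnthS tnth0 AU ?(onb_mem eU).
- by rewrite !tnth0 AA eqxx.
Qed.

End Orthonormal.

(** * Structure constants and change of basis *)

Section LieProd.
Context {F : fieldType} {V : vectType F}.
Variable br : {bilinear V -> V -> V}.

Lemma mem_lie_prod (U W : {vspace V}) u w : u \in U -> w \in W -> br u w \in lie_prod br U W.
Proof.
move=> uU wW; rewrite (coord_vbasis uU) (coord_vbasis wW).
rewrite linear_sumlz; apply: rpred_sum => i _; rewrite linear_sumr.
apply: rpred_sum => j _; rewrite linearZl_LR linearZr_LR !rpredZ //.
by apply: memv_span; apply: allpairs_f; rewrite mem_nth ?size_tuple.
Qed.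

Lemma lie_prod0r (U : {vspace V}) : lie_prod br U 0 = 0%VS.
Proof.
apply/eqP; rewrite -subv0; apply/span_subvP => v /allpairsP[[u w] /= [_ w0 ->]].
have /eqP -> : w == 0 by rewrite -memv0; apply: vbasis_mem.
by rewrite linear0r mem0v.
Qed.
End LieProd.

Section Structure.
Context {R : realType} {V : vectType R}.
Variables (br : {bilinear V -> V -> V}) (ip : {dot V for idfun}).
Hypothesis br_lie : lie_bracket br.

Lemma br_anti x y : br x y = - br y x.
Proof.
case: br_lie => alt _; apply/eqP; rewrite -addr_eq0; apply/eqP.
by have := alt (x + y); rewrite linearDl !linearDr !alt add0r addr0.
Qed.

Section Coordinates.
Context (U : {vspace V}) (n : nat) (e : n.-tuple V).
Hypothesis e_onb : orthonormal_basis ip U e.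
Hypothesis U_br : forall x y, x \in U -> y \in U -> br x y \in U.
Local Notation c := (structure_constants br ip e).

Lemma sc_anti i j k : c i j k = - c j i k.
Proof. by rewrite /structure_constants br_anti linearNl. Qed.

Lemma sc_br i j : br (tnth e i) (tnth e j) = \sum_k c i j k *: tnth e k.
Proof. by apply: onb_expand e_onb _ _; apply: U_br; exact: onb_mem e_onb _. Qed.

Lemma sc_jacobi : jacobi c.
Proof.
move=> i j k l; case: br_lie => _ /(_ (tnth e i) (tnth e j) (tnth e k)).
move/(congr1 (fun v => ip v (tnth e l))); rewrite /= !linearDl linear0l /= => J; rewrite -[RHS]J.
rewrite !sc_br !linear_sumr /= !ip_suml -!big_split /=; apply: eq_bigr => p _.
by rewrite !linearZr_LR !ipZl.
Qed.

Definition coords x : 'rV[R]_n := \row_l ip x (tnth e l).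

Lemma coords_ad_mx i x : x \in U ->
  coords x *m ad_mx c i = coords (br (tnth e i) x).
Proof.
move=> xU; apply/rowP => l; rewrite !mxE {2}(onb_expand e_onb xU).
rewrite linear_sumr ip_suml; apply: eq_bigr => j _.
by rewrite !mxE linearZr_LR ipZl.
Qed.

Lemma coords_tnth i : coords (tnth e i) = delta_mx 0 i.
Proof. by apply/rowP => l; rewrite !mxE (onb_gram e_onb) eqxx eq_sym. Qed.

(** A product of matrices ad e_i is an iterated bracket, and
    descends the lower central series. *)
Lemma ad_mx_nilpotent : lie_nilpotent br U ->
  exists K, forall s : seq 'I_n, (K <= size s)%N -> \prod_(i <- s) ad_mx c i = 0.
Proof.
case=> K UK; exists K => s Ks.
have desc (t : seq 'I_n) x k : x \in iter k (lie_prod br U) U ->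
    x \in U -> exists y, [/\ y \in iter (size t + k) (lie_prod br U) U, y \in U &
      coords x *m \prod_(i <- t) ad_mx c i = coords y].
  elim: t x k => [|i t IHt] x k xk xU; first by exists x; rewrite big_nil mulmx1.
  have [||y [yk yU xy]] := IHt (br (tnth e i) x) k.+1.
  - by apply: mem_lie_prod => //; exact: onb_mem e_onb _.
  - by apply: U_br => //; exact: onb_mem e_onb _.
  exists y; split=> //; first by rewrite -[size (i :: t)]/(size t).+1 addSnnS.
  by rewrite big_cons -mulmxE mulmxA coords_ad_mx.
apply/row_matrixP => i; rewrite row0 rowE -coords_tnth.
have [|y [yk yU ->]] := desc s (tnth e i) 0%N (onb_mem e_onb i); first exact: onb_mem e_onb _.
have : iter (size s + 0) (lie_prod br U) U = 0%VS.
  rewrite addn0 -(subnK Ks) iterD UK.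
  by elim: (_ - _)%N => //= k ->; exact: lie_prod0r.
move=> E; move: yk; rewrite E memv0 => /eqP ->.
by apply/rowP => l; rewrite !mxE linear0l.
Qed.

(** The products of structure matrices are nilpotent, hence trace-free. *)
Lemma nilpotent_traces : lie_nilpotent br U ->
  (forall i, \tr (ad_mx c i) = 0) /\ (forall i j, \tr (ad_mx c i *m ad_mx c j) = 0).
Proof.
case/ad_mx_nilpotent => K HK; split=> [i|i j]; apply: (@mxtrace_nilpotent _ _ _ K).
  have <- : \prod_(l <- nseq K i) ad_mx c l = ad_mx c i ^+ K.
    by rewrite big_nseq -Monoid.iteropE; elim: K {HK} => //= k ->; rewrite exprS.
  by apply: HK; rewrite size_nseq.
have <- : \prod_(l <- flatten (nseq K [:: i; j])) ad_mx c l = (ad_mx c i *m ad_mx c j) ^+ K.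
  elim: K {HK} => [|k IHk]; first by rewrite big_nil.
  by rewrite /= !big_cons IHk exprS mulrA.
by apply: HK; rewrite size_flatten /shape map_nseq sumn_nseq leq_pmull.
Qed.
End Coordinates.

(** The Levi-Civita form and the curvature as multilinear forms on the Lie
    algebra; they do not depend on the orthonormal basis, so the hypotheses on
    the Einstein metric may be read in any orthonormal basis. *)
Definition koszul x y z : R := (ip (br x y) z - ip (br y z) x + ip (br z x) y) / 2.

Section Curvature4.
Context (m : nat) (f : m.-tuple V).
Hypothesis f_onb : orthonormal_basis ip fullv f.

(** The covariant derivative nabla_y z enters through its components
    koszul y z f_p in an orthonormal basis; by Parseval the result does not
    depend on it. *)
Definition curvature4 x y z w : R :=
  \sum_p (koszul y z (tnth f p) * koszul x (tnth f p) w
          - koszul x z (tnth f p) * koszul y (tnth f p) w)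
  - koszul (br x y) z w.

Definition linear_form (B : V -> R) := forall a u v, B (a *: u + v) = a * B u + B v.

Lemma linear_form_sum B I (r : seq I) (x : I -> R) (E : I -> V) : linear_form B ->
  B (\sum_(i <- r) x i *: E i) = \sum_(i <- r) x i * B (E i).
Proof.
move=> lB; have B0 : B 0 = 0.
  by have := lB (- 1) 0 0; rewrite scaler0 addr0 mulN1r addNr.
by elim: r => [|i r IHr]; rewrite ?big_nil // !big_cons lB IHr.
Qed.

Lemma koszul_lin1 y z : linear_form (fun x => koszul x y z).
Proof.
by move=> a u v; rewrite /koszul !linearPr !linearPl /=; field.
Qed.
Lemma koszul_lin2 x z : linear_form (fun y => koszul x y z).
Proof.
by move=> a u v; rewrite /koszul !linearPr !linearPl /=; field.
Qed.
Lemma koszul_lin3 x y : linear_form (fun z => koszul x y z).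
Proof.
by move=> a u v; rewrite /koszul !linearPr !linearPl /=; field.
Qed.

Lemma riemann_curvature4 i j k l :
  riemann (structure_constants br ip f) i j k l =
  curvature4 (tnth f i) (tnth f j) (tnth f k) (tnth f l).
Proof.
rewrite /curvature4.
rewrite (onb_expand f_onb (memvf (br (tnth f i) (tnth f j)))).
rewrite (linear_form_sum _ _ _ (koszul_lin1 _ _)) -sumrB.
by apply: eq_bigr => p _.
Qed.

(** Expand f_p in the basis g, exchange the sums, and recognize the expansion
    of g_q in the basis f. *)
Lemma parseval_bilinear m' (g : m'.-tuple V) (B : V -> V -> R) :
  orthonormal_basis ip fullv g ->
  (forall y, linear_form (B ^~ y)) -> (forall x, linear_form (B x)) ->
  \sum_p B (tnth f p) (tnth f p) = \sum_q B (tnth g q) (tnth g q).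
Proof.
move=> g_onb Bl Br.
transitivity (\sum_p \sum_q ip (tnth f p) (tnth g q) * B (tnth g q) (tnth f p)).
  apply: eq_bigr => p _.
  by rewrite {1}(onb_expand g_onb (memvf (tnth f p))) (linear_form_sum _ _ _ (Bl _)).
rewrite exchange_big /=; apply: eq_bigr => q _.
have -> : B (tnth g q) (tnth g q) =
    \sum_p ip (tnth g q) (tnth f p) * B (tnth g q) (tnth f p).
  by rewrite {2}(onb_expand f_onb (memvf (tnth g q))) (linear_form_sum _ _ _ (Br _)).
by apply: eq_bigr => p _; rewrite ipC.
Qed.

Lemma curvature4_lin1 y z w : linear_form (fun x => curvature4 x y z w).
Proof.
move=> a u v; rewrite /curvature4 linearPl koszul_lin1.
under eq_bigr do rewrite !koszul_lin1.
rewrite mulrBr mulr_sumr [RHS]addrACA -big_split -opprD /=; congr (_ - _).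
by apply: eq_bigr => p _; ring.
Qed.

Lemma curvature4_lin2 x z w : linear_form (fun y => curvature4 x y z w).
Proof.
move=> a u v; rewrite /curvature4 linearPr koszul_lin1.
under eq_bigr do rewrite !koszul_lin1.
rewrite mulrBr mulr_sumr [RHS]addrACA -big_split -opprD /=; congr (_ - _).
by apply: eq_bigr => p _; ring.
Qed.

Lemma curvature4_lin3 x y w : linear_form (fun z => curvature4 x y z w).
Proof.
move=> a u v; rewrite /curvature4 koszul_lin2.
under eq_bigr do rewrite !koszul_lin2.
rewrite mulrBr mulr_sumr [RHS]addrACA -big_split -opprD /=; congr (_ - _).
by apply: eq_bigr => p _; ring.
Qed.

Lemma curvature4_lin4 x y z : linear_form (fun w => curvature4 x y z w).
Proof.
move=> a u v; rewrite /curvature4 koszul_lin3.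
under eq_bigr do rewrite !koszul_lin3.
rewrite mulrBr mulr_sumr [RHS]addrACA -big_split -opprD /=; congr (_ - _).
by apply: eq_bigr => p _; ring.
Qed.

End Curvature4.

Section ChangeOfBasis.
Context (m m' : nat) (f : m.-tuple V) (g : m'.-tuple V).
Hypothesis f_onb : orthonormal_basis ip fullv f.
Hypothesis g_onb : orthonormal_basis ip fullv g.

Lemma curvature4_basis x y z w : curvature4 f x y z w = curvature4 g x y z w.
Proof.
rewrite /curvature4; congr (_ - _).
pose B u v := koszul y z u * koszul x v w - koszul x z u * koszul y v w.
apply: (parseval_bilinear f_onb (B := B) g_onb) => u a v v'; rewrite /B.
  by rewrite !koszul_lin3; ring.
by rewrite !koszul_lin2; ring.
Qed.

Definition transition : 'M[R]_(m', m) := \matrix_(i, a) ip (tnth g i) (tnth f a).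

(** Contracting a form h with B is independent of the basis, provided that h
    is transported by the transition matrix. *)
Lemma pullback_bilinear (h : 'M[R]_m') (B : V -> V -> R) :
  (forall y, linear_form (B ^~ y)) -> (forall x, linear_form (B x)) ->
  \sum_a \sum_b (transition^T *m h *m transition) a b * B (tnth f a) (tnth f b) =
  \sum_i \sum_j h i j * B (tnth g i) (tnth g j).
Proof.
move=> Bl Br.
have gE i j : B (tnth g i) (tnth g j) =
    \sum_a \sum_b transition i a * transition j b * B (tnth f a) (tnth f b).
  have lE x y : B x y = \sum_a ip x (tnth f a) * B (tnth f a) y.
    by rewrite {1}(onb_expand f_onb (memvf x)) (linear_form_sum _ _ _ (Bl _)).
  have rE x y : B x y = \sum_b ip y (tnth f b) * B x (tnth f b).
    by rewrite {1}(onb_expand f_onb (memvf y)) (linear_form_sum _ _ _ (Br _)).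
  rewrite lE; apply: eq_bigr => a _; rewrite rE mulr_sumr.
  by apply: eq_bigr => b _; rewrite !mxE mulrA.
under [RHS]eq_bigr do under eq_bigr do rewrite gE mulr_sumr.
under [RHS]eq_bigr do rewrite exchange_big /=.
rewrite [RHS]exchange_big /=; apply: eq_bigr => a _.
under [RHS]eq_bigr do under eq_bigr do rewrite mulr_sumr.
under [RHS]eq_bigr do rewrite exchange_big /=.
rewrite [RHS]exchange_big /=; apply: eq_bigr => b _.
have -> : (transition^T *m h *m transition) a b =
    \sum_i \sum_j transition i a * h i j * transition j b.
  rewrite exchange_big mxE; apply: eq_bigr => j _ /=.
  have -> : (transition^T *m h) a j = \sum_i transition i a * h i j.
    by rewrite mxE; apply: eq_bigr => i _; rewrite mxE.
  by rewrite mulr_suml.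
rewrite mulr_suml; apply: eq_bigr => i _; rewrite mulr_suml; apply: eq_bigr => j _.
by ring.
Qed.

Lemma einstein_basis lambda : einstein (structure_constants br ip f) lambda ->
  einstein (structure_constants br ip g) lambda.
Proof.
move=> f_einstein; apply/matrixP => j k.
have ricE y z : \sum_p curvature4 f (tnth f p) y z (tnth f p) =
    \sum_p curvature4 g (tnth g p) y z (tnth g p).
  rewrite (parseval_bilinear f_onb (B := fun u v => curvature4 f u y z v) g_onb).
  - by apply: eq_bigr => p _; exact: curvature4_basis.
  - by move=> v; exact: curvature4_lin1.
  - by move=> v; exact: curvature4_lin4.
rewrite mxE; under eq_bigr do rewrite (riemann_curvature4 g_onb).
rewrite -ricE [lambda%:M j k]mxE.
pose B y z := \sum_p curvature4 f (tnth f p) y z (tnth f p).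
have Bf a b : B (tnth f a) (tnth f b) = lambda * (a == b)%:R.
  rewrite mulr_natr; have := congr1 (fun M : 'M[R]_m => M a b) f_einstein.
  rewrite [lambda%:M _ _]mxE [ricci _ _ _]mxE => <-.
  by apply: eq_bigr => p _; rewrite (riemann_curvature4 f_onb).
have Bl y : linear_form (B ^~ y).
  move=> u v w; rewrite /B; under eq_bigr do rewrite curvature4_lin2.
  by rewrite big_split /= -mulr_sumr.
have Br y : linear_form (B y).
  move=> u v w; rewrite /B; under eq_bigr do rewrite curvature4_lin3.
  by rewrite big_split /= -mulr_sumr.
rewrite -mulr_natr -(onb_gram g_onb) -/(B (tnth g j) (tnth g k)).
have BE x : B (tnth f x) (tnth g k) = lambda * ip (tnth g k) (tnth f x).
  rewrite {1}(onb_expand f_onb (memvf (tnth g k))) (linear_form_sum _ _ _ (Br _)).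
  rewrite (bigD1 x) //= Bf eqxx mulr1 mulrC big1 ?addr0 => [//|b bx].
  by rewrite Bf eq_sym (negPf bx) !mulr0.
rewrite {1}(onb_expand f_onb (memvf (tnth g j))) (linear_form_sum _ _ _ (Bl _)).
rewrite (onb_parseval f_onb (tnth g k) (memvf (tnth g j))) mulr_sumr.
by apply: eq_bigr => a _; rewrite BE; ring.
Qed.

Lemma transition_orthogonal : transition *m transition^T = 1%:M.
Proof.
apply/matrixP => i j; rewrite !mxE -(onb_gram g_onb).
rewrite (onb_parseval f_onb (tnth g j) (memvf (tnth g i))).
by apply: eq_bigr => a _; rewrite !mxE.
Qed.

(** The quadratic form of the curvature operator and the norm are both
    invariant under the orthogonal change of basis. *)
Lemma curvature_bound_basis K :
  (forall h : 'M[R]_m, h^T = h ->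
     form_dot (curvature_op (structure_constants br ip f) h) h <= K * form_dot h h) ->
  forall h : 'M[R]_m', h^T = h ->
     form_dot (curvature_op (structure_constants br ip g) h) h <= K * form_dot h h.
Proof.
move=> f_curv h hT.
set P := transition; pose h' := P^T *m h *m P.
have h'T : h'^T = h' by rewrite /h' !trmx_mul trmxK hT mulmxA.
have norm : form_dot h' h' = form_dot h h.
  rewrite !form_dotE h'T hT /h' !mulmxA -(mulmxA (P^T *m h)) transition_orthogonal mulmx1.
  by rewrite mxtrace_mulC !mulmxA transition_orthogonal mul1mx.
have := f_curv h' h'T; rewrite norm.
suff -> : form_dot (curvature_op (structure_constants br ip f) h') h' =
  form_dot (curvature_op (structure_constants br ip g) h) h by [].
pose B x y := \sum_p \sum_q h p q * curvature4 g x (tnth g p) (tnth g q) y.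
have Bl y : linear_form (B ^~ y).
  move=> a u v; rewrite /B mulr_sumr -big_split; apply: eq_bigr => p _ /=.
  rewrite mulr_sumr -big_split; apply: eq_bigr => q _ /=.
  by rewrite curvature4_lin1; ring.
have Br x : linear_form (B x).
  move=> a u v; rewrite /B mulr_sumr -big_split; apply: eq_bigr => p _ /=.
  rewrite mulr_sumr -big_split; apply: eq_bigr => q _ /=.
  by rewrite curvature4_lin4; ring.
transitivity (\sum_i \sum_j h i j * B (tnth g i) (tnth g j)); last first.
  apply: eq_bigr => i _; apply: eq_bigr => j _; rewrite mulrC mxE; congr (_ * _).
  apply: eq_bigr => p _; apply: eq_bigr => q _.
  by rewrite (riemann_curvature4 g_onb) mulrC.
rewrite -(pullback_bilinear h Bl Br); apply: eq_bigr => a _; apply: eq_bigr => b _.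
rewrite mulrC mxE; congr (_ * _); rewrite /B.
pose C u v := curvature4 g (tnth f a) u v (tnth f b).
rewrite -(@pullback_bilinear h C); first last.
- by move=> x u v w; rewrite /C curvature4_lin3.
- by move=> x u v w; rewrite /C curvature4_lin2.
rewrite mxE; apply: eq_bigr => p _; apply: eq_bigr => q _.
by rewrite (riemann_curvature4 f_onb) /C curvature4_basis mulrC.
Qed.

End ChangeOfBasis.
End Structure.

(** * The nilradical of an Einstein solvable algebra *)

Section EinsteinNilradical.
Context {R : realType} {V : vectType R}.
Variables (br : {bilinear V -> V -> V}) (ip : {dot V for idfun}) (nn : {vspace V}).
Hypothesis br_lie : lie_bracket br.
Hypothesis nn_nilradical : nilradical br nn.
Hypothesis nn_derived : nn = lie_prod br fullv fullv.
Hypothesis nn_codim1 : \dim {:V} = (\dim nn).+1.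
Context (m : nat) (f : m.-tuple V).
Hypothesis f_onb : orthonormal_basis ip fullv f.
Variable lambda : R.
Hypothesis s_einstein : einstein (structure_constants br ip f) lambda.
Hypothesis s_curv : forall h : 'M[R]_m, h^T = h ->
  form_dot (curvature_op (structure_constants br ip f) h) h <= - lambda * form_dot h h.
Context (n : nat) (e : n.-tuple V).
Hypothesis e_onb : orthonormal_basis ip nn e.
Local Notation c := (structure_constants br ip e).

Let br_nn x y : br x y \in nn.
Proof. by rewrite nn_derived mem_lie_prod ?memvf. Qed.

Let nn_br x y : x \in nn -> y \in nn -> br x y \in nn.
Proof. by move=> _ _; exact: br_nn. Qed.

Let nn_nilp : lie_nilpotent br nn.
Proof. by case: nn_nilradical. Qed.

Lemma nilradical_anti i j k : c i j k = - c j i k.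
Proof. exact: sc_anti. Qed.

Lemma nilradical_tr i : \tr (ad_mx c i) = 0.
Proof. by have [+ _] := nilpotent_traces e_onb nn_br nn_nilp; apply. Qed.

(** The matrix S is the symmetric part of ad A for a unit normal A to the
    nilradical; the results on structure constants apply in the orthonormal
    basis obtained by putting A in front of e. *)
Lemma einstein_nilradical D : ricci c = lambda%:M + D ->
  [/\ nilsoliton c lambda D,
     (forall (v : 'rV[R]_n) d, v != 0 -> v *m D = d *: v -> 0 <= d) &
     exists S : 'M[R]_n, [/\ D = \tr S *: S, \tr D = (\tr S) ^+ 2 &
       forall h : 'M[R]_n, h^T = h -> form_dot (curvature_op c h) h <=
         - lambda * form_dot h h + (form_dot S h) ^+ 2 - \tr (S *m h *m S *m h)]].
Proof.
move=> ricD.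
have [A [AA AU]] := unit_normal e_onb nn_codim1.
have g_onb := onb_cons e_onb nn_codim1 AA AU.
set g := [tuple of A :: e] in g_onb.
pose cs := structure_constants br ip g.
have cs_anti : forall i j k, cs i j k = - cs j i k by move=> i j k; exact: sc_anti.
have cs0 i j : cs i j ord0 = 0.
  by rewrite /cs /structure_constants tnth0 ipC AU.
have cs_jac : jacobi cs.
  by apply: (sc_jacobi br_lie g_onb) => x y _ _; exact: memvf.
have cs_ein : einstein cs lambda by exact: (einstein_basis f_onb g_onb s_einstein).
have cE : c = hyperplane_const cs.
  by apply/funext => i; apply/funext => j; apply/funext => k;
     rewrite /hyperplane_const /cs /structure_constants !tnthS.
have [trc kil] := nilpotent_traces e_onb nn_br nn_nilp.
rewrite cE in trc kil ricD *.
have [sol DS trD] := einstein_nilsoliton cs_anti cs0 cs_jac trc kil cs_ein ricD.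
split=> //.
  by move=> v d; apply: (nilsoliton_eigenvalue_ge0 cs_anti cs0 cs_jac trc kil cs_ein sol).
exists (sym_part (normal_ad cs)); split=> // h hT.
have hl : (lift_form h)^T = lift_form h by rewrite lift_form_tr hT.
have := curvature_bound_basis f_onb g_onb s_curv hl.
rewrite (gauss_curvature cs_anti cs0 hT) form_dot_lift.
have -> : \sum_i \sum_j lift_form h (lift ord0 i) (lift ord0 j) * h i j = form_dot h h.
  by apply: eq_bigr => i _; apply: eq_bigr => j _; rewrite lift_formE.
by lra.
Qed.

End EinsteinNilradical.

(** * The pointwise quadratic form *)

Local Open Scope sesquilinear_scope.
(** The weights are w_ij = |k_ij|^2, where k is the matrix of h in an
    orthonormal basis of eigenvectors of A. They reduce trace inequalities
    between A and h to inequalities between eigenvalues. *)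
Lemma hermitian_weights (C : numClosedFieldType) n (A : 'M[C]_n) :
  A ^t Num.conj = A ->
  exists2 sp : 'I_n -> C, (forall i, root (char_poly A) (sp i)) &
  forall h : 'M[C]_n, h ^t Num.conj = h ->
  exists w : 'I_n -> 'I_n -> C, [/\ forall i j, 0 <= w i j /\ w i j = w j i,
    \tr (h *m h) = \sum_i \sum_j w i j,
    \tr (A *m h *m h) = \sum_i \sum_j sp i * w i j &
    \tr (A *m h *m A *m h) = \sum_i \sum_j sp i * sp j * w i j].
Proof.
move=> Aherm.
have /orthomx_spectralP : A \is normalmx by apply/normalmxP; rewrite Aherm.
set P := spectralmx A; set sp := spectral_diag A => AE.
have Pu : P \in unitmx by exact: spectral_unit.
have PU : invmx P = P ^t Num.conj by rewrite invmx_unitary ?spectral_unitarymx.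
exists (fun i => sp 0 i).
  move=> i; rewrite -eigenvalue_root_char; apply/eigenvalueP.
  exists (row i P); last first.
    apply/eqP => ri0; have : row i P *m invmx P = row i 1%:M.
      by rewrite -row_mul mulmxV.
    rewrite ri0 mul0mx => /rowP /(_ i); rewrite !mxE eqxx => /eqP.
    by rewrite eq_sym oner_eq0.
  rewrite {1}AE !mulmxA -row_mul mulmxV // -row_mul mul1mx row_diag_mx.
  by rewrite -scalemxAl -rowE.
move=> h hherm; pose k := P *m h *m invmx P.
have kherm : k ^t Num.conj = k.
  by rewrite /k PU !trmx_mul !map_mxM hherm map_trmx !trmxK -map_mx_comp
    (map_mx_id (@conjCK _)) mulmxA.
have kE i j : k j i = (k i j)^*%R by rewrite -{1}kherm !mxE.
have hE : h = invmx P *m k *m P by rewrite /k !mulmxA mulVmx // mul1mx mulmxKV.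
exists (fun i j => k i j * k j i); split.
- by move=> i j; rewrite mulrC; split; rewrite // (kE j i) mul_conjC_ge0.
- have -> : \tr (h *m h) = \tr (k *m k).
    rewrite {1 2}hE !mulmxA mulmxK // mxtrace_mulC !mulmxA mulmxV // mul1mx.
    by [].
  by rewrite /mxtrace; apply: eq_bigr => i _; rewrite mxE.
- have -> : \tr (A *m h *m h) = \tr (diag_mx sp *m k *m k).
    rewrite {1}AE hE !mulmxA mulmxK // mulmxK // mxtrace_mulC !mulmxA mulmxV // mul1mx.
    by [].
  rewrite /mxtrace; apply: eq_bigr => i _; rewrite mxE; apply: eq_bigr => j _.
  by rewrite mul_diag_mx mxE mulrA.
- have -> : \tr (A *m h *m A *m h) = \tr (diag_mx sp *m k *m diag_mx sp *m k).
    rewrite {1 2}AE hE !mulmxA mulmxK // mulmxK // mulmxK // mxtrace_mulC !mulmxA mulmxV // mul1mx.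
    by [].
  rewrite /mxtrace; apply: eq_bigr => i _; rewrite mxE; apply: eq_bigr => j _.
  by rewrite mul_mx_diag mul_diag_mx !mxE; ring.
Qed.
Local Close Scope sesquilinear_scope.

Section RealSpectral.
Import complex.
Context {R : rcfType}.
Local Notation rc := (real_complex R).

(** The spectral theorem is used over the complex numbers, where it holds for
    normal matrices; the weights are real because they are nonnegative. *)
Lemma symmetric_weights n (D : 'M[R]_n) (d : 'I_n -> R) : D^T = D ->
  char_poly D = \prod_(i < n) ('X - (d i)%:P) ->
  exists2 sp : 'I_n -> R, (forall i, exists j, sp i = d j) &
  forall h : 'M[R]_n, h^T = h ->
  exists w : 'I_n -> 'I_n -> R, [/\ forall i j, 0 <= w i j /\ w i j = w j i,
    \tr (h *m h) = \sum_i \sum_j w i j,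
    \tr (D *m h *m h) = \sum_i \sum_j sp i * w i j &
    \tr (D *m h *m D *m h) = \sum_i \sum_j sp i * sp j * w i j].
Proof.
move=> DT dE.
have conjrc (M : 'M[R]_n) : M^T = M -> map_mx Num.conj (map_mx rc M)^T = map_mx rc M.
  move=> MT; rewrite map_trmx MT; apply/matrixP => i j; rewrite !mxE.
  by apply: conj_Creal; apply/complex_realP; exists (M i j).
have [sp spE H] := hermitian_weights (conjrc _ DT).
have spd i : exists j, sp i = rc (d j).
  have := spE i; rewrite -map_char_poly dE rmorph_prod /=.
  under eq_bigr do rewrite rmorphB /= map_polyX map_polyC.
  rewrite -(big_map (fun j => rc (d j)) predT (fun z => 'X - z%:P)) root_prod_XsubC.
  by move=> /mapP[j _ ->]; exists j.
have [s sE] := boolp.choice spd.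
exists (fun i => d (s i)); first by move=> i; exists (s i).
move=> h hT; have [w [w0 w1 w2 w3]] := H _ (conjrc _ hT).
pose v i j := Re (w i j).
have wE i j : w i j = rc (v i j).
  by rewrite /v RRe_real //; apply: ger0_real; case: (w0 i j).
exists v; split.
- move=> i j; have [] := w0 i j; rewrite !wE ler0c => ? e; split=> //.
  exact: complexI e.
- apply: (@complexI R); rewrite -[LHS](trace_map_mx rc) map_mxM /= w1 raddf_sum.
  by apply: eq_bigr => i _; rewrite raddf_sum; apply: eq_bigr => j _; rewrite wE.
- apply: (@complexI R); rewrite -[LHS](trace_map_mx rc) !map_mxM /= w2 raddf_sum.
  apply: eq_bigr => i _; rewrite raddf_sum; apply: eq_bigr => j _.
  by rewrite wE sE -[RHS]/(rc (_ * _)) [RHS](rmorphM rc).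
- apply: (@complexI R); rewrite -[LHS](trace_map_mx rc) !map_mxM /= w3 raddf_sum.
  apply: eq_bigr => i _; rewrite raddf_sum; apply: eq_bigr => j _.
  by rewrite wE !sE -[RHS]/(rc (_ * _)) [RHS](rmorphM rc) (rmorphM rc).
Qed.
End RealSpectral.

Section PointwiseBound.
Context {R : realType} {n : nat}.

(** With E = tr D - D, the quadratic form below is at most
    (tr D)^-1 (|h|^2 (tr D)^2 / 2 - tr (E h E h)), by the Cauchy-Schwarz
    inequality (tr (D h))^2 <= tr D tr (D h^2). The bound on the d_i gives
    E >= mu > tr D / sqrt 2, hence tr (E h E h) >= mu^2 |h|^2. *)
Lemma stability_quadratic_form (D S : 'M[R]_n) (d : 'I_n -> R) : D^T = D ->
  char_poly D = \prod_(i < n) ('X - (d i)%:P) ->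
  (forall i, 0 <= d i) ->
  (forall i, d i < (2 + Num.sqrt 2)^-1 * \tr D) ->
  D = \tr S *: S -> \tr D = (\tr S) ^+ 2 ->
  exists2 eps : R, 0 < eps & forall h : 'M[R]_n, h^T = h ->
    (form_dot S h) ^+ 2 - \tr (S *m h *m S *m h) + \tr (D *m h *m h)
      - \tr D / 2 * form_dot h h <= - eps * form_dot h h.
Proof.
move=> DT dE d0 dmax DS trD.
have [/eqP n0|n0] := eqVneq n 0%N.
  exists 1 => // h hT.
  have -> : h = 0 by apply/matrixP => i; have := ltn_ord i; rewrite [X in (_ < X)%N](eqP n0).
  rewrite !mulmx0 mxtrace0 !form_dotE trmx0 mulmx0 mxtrace0; lra.
have [sp spd H] := symmetric_weights DT dE.
set t := \tr D in dmax trD *.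
have tpos : 0 < t.
  have i0 : 'I_n by case: (n) n0 => // k _; exact: ord0.
  have q0 : 0 < (2 + Num.sqrt 2 : R)^-1 by rewrite invr_gt0 ltr_wpDr ?sqrtr_ge0.
  by rewrite -(pmulr_rgt0 _ q0); apply: le_lt_trans (d0 i0) (dmax i0).
set r := Num.sqrt (2 : R).
have r2 : r ^+ 2 = 2 by rewrite sqr_sqrtr.
have r0 : 0 < r by rewrite sqrtr_gt0.
have qE : (2 + r)^-1 = 1 - r^-1.
  apply: (mulfI (_ : 2 + r != 0)); first by rewrite gt_eqF// addr_gt0.
  rewrite divff ?gt_eqF ?addr_gt0 // mulrBr mulr1 mulrDl divff ?gt_eqF//.
  have -> : 2 / r = r by rewrite -r2 expr2 mulfK ?gt_eqF.
  ring.
have [mu [mu_gt mu_le]] : exists mu, t / r < mu /\ forall i, mu <= t - sp i.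
  exists (\big[Order.min/t]_i (t - sp i)); split; last first.
    by move=> i; exact: bigmin_le_cond.
  apply: lt_bigmin => [|i _].
    rewrite ltr_pdivrMr // ltr_pMr //.
    by rewrite -(ltr_pXn2r (n := 2)) ?nnegrE ?ltW // r2 expr1n; lra.
  have [j ->] := spd i; have := dmax j; rewrite -/r qE.
  lra.
exists (mu ^+ 2 / t - t / 2).
  rewrite subr_gt0 ltr_pdivlMr //.
  have : (t / r) ^+ 2 < mu ^+ 2.
    by rewrite ltr_pXn2r ?nnegrE // ?ltW ?divr_gt0 // (lt_trans _ mu_gt) ?divr_gt0.
  by rewrite expr_div_n r2; lra.
have D_psd k : k^T = k -> 0 <= \tr (D *m k *m k).
  move=> kT; have [w [w0 _ -> _]] := H _ kT.
  apply: sumr_ge0 => i _; apply: sumr_ge0 => j _; apply: mulr_ge0; last by case: (w0 i j).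
  by have [l ->] := spd i.
move=> h hT; have [w [w0 w1 w2 w3]] := H _ hT.
(* Cauchy-Schwarz: D is positive semidefinite on t h - x *)
have CS : (\tr (D *m h)) ^+ 2 <= t * \tr (D *m h *m h).
  set x := \tr (D *m h).
  have kT : (t *: h - x%:M)^T = t *: h - x%:M.
    by rewrite linearB linearZ /= hT tr_scalar_mx.
  have := D_psd _ kT.
  have -> : \tr (D *m (t *: h - x%:M) *m (t *: h - x%:M)) =
      t * (t * \tr (D *m h *m h) - x ^+ 2).
    rewrite !mulmxBr !mulmxBl -!scalemxAr !mul_mx_scalar -!scalemxAl.
    rewrite !(linearB mxtrace) /= !mxtraceZ -/x -/t; ring.
  by rewrite pmulr_rge0 // subr_ge0.
have hh : form_dot h h = \tr (h *m h) by rewrite form_dotE hT.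
have Sh : t * form_dot S h ^+ 2 <= t * \tr (D *m h *m h).
  apply: le_trans CS; rewrite trD -exprMn form_dotE hT DS -scalemxAl mxtraceZ.
  by [].
have DhDh : \tr (D *m h *m D *m h) = t * \tr (S *m h *m S *m h).
  by rewrite [in LHS]DS -!scalemxAr -!scalemxAl !mxtraceZ mulrA -expr2 -trD.
have key : mu ^+ 2 * \tr (h *m h) <= t ^+ 2 * \tr (h *m h)
    - 2 * t * \tr (D *m h *m h) + \tr (D *m h *m D *m h).
  have w2' : \tr (D *m h *m h) = \sum_i \sum_j sp j * w i j.
    rewrite w2 exchange_big; apply: eq_bigr => i _; apply: eq_bigr => j _ /=.
    by congr (_ * _); have [] := w0 j i.
  have -> : t ^+ 2 * \tr (h *m h) - 2 * t * \tr (D *m h *m h) + \tr (D *m h *m D *m h)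
      = \sum_i \sum_j (t - sp i) * (t - sp j) * w i j.
    transitivity (t ^+ 2 * \tr (h *m h) - t * \tr (D *m h *m h) - t * \tr (D *m h *m h)
       + \tr (D *m h *m D *m h)); first by ring.
    rewrite {1}w2 w2' w1 w3 !mulr_sumr -!sumrB -big_split; apply: eq_bigr => i _ /=.
    rewrite !mulr_sumr -!sumrB -big_split; apply: eq_bigr => j _ /=; ring.
  rewrite w1 mulr_sumr; apply: ler_sum => i _; rewrite mulr_sumr; apply: ler_sum => j _.
  apply: ler_wpM2r; first by case: (w0 i j).
  have mu0 : 0 <= mu by rewrite (le_trans _ (ltW mu_gt)) // divr_ge0 ?ltW.
  by rewrite expr2; apply: ler_pM.
rewrite hh -(ler_pM2l tpos).
rewrite DhDh in key.
have -> : t * (- (mu ^+ 2 / t - t / 2) * \tr (h *m h)) =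
    - (mu ^+ 2 - t ^+ 2 / 2) * \tr (h *m h) by field; rewrite gt_eqF.
rewrite !mulrDr; nra.
Qed.
End PointwiseBound.

(** * Covariant derivatives and the Bochner identity at a point *)

Section ConnectionAlgebra.
Context {R : realType} {n : nat}.
Variable c : 'I_n -> 'I_n -> 'I_n -> R.
Hypothesis c_anti : forall i j k, c i j k = - c j i k.
Local Notation G := (connection c).

(** The connection and curvature forms; in these terms
    nabla_i h = E_i h - G_i h - h G_i^T. *)
Definition connection_mx i : 'M[R]_n := \matrix_(j, k) G i j k.
Definition curvature_mx i j : 'M[R]_n := \matrix_(k, l) riemann c i j k l.

Lemma connection_skew i j k : G i j k = - G i k j.
Proof. by rewrite /connection (c_anti i j k) (c_anti j k i) (c_anti k i j); field. Qed.

Lemma connection_torsion i j k : G i j k - G j i k = c i j k.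
Proof. by rewrite /connection (c_anti j i k) (c_anti j k i) (c_anti k i j); field. Qed.

Lemma connection_mx_skew i : (connection_mx i)^T = - connection_mx i.
Proof. by apply/matrixP => j k; rewrite !mxE connection_skew. Qed.

(** The vector sum_k nabla_k e_k is dual to the trace of ad, hence vanishes for
    unimodular algebras. *)
Lemma connection_trace l : \tr (ad_mx c l) = 0 -> \sum_k G k k l = 0.
Proof.
move=> tr0; rewrite -[RHS]tr0; apply: eq_bigr => k _; rewrite mxE /connection.
have := c_anti k k l; rewrite (c_anti k l k); lra.
Qed.

(** The structure equation: as the connection forms have constant components,
    their derivatives contribute only the bracket term. *)
Lemma curvature_mxE i j : curvature_mx i j =
  connection_mx j *m connection_mx i - connection_mx i *m connection_mx j - \sum_p c i j p *: connection_mx p.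
Proof.
apply/matrixP => k l.
have subE (A B : 'M[R]_n) : (A - B) k l = A k l - B k l by rewrite !mxE.
rewrite !subE summxE [LHS]mxE /riemann !sumrB; congr (_ - _ - _).
- by rewrite mxE; apply: eq_bigr => p _; rewrite !mxE.
- by rewrite mxE; apply: eq_bigr => p _; rewrite !mxE.
- by apply: eq_bigr => p _; rewrite !mxE.
Qed.

Lemma curvature_mx_skew i j : (curvature_mx i j)^T = - curvature_mx i j.
Proof.
rewrite curvature_mxE !(raddfB (@trmx R n n)) /= !trmx_mul !connection_mx_skew.
have -> : (\sum_p c i j p *: connection_mx p)^T = - \sum_p c i j p *: connection_mx p.
  rewrite linear_sum -sumrN; apply: eq_bigr => p _.
  by rewrite linearZ /= connection_mx_skew scalerN.
rewrite !mulmxN !mulNmx !opprK.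
move: (connection_mx i *m connection_mx j) (connection_mx j *m connection_mx i) (\sum_p _) => A B C.
by apply/matrixP => a b; rewrite !mxE; ring.
Qed.

Lemma riemann_skew i j k l : riemann c i j k l = - riemann c i j l k.
Proof. by have := congr1 (fun M : 'M[R]_n => M l k) (curvature_mx_skew i j); rewrite !mxE. Qed.

(** u i and uu k i stand for the derivatives E_i h and E_k E_i h of the matrix
    of components, so that T i is nabla_i h and TT k i is the derivative
    nabla_k (T i) for fixed i. The terms which are not of order zero in h
    cancel except for the bracket [E_k, E_i]. *)
Lemma ricci_identity (h : 'M[R]_n) (u : 'I_n -> 'M[R]_n) (uu : 'I_n -> 'I_n -> 'M[R]_n) :
  (forall k i, uu k i - uu i k = \sum_l c k i l *: u l) ->
  let T i := u i - connection_mx i *m h - h *m (connection_mx i)^T in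
  let TT k i := uu k i - connection_mx i *m u k - u k *m (connection_mx i)^T
    - connection_mx k *m T i - T i *m (connection_mx k)^T in
  forall k i, TT k i - TT i k =
    \sum_l c k i l *: T l - curvature_mx k i *m h - h *m (curvature_mx k i)^T.
Proof.
move=> huu T TT k i.
have sumT : \sum_l c k i l *: T l = \sum_l c k i l *: u l
    - (\sum_l c k i l *: connection_mx l) *m h + h *m (\sum_l c k i l *: connection_mx l).
  rewrite mulmx_suml mulmx_sumr -sumrB -big_split /=; apply: eq_bigr => l _.
  by rewrite /T connection_mx_skew mulmxN opprK scalerDr scalerBr -scalemxAl -scalemxAr.
rewrite sumT -huu curvature_mx_skew mulmxN opprK curvature_mxE /TT /T !connection_mx_skew.
move: (\sum_p _) => C.
rewrite !(mulmxBr, mulmxBl, mulmxDr, mulmxDl, mulmxN, mulNmx, mulmxA).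
move: (uu k i) (uu i k) (connection_mx i *m u k) (u k *m connection_mx i) (connection_mx k *m u i) (u i *m connection_mx k).
move: (connection_mx k *m connection_mx i *m h) (connection_mx i *m connection_mx k *m h).
move: (connection_mx k *m h *m connection_mx i) (connection_mx i *m h *m connection_mx k).
move: (h *m connection_mx i *m connection_mx k) (h *m connection_mx k *m connection_mx i) (C *m h) (h *m C).
move=> x1 x2 x3 x4 x5 x6 x7 x8 x9 y1 y2 y3 y4 y5.
by apply/matrixP => a b; rewrite !mxE; ring.
Qed.

Hypothesis G_trace : forall l, \sum_k G k k l = 0.

Local Notation sum4 F := (\sum_k \sum_i \sum_j \sum_l F k i j l).

Lemma sum4_swap12 (F : 'I_n -> 'I_n -> 'I_n -> 'I_n -> R) :
  sum4 F = sum4 (fun k i j l => F i k j l).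
Proof. by rewrite exchange_big. Qed.

Lemma sum4_swap23 (F : 'I_n -> 'I_n -> 'I_n -> 'I_n -> R) :
  sum4 F = sum4 (fun k i j l => F k j i l).
Proof. by apply: eq_bigr => k _; rewrite exchange_big. Qed.

Lemma sum4_swap34 (F : 'I_n -> 'I_n -> 'I_n -> 'I_n -> R) :
  sum4 F = sum4 (fun k i j l => F k i l j).
Proof. by apply: eq_bigr => k _; apply: eq_bigr => i _; rewrite exchange_big. Qed.

Lemma sum4_swap24 (F : 'I_n -> 'I_n -> 'I_n -> 'I_n -> R) :
  sum4 F = sum4 (fun k i j l => F k l j i).
Proof. by rewrite sum4_swap34 sum4_swap23 sum4_swap34. Qed.

Lemma sum4D (F F' : 'I_n -> 'I_n -> 'I_n -> 'I_n -> R) :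
  sum4 (fun k i j l => F k i j l + F' k i j l) = sum4 F + sum4 F'.
Proof.
rewrite -big_split /=; apply: eq_bigr => k _; rewrite -big_split /=; apply: eq_bigr => i _.
by rewrite -big_split /=; apply: eq_bigr => j _; rewrite -big_split.
Qed.

Lemma sum4N (F : 'I_n -> 'I_n -> 'I_n -> 'I_n -> R) :
  sum4 (fun k i j l => - F k i j l) = - sum4 F.
Proof.
rewrite -sumrN; apply: eq_bigr => k _; rewrite -sumrN; apply: eq_bigr => i _.
by rewrite -sumrN; apply: eq_bigr => j _; rewrite -sumrN.
Qed.

Lemma eq_sum4 (F F' : 'I_n -> 'I_n -> 'I_n -> 'I_n -> R) :
  (forall k i j l, F k i j l = F' k i j l) -> sum4 F = sum4 F'.
Proof.
by move=> FF; apply: eq_bigr => k _; apply: eq_bigr => i _; apply: eq_bigr => j _;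
  apply: eq_bigr => l _.
Qed.

Lemma sum4_antisym34 (F : 'I_n -> 'I_n -> 'I_n -> 'I_n -> R) :
  (forall k i j l, F k i j l = - F k i l j) -> sum4 F = 0.
Proof.
move=> Fa; rewrite big1 // => k _; rewrite big1 // => i _.
by apply: sum_antisym => j l.
Qed.

Lemma sum4_trace (F : 'I_n -> 'I_n -> 'I_n -> 'I_n -> R) :
  (forall i j l, \sum_k F k i j l = 0) -> sum4 F = 0.
Proof.
move=> F0; rewrite exchange_big big1 // => i _.
rewrite exchange_big big1 // => j _.
by rewrite exchange_big big1.
Qed.

(** The divergence of Y_k = sum_ij (h_ij (nabla_i h)_kj - h_kj (nabla_i h)_ij).
    Here T i is nabla_i h, TT k i is nabla_k (T i) for fixed i, and Eh k, ET k i
    are the derivatives of the components of h and of T i along E_k. In the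
    second derivatives of h only a commutator appears, which produces the
    curvature terms. *)
Lemma bochner_divergence (h : 'M[R]_n) (T : 'I_n -> 'M[R]_n) (TT : 'I_n -> 'I_n -> 'M[R]_n)
    (Eh : 'I_n -> 'M[R]_n) (ET : 'I_n -> 'I_n -> 'M[R]_n) : h^T = h ->
  (forall k, Eh k = T k + connection_mx k *m h + h *m (connection_mx k)^T) ->
  (forall k i, ET k i = TT k i + connection_mx k *m T i + T i *m (connection_mx k)^T) ->
  (forall k i, TT k i - TT i k =
    \sum_l c k i l *: T l - curvature_mx k i *m h - h *m (curvature_mx k i)^T) ->
  \sum_k \sum_i \sum_j (Eh k i j * T i k j + h i j * ET k i k j
     - Eh k k j * T i i j - h k j * ET k i i j) =
  \sum_k \sum_i \sum_j (T k i j * T i k j) - \sum_k \sum_i \sum_j (T k k j * T i i j)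
  + \tr (ricci c *m h *m h) - form_dot (curvature_op c h) h.
Proof.
move=> hT EhE ETE TTE.
have hS i j : h i j = h j i by rewrite -{1}hT mxE.
have entry (A B : 'M[R]_n) k a b : (A + connection_mx k *m B + B *m (connection_mx k)^T) a b =
    A a b + \sum_l (G k a l * B l b + G k b l * B a l).
  rewrite mxE [in LHS]mxE -addrA; congr (_ + _); rewrite big_split /=; congr (_ + _).
    by rewrite mxE; apply: eq_bigr => l _; rewrite mxE.
  by rewrite mxE; apply: eq_bigr => l _; rewrite !mxE mulrC.
have expand k i j : Eh k i j * T i k j + h i j * ET k i k j
     - Eh k k j * T i i j - h k j * ET k i i j =
   T k i j * T i k j - T k k j * T i i j
   + (h i j * TT k i k j - h k j * TT k i i j)
   + \sum_l ((G k i l * h l j * T i k j - h k j * G k i l * T i l j)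
     + G k j l * (h i l * T i k j + h i j * T i k l)
     - G k j l * (h k l * T i i j + h k j * T i i l)
     + h i j * G k k l * T i l j - G k k l * h l j * T i i j).
  rewrite EhE !ETE !entry.
  have -> : \sum_l ((G k i l * h l j * T i k j - h k j * G k i l * T i l j)
     + G k j l * (h i l * T i k j + h i j * T i k l)
     - G k j l * (h k l * T i i j + h k j * T i i l)
     + h i j * G k k l * T i l j - G k k l * h l j * T i i j) =
    (\sum_l (G k i l * h l j + G k j l * h i l)) * T i k j
    + h i j * (\sum_l (G k k l * T i l j + G k j l * T i k l))
    - (\sum_l (G k k l * h l j + G k j l * h k l)) * T i i j
    - h k j * (\sum_l (G k i l * T i l j + G k j l * T i i l)).
    rewrite !mulr_suml !mulr_sumr -big_split -!sumrB /=.
    by apply: eq_bigr => l _; ring.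
  ring.
(* The connection terms disappear by skew-symmetry in the last two indices
   and by G_trace; the torsion leaves the term that cancels the bracket in
   the commutator of the covariant derivatives. *)
have conn : sum4 (fun k i j l => (G k i l * h l j * T i k j - h k j * G k i l * T i l j)
     + G k j l * (h i l * T i k j + h i j * T i k l)
     - G k j l * (h k l * T i i j + h k j * T i i l)
     + h i j * G k k l * T i l j - G k k l * h l j * T i i j) =
   - sum4 (fun k i j l => c k i l * (h i j * T l k j)).
  have split4 (F1 F2 F3 F4 F5 F6 : 'I_n -> 'I_n -> 'I_n -> 'I_n -> R) :
    sum4 (fun k i j l => (F1 k i j l - F2 k i j l) + F3 k i j l - F4 k i j l + F5 k i j l - F6 k i j l) =
    (sum4 F1 - sum4 F2) + sum4 F3 - sum4 F4 + sum4 F5 - sum4 F6.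
    by rewrite sum4D sum4N sum4D sum4D sum4N sum4D sum4D sum4N.
  have A1 : sum4 (fun k i j l => G k j l * (h i l * T i k j + h i j * T i k l)) = 0.
    by apply: sum4_antisym34 => k' i' j' l'; rewrite (connection_skew k' l' j'); ring.
  have A2 : sum4 (fun k i j l => G k j l * (h k l * T i i j + h k j * T i i l)) = 0.
    by apply: sum4_antisym34 => k' i' j' l'; rewrite (connection_skew k' l' j'); ring.
  have Z1 : sum4 (fun k i j l => h i j * G k k l * T i l j) = 0.
    apply: sum4_trace => i' j' l'.
    rewrite (eq_bigr (fun k => G k k l' * (h i' j' * T i' l' j'))) => [|k' _]; last by ring.
    by rewrite -mulr_suml G_trace mul0r.
  have Z2 : sum4 (fun k i j l => G k k l * h l j * T i i j) = 0.
    apply: sum4_trace => i' j' l'.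
    rewrite (eq_bigr (fun k => G k k l' * (h l' j' * T i' i' j'))) => [|k' _]; last by ring.
    by rewrite -mulr_suml G_trace mul0r.
  rewrite split4 A1 A2 Z1 Z2 !subr0 !addr0.
  have -> : sum4 (fun k i j l => G k i l * h l j * T i k j) = - sum4 (fun k i j l => G k i l * h i j * T l k j).
    rewrite sum4_swap24 -sum4N; apply: eq_sum4 => k' i' j' l'.
    by rewrite (connection_skew k' l' i'); ring.
  have -> : sum4 (fun k i j l => h k j * G k i l * T i l j) = - sum4 (fun k i j l => G i k l * h i j * T l k j).
    rewrite sum4_swap24 sum4_swap12 -sum4N; apply: eq_sum4 => k' i' j' l'.
    by rewrite (connection_skew i' l' k'); ring.
  rewrite opprK addrC -sum4N -sum4D -sum4N; apply: eq_sum4 => k' i' j' l'.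
  by rewrite -connection_torsion; ring.
have comm : \sum_k \sum_i \sum_j (h i j * TT k i k j - h k j * TT k i i j) =
    sum4 (fun k i j l => c k i l * (h i j * T l k j))
    + \tr (ricci c *m h *m h) - form_dot (curvature_op c h) h.
  have -> : \sum_k \sum_i \sum_j (h i j * TT k i k j - h k j * TT k i i j) =
      \sum_k \sum_i \sum_j h i j * (TT k i - TT i k) k j.
    transitivity (\sum_k \sum_i \sum_j h i j * TT k i k j - \sum_k \sum_i \sum_j h k j * TT k i i j).
      by rewrite -sumrB; apply: eq_bigr => k _; rewrite -sumrB; apply: eq_bigr => i _; rewrite -sumrB.
    rewrite [X in _ - X]exchange_big /= -sumrB; apply: eq_bigr => k _; rewrite -sumrB.
    apply: eq_bigr => i _; rewrite -sumrB; apply: eq_bigr => j _.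
    by rewrite [(TT k i - TT i k) k j]mxE [(- TT i k) k j]mxE; ring.
  have E k i j : h i j * (TT k i - TT i k) k j =
      \sum_l (c k i l * (h i j * T l k j) - h i j * riemann c k i k l * h l j
          - h i j * riemann c k i j l * h k l).
    rewrite TTE.
    have subE (A B C : 'M[R]_n) : (A - B - C) k j = A k j - B k j - C k j by rewrite !mxE.
    rewrite subE summxE !mulrBr !sumrB; congr (_ - _ - _).
    - by rewrite mulr_sumr; apply: eq_bigr => l _; rewrite mxE; ring.
    - by rewrite mxE mulr_sumr; apply: eq_bigr => l _; rewrite mxE; ring.
    - by rewrite mxE mulr_sumr; apply: eq_bigr => l _; rewrite !mxE; ring.
  transitivity (sum4 (fun k i j l => c k i l * (h i j * T l k j) - h i j * riemann c k i k l * h l j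
          - h i j * riemann c k i j l * h k l)).
    by apply: eq_bigr => k _; apply: eq_bigr => i _; apply: eq_bigr => j _; exact: E.
  rewrite sum4D sum4D !sum4N; congr (_ + _ - _).
    have -> : \tr (ricci c *m h *m h) = \sum_i \sum_j \sum_l ricci c i l * h l j * h j i.
      apply: eq_bigr => i _; rewrite mxE; apply: eq_bigr => j _.
      by rewrite mxE mulr_suml.
    rewrite -sum4N sum4_swap12; apply: eq_bigr => i _.
    rewrite exchange_big; apply: eq_bigr => j _; rewrite exchange_big; apply: eq_bigr => l _ /=.
    rewrite mxE !mulr_suml; apply: eq_bigr => k _.
    by rewrite (riemann_skew k i k l) (hS j i); ring.
  transitivity (sum4 (fun k l i j => h i j * riemann c k i j l * h k l)).
    by rewrite sum4_swap34 sum4_swap23.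
  apply: eq_bigr => k _; apply: eq_bigr => l _; rewrite mxE mulr_suml.
  apply: eq_bigr => i _; rewrite mulr_suml; apply: eq_bigr => j _.
  by rewrite [h i j * _]mulrC.
have split3 (F1 F2 F3 F4 : 'I_n -> 'I_n -> 'I_n -> R) :
    \sum_k \sum_i \sum_j (F1 k i j - F2 k i j + F3 k i j + F4 k i j) =
    \sum_k \sum_i \sum_j F1 k i j - \sum_k \sum_i \sum_j F2 k i j
    + \sum_k \sum_i \sum_j F3 k i j + \sum_k \sum_i \sum_j F4 k i j.
  rewrite -sumrB -!big_split /=; apply: eq_bigr => k _.
  rewrite -sumrB -!big_split /=; apply: eq_bigr => i _.
  by rewrite -sumrB -!big_split /=.
transitivity (\sum_k \sum_i \sum_j (T k i j * T i k j - T k k j * T i i j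
   + (h i j * TT k i k j - h k j * TT k i i j)
   + \sum_l ((G k i l * h l j * T i k j - h k j * G k i l * T i l j)
     + G k j l * (h i l * T i k j + h i j * T i k l)
     - G k j l * (h k l * T i i j + h k j * T i i l)
     + h i j * G k k l * T i l j - G k k l * h l j * T i i j))).
  by apply: eq_bigr => k _; apply: eq_bigr => i _; apply: eq_bigr => j _; exact: expand.
rewrite split3 conn comm; ring.
Qed.

(** The first sum is at most |T|^2 because the part of T skew in its first two
    slots has a nonnegative norm; the second is the norm of the divergence. *)
Lemma bochner_le (T : 'I_n -> 'M[R]_n) :
  \sum_k \sum_i \sum_j (T k i j * T i k j) - \sum_k \sum_i \sum_j (T k k j * T i i j)
    <= \sum_k form_dot (T k) (T k).
Proof.
have div_ge0 : 0 <= \sum_k \sum_i \sum_j (T k k j * T i i j).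
  have -> : \sum_k \sum_i \sum_j (T k k j * T i i j) = \sum_j (\sum_k T k k j) ^+ 2.
    rewrite exchange_big [RHS](eq_bigr (fun j => \sum_i \sum_k T k k j * T i i j)).
      by rewrite [RHS]exchange_big; apply: eq_bigr => i _; rewrite exchange_big.
    by move=> j _; rewrite expr2 mulr_sumr; apply: eq_bigr => i _; rewrite mulr_suml.
  by apply: sumr_ge0 => j _; exact: sqr_ge0.
have sq_ge0 : 0 <= \sum_k \sum_i \sum_j (T k i j - T i k j) ^+ 2.
  by do 3!(apply: sumr_ge0 => ? _); exact: sqr_ge0.
have sqE : \sum_k \sum_i \sum_j (T k i j - T i k j) ^+ 2 =
    (\sum_k form_dot (T k) (T k)) *+ 2 - (\sum_k \sum_i \sum_j (T k i j * T i k j)) *+ 2.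
  have swap : \sum_k \sum_i \sum_j T i k j * T i k j = \sum_k form_dot (T k) (T k).
    by rewrite exchange_big.
  rewrite !mulr2n -{2}swap /form_dot -!(sumrN, big_split) /=; apply: eq_bigr => k _.
  rewrite -!(sumrN, big_split) /=; apply: eq_bigr => i _.
  rewrite -!(sumrN, big_split) /=; apply: eq_bigr => j _; ring.
lra.
Qed.

End ConnectionAlgebra.

(** * Functions of class C^k *)

Import numFieldNormedType.Exports.
Local Open Scope classical_set_scope.
Local Open Scope ring_scope.

Lemma le_dist_half (R : realFieldType) (p q z e : R) :
  `|p - z| < e / 2 -> `|z - q| < e / 2 -> `|p - q| <= e.
Proof. by move=> h1 h2; have := ler_normD (p - z) (z - q); rewrite subrKA; lra. Qed.

Section Ck.
Context {R : realType}.

(** Iterated directional derivatives avoid partial derivatives in coordinates,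
    so the definition also serves on products of spaces. *)
Fixpoint Ck {V : normedModType R} (k : nat) (f : V -> R) : Prop :=
  match k with
  | 0 => continuous f
  | k'.+1 => (forall x, differentiable f x) /\ forall v, Ck k' ('D_v f)
  end.

Section Scalar.
Context {V : normedModType R}.
Implicit Types f g : V -> R.

Lemma Ck_continuous k f : Ck k f -> continuous f.
Proof. by case: k => // k [df _] x; exact: differentiable_continuous. Qed.

Lemma CkS k f : Ck k.+1 f -> Ck k f.
Proof.
elim: k f => [|k IHk] f; first exact: (@Ck_continuous 1).
by move=> [df Df]; split=> // v; exact: IHk.
Qed.

Lemma Ck_le k l f : (k <= l)%N -> Ck l f -> Ck k f.
Proof.
move=> /subnK <-; elim: (_ - _)%N => // m IHm H; apply: IHm; exact: CkS.
Qed.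

Lemma Ck_cst k (a : R) : Ck k (cst a : V -> R).
Proof.
elim: k a => [|k IHk] a; first by move=> x; exact: cst_continuous.
split=> [x|v]; first exact: differentiable_cst.
by have -> : 'D_v (cst a : V -> R) = cst 0 by apply/funext => x; rewrite derive_cst.
Qed.

Lemma Ck_add k f g : Ck k f -> Ck k g -> Ck k (fun x => f x + g x).
Proof.
elim: k f g => [|k IHk] f g; first by move=> cf cg x; apply: continuousD; [exact: cf|exact: cg].
move=> [df Df] [dg Dg]; split=> [x|v]; first exact: differentiableD.
have -> : 'D_v (fun x => f x + g x) = fun x => 'D_v f x + 'D_v g x.
  by apply/funext => x; rewrite (@deriveD _ _ _ f g) //; exact: diff_derivable.
exact: IHk (Df v) (Dg v).
Qed.

Lemma Ck_mul k f g : Ck k f -> Ck k g -> Ck k (fun x => f x * g x).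
Proof.
elim: k f g => [|k IHk] f g; first by move=> cf cg x; apply: continuousM; [exact: cf|exact: cg].
move=> Cf Cg; have [df Df] := Cf; have [dg Dg] := Cg.
split=> [x|v]; first exact: differentiableM.
have -> : 'D_v (fun x => f x * g x) = fun x => f x * 'D_v g x + g x * 'D_v f x.
  by apply/funext => x; rewrite (@deriveM _ _ f g) //; exact: diff_derivable.
apply: Ck_add; apply: IHk; by [exact: CkS | exact: Df | exact: Dg].
Qed.

Lemma Ck_scale k (a : R) f : Ck k f -> Ck k (fun x => a * f x).
Proof. by move=> Cf; apply: Ck_mul => //; exact: Ck_cst. Qed.

Lemma Ck_opp k f : Ck k f -> Ck k (fun x => - f x).
Proof.
move=> Cf; have -> : (fun x => - f x) = (fun x => -1 * f x).
  by apply/funext => x; rewrite mulN1r.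
exact: Ck_scale.
Qed.

Lemma Ck_sum k I (r : seq I) (P : pred I) (F : I -> V -> R) :
  (forall i, Ck k (F i)) -> Ck k (fun x => \sum_(i <- r | P i) F i x).
Proof.
move=> CF; elim: r => [|i r IHr].
  by under [X in Ck k X]funext do rewrite big_nil; exact: Ck_cst.
under [X in Ck k X]funext do rewrite big_cons.
by case: (P i) => //; apply: Ck_add.
Qed.

Lemma Ck_prod k I (r : seq I) (P : pred I) (F : I -> V -> R) :
  (forall i, Ck k (F i)) -> Ck k (fun x => \prod_(i <- r | P i) F i x).
Proof.
move=> CF; elim: r => [|i r IHr].
  by under [X in Ck k X]funext do rewrite big_nil; exact: Ck_cst.
under [X in Ck k X]funext do rewrite big_cons.
by case: (P i) => //; apply: Ck_mul.
Qed.

Lemma Ck_inv k f : (forall x, f x != 0) -> Ck k f -> Ck k (fun x => (f x)^-1).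
Proof.
move=> f0; elim: k => [|k IHk].
  by move=> cf x; apply: continuousV => //; exact: cf.
move=> Cf; have [df Df] := Cf; split=> [x|v]; first exact: differentiableV.
have -> : 'D_v (fun x => (f x)^-1) = fun x => - ((f x)^-1 * (f x)^-1 * 'D_v f x).
  apply/funext => x; rewrite (@deriveV _ _ f) //; last exact: diff_derivable.
  by rewrite -[_ *: _]/(_ * _) mulNr -exprVn expr2.
apply: Ck_opp; apply: Ck_mul; last exact: Df.
by apply: Ck_mul; apply: IHk; exact: CkS.
Qed.

Lemma differentiable_sum_fun I (r : seq I) (F : I -> V -> R) x :
  (forall i, differentiable (F i) x) -> differentiable (fun y => \sum_(i <- r) F i y) x.
Proof.
move=> dF; elim: r => [|i r IHr].
  by under eq_fun do rewrite big_nil; exact: differentiable_cst.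
by under eq_fun do rewrite big_cons; apply: differentiableD.
Qed.

Lemma derive_sum_fun I (r : seq I) (F : I -> V -> R) x v :
  (forall i, differentiable (F i) x) ->
  'D_v (fun y => \sum_(i <- r) F i y) x = \sum_(i <- r) 'D_v (F i) x.
Proof.
move=> dF; elim: r => [|i r IHr].
  by under eq_fun do rewrite big_nil; rewrite big_nil; exact: derive_cst.
under eq_fun do rewrite big_cons.
rewrite (@deriveD _ _ _ (F i)) ?IHr ?big_cons //; apply: diff_derivable => //.
exact: differentiable_sum_fun.
Qed.

Lemma derive_linear_comb (f : V -> R) x n (a : 'I_n -> R) (v : 'I_n -> V) :
  differentiable f x ->
  'D_(\sum_i a i *: v i) f x = \sum_i a i * 'D_(v i) f x.
Proof.
move=> df; rewrite deriveE // linear_sum; apply: eq_bigr => i _.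
by rewrite linearZ /= -deriveE.
Qed.

Lemma derivative_along_line (f : V -> R) (y v : V) (t : R) :
  differentiable f (y + t *: v) ->
  is_derive t 1 (fun s : R => f (y + s *: v)) ('D_v f (y + t *: v)).
Proof.
move=> /(@diff_derivable _ _ _ f _ v) dv.
have E : (fun h : R => h^-1 *: (((fun s : R => f (y + s *: v)) \o shift t) (h *: 1) - f (y + t *: v)))
  = (fun h => h^-1 *: ((f \o shift (y + t *: v)) (h *: v) - f (y + t *: v))).
  apply/funext => h /=; congr (_ *: (f _ - _)).
  by rewrite -[h *: 1]/(h * 1) mulr1 scalerDl addrCA.
by split; rewrite /derivable /derive E.
Qed.

Lemma mean_value (f : V -> R) (y v : V) (s : R) : 0 < s -> (forall x, differentiable f x) ->
  exists2 r, 0 < r < s & f (y + s *: v) - f y = s * 'D_v f (y + r *: v).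
Proof.
move=> s0 df.
have [||r] := @MVT R (fun t => f (y + t *: v)) (fun t => 'D_v f (y + t *: v)) 0 s s0.
- by move=> t _; exact: derivative_along_line.
- apply: continuous_subspaceT => t.
  apply: differentiable_continuous; apply/derivable1_diffP.
  by have [] := derivative_along_line (df (y + t *: v)).
rewrite in_itv /= => rs; rewrite scale0r addr0 subr0 mulrC => E.
by exists r.
Qed.

(** Both mixed derivatives are limits of the same second difference of f, by
    the mean value theorem applied twice. *)
Lemma schwarz (f : V -> R) (u v : V) x : Ck 2 f -> 'D_u ('D_v f) x = 'D_v ('D_u f) x.
Proof.
move=> [df Df].
have [dDv DDv] := Df v; have [dDu DDu] := Df u.
have cvu : continuous ('D_u ('D_v f)) by exact: DDv.
have cuv : continuous ('D_v ('D_u f)) by exact: DDu.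
apply/eqP; rewrite -subr_eq0 -normr_le0; apply/ler_addgt0Pr => e e0; rewrite add0r.
have e20 : 0 < e / 2 by rewrite divr_gt0.
have [d /= d0 Hd] : exists2 d : R, 0 < d & forall w, `|x - w| < d ->
    `|'D_u ('D_v f) x - 'D_u ('D_v f) w| < e / 2 /\
    `|'D_v ('D_u f) x - 'D_v ('D_u f) w| < e / 2.
  have /cvgrPdist_lt /(_ _ e20) n1 := cvu x.
  have /cvgrPdist_lt /(_ _ e20) n2 := cuv x.
  have [d /= d0 sub] := (nbhs_normP _ _).1 (filterI n1 n2).
  by exists d => // w xw; exact: sub.
pose s := d / (`|u| + `|v| + 1).
have N0 : 0 < `|u| + `|v| + 1 by rewrite ltr_wpDl ?addr_ge0.
have s0 : 0 < s by rewrite divr_gt0.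
have close a b : 0 < a < s -> 0 < b < s -> `|x - (x + a *: u + b *: v)| < d.
  move=> /andP[a0 as_] /andP[b0 bs].
  rewrite -addrA opprD addNKr normrN (le_lt_trans (ler_normD _ _)) // !normrZ.
  rewrite !gtr0_norm //.
  have -> : d = s * `|u| + s * `|v| + s.
    by rewrite /s; field; rewrite gt_eqF.
  apply: (@le_lt_trans _ _ (s * `|u| + s * `|v|)); last by rewrite ltrDl.
  by apply: lerD; apply: ler_wpM2r => //; exact: ltW.
clearbody s.
(* The second difference of f equals s^2 times a mixed derivative nearby; the
   order of the differences decides which one. *)
have second w1 w2 : (forall z, differentiable ('D_w1 f) z) ->
    exists a b, [/\ 0 < a < s, 0 < b < s &
      f (x + s *: w1 + s *: w2) - f (x + s *: w1) - (f (x + s *: w2) - f x) =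
      s ^+ 2 * 'D_w2 ('D_w1 f) (x + a *: w1 + b *: w2)].
  move=> dw1; pose phi z := f (z + s *: w2) - f z.
  have dshift z : differentiable (fun z => f (z + s *: w2)) z.
    by apply: (@differentiable_comp _ _ _ _ (fun z => z + s *: w2) f).
  have dphi z : differentiable phi z.
    by apply: (@differentiableB _ _ _ (fun z => f (z + s *: w2)) f).
  have Dphi z : 'D_w1 phi z = 'D_w1 f (z + s *: w2) - 'D_w1 f z.
    have dsh : 'D_w1 (fun z => f (z + s *: w2)) z = 'D_w1 f (z + s *: w2).
      have E : (fun h : R => h^-1 *: (((fun z => f (z + s *: w2)) \o shift z) (h *: w1) - f (z + s *: w2)))
        = (fun h => h^-1 *: ((f \o shift (z + s *: w2)) (h *: w1) - f (z + s *: w2))).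
        by apply/funext => h /=; rewrite addrA.
      by rewrite /derive E.
    by rewrite (@deriveB _ _ _ (fun z => f (z + s *: w2)) f) ?dsh //;
      apply: diff_derivable.
  have [a as_ Ea] := mean_value x w1 s0 dphi.
  have [b bs Eb] := mean_value (x + a *: w1) w2 s0 dw1.
  exists a, b; split=> //.
  rewrite -[X in X - _ = _]/(phi (x + s *: w1)) -/(phi x) Ea Dphi Eb; ring.
have [a [b [as_ bs E1]]] := second u v dDu.
have [a' [b' [as' bs' E2]]] := second v u dDv.
have E : 'D_v ('D_u f) (x + a *: u + b *: v) = 'D_u ('D_v f) (x + b' *: u + a' *: v).
  apply: (mulfI (_ : s ^+ 2 != 0)); first by rewrite expf_neq0 // gt_eqF.
  apply: etrans (esym E1) _; rewrite [x + b' *: u + _]addrAC; apply: etrans E2.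
  rewrite [x + s *: v + _]addrAC.
  by move: (f (x + s *: u + s *: v)) (f (x + s *: u)) (f (x + s *: v)) (f x) => *; ring.
have [_ h1] := Hd _ (close _ _ as_ bs).
have [h2 _] := Hd _ (close _ _ bs' as').
rewrite E distrC in h1.
exact: le_dist_half h2 h1.
Qed.

End Scalar.

Lemma derive_comp (V W U : normedModType R) (g : V -> W) (f : W -> U) x v :
  differentiable g x -> differentiable f (g x) ->
  'D_v (f \o g) x = 'D_('D_v g x) f (g x).
Proof.
move=> dg df.
by rewrite (deriveE v (differentiable_comp dg df)) (diff_comp dg df) (deriveE v dg) (deriveE _ df).
Qed.

Lemma derive_along_curve (V : normedModType R) (g : R^o -> V) (f : V -> R) (t : R) y w :
  differentiable g t -> g t = y -> 'D_(1 : R^o) g t = w -> differentiable f y ->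
  is_derive t (1 : R) (fun s : R => f (g s)) ('D_w f y).
Proof.
move=> dg <- <- df; split; last exact: (derive_comp (1 : R^o) dg df).
by apply: diff_derivable; exact: (differentiable_comp dg df).
Qed.

Lemma Ck_comp_affine (V W : normedModType R) (A : V -> W) (B : V -> W) k (f : W -> R) :
  (forall x, differentiable A x) -> (forall v x, 'D_v A x = B v) ->
  Ck k f -> Ck k (f \o A).
Proof.
move=> dA AB; elim: k f => [|k IHk] f.
  by move=> cf x; apply: continuous_comp; [exact: differentiable_continuous|exact: cf].
move=> [df Df]; split=> [x|v]; first exact: differentiable_comp.
have -> : 'D_v (f \o A) = 'D_(B v) f \o A.
  by apply/funext => x; rewrite derive_comp // AB.
exact: IHk (Df _).
Qed.

Lemma derive_entry (V : normedModType R) m n (f : V -> 'M[R]_(m, n)) x v i j :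
  differentiable f x -> ('D_v f x) i j = 'D_v (fun y => f y i j) x.
Proof. by move=> df; rewrite derive_mx ?mxE //; exact: diff_derivable. Qed.

Lemma differentiable_entry (V : normedModType R) m n (f : V -> 'M[R]_(m, n)) x i j :
  differentiable f x -> differentiable (fun y => f y i j) x.
Proof.
move=> df; apply: (@differentiable_comp _ _ _ _ f (fun N => N i j)) => //.
exact: differentiable_coord.
Qed.

Lemma differentiable_entries (V : normedModType R) m n (f : V -> 'M[R]_(m, n)) x :
  (forall i j, differentiable (fun y => f y i j) x) -> differentiable f x.
Proof.
move=> df; have -> : f = \sum_(i < m) \sum_(j < n) (fun y => f y i j *: delta_mx i j).
  apply/funext => y; rewrite fct_sumE {1}(matrix_sum_delta (f y)).
  by apply: eq_bigr => i _; rewrite fct_sumE.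
apply: differentiable_sum => i; apply: differentiable_sum => j.
exact: differentiableZl.
Qed.

Lemma smooth_derive (V W : normedModType R) (f : V -> W) v :
  smooth f -> smooth ('D_v f).
Proof. by move=> sf s x; have := sf (rcons s v) x; rewrite foldr_rcons. Qed.

Lemma smooth_differentiable (V W : normedModType R) (f : V -> W) x :
  smooth f -> differentiable f x.
Proof. by move=> sf; exact: (sf [::]). Qed.

Lemma smooth_Ck (V : normedModType R) m n (f : V -> 'M[R]_(m, n)) i j k :
  smooth f -> Ck k (fun x => f x i j).
Proof.
elim: k f => [|k IHk] f sf.
  move=> x; apply: differentiable_continuous; apply: differentiable_entry.
  exact: smooth_differentiable.
split=> [x|v]; first by apply: differentiable_entry; exact: smooth_differentiable.
have -> : 'D_v (fun x => f x i j) = fun x => 'D_v f x i j.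
  by apply/funext => x; rewrite derive_entry //; exact: smooth_differentiable.
by apply: IHk; exact: smooth_derive.
Qed.

Lemma derive_pairl (V W : normedModType R) (b : W) (x v : V) :
  'D_v (fun y => (y, b)) x = (v, 0).
Proof.
rewrite deriveE; last by apply: differentiable_pair.
by rewrite diff_pair //= diff_val diff_cst.
Qed.

Lemma derive_pairr (V W : normedModType R) (b : W) (x v : V) :
  'D_v (fun y => (b, y)) x = (0, v).
Proof.
rewrite deriveE; last by apply: differentiable_pair.
by rewrite diff_pair //= !diff_val.
Qed.

Lemma derive_rowE n (f : 'rV[R]_n -> R) x v : differentiable f x ->
  'D_v f x = \sum_i v 0 i * 'D_(delta_mx 0 i) f x.
Proof. by move=> df; rewrite {1}(row_sum_delta v) derive_linear_comb. Qed.

End Ck.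

(** * The iterated integral *)

Section Integral1.
Context {R : realType}.
Notation mu := (@lebesgue_measure R).
Implicit Types (f g : R -> R) (M : R).

(** Compact support is recorded by the radius of a ball, which makes it stable
    under slicing and differentiation. *)
Definition vanishes {V : normedModType R} M (f : V -> R) := forall x, M < `|x| -> f x = 0.

Lemma vanishes_restrict f M a b : vanishes M f -> a <= - M -> M <= b -> f \_ `[a, b] = f.
Proof.
move=> vf aM Mb; apply/funext => t; rewrite patchE; case: ifPn => // tab.
apply/esym/vf; rewrite ltNge; apply: contra tab; rewrite ler_norml => /andP[? ?].
by rewrite inE /= in_itv /= (le_trans aM) //= (le_trans _ Mb).
Qed.

Lemma vanishes_integrable f M : continuous f -> vanishes M f ->
  mu.-integrable setT (EFin \o f).
Proof.
move=> cf vf; rewrite -(vanishes_restrict vf (lexx _) (lexx _)) -restrict_EFin.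
apply/(integrable_mkcond _ _).1; first exact: measurable_itv.
apply: continuous_compact_integrable; first exact: segment_compact.
exact: continuous_subspaceT.
Qed.

Lemma Rintegral_vanishes f M a b : vanishes M f -> a <= - M -> M <= b ->
  Rintegral mu setT f = Rintegral mu `[a, b] f.
Proof. by move=> vf aM Mb; rewrite [RHS]Rintegral_mkcond (vanishes_restrict vf). Qed.

Lemma Rintegral_bound f M K : 0 <= M -> continuous f -> vanishes M f ->
  (forall t, `|f t| <= K) -> `|Rintegral mu setT f| <= 2 * M * K.
Proof.
move=> M0 cf vf fK; rewrite (Rintegral_vanishes vf (lexx _) (lexx _)).
have intf : mu.-integrable `[- M, M] (EFin \o f).
  by apply: integrableS (vanishes_integrable cf vf).
apply: le_trans (le_normr_Rintegral _ intf) _ => //.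
have intK : mu.-integrable `[- M, M] (EFin \o cst K).
  apply: continuous_compact_integrable; first exact: segment_compact.
  by apply: continuous_subspaceT; exact: cst_continuous.
have intn : mu.-integrable `[- M, M] (EFin \o (fun t => `|f t|)).
  apply: continuous_compact_integrable; first exact: segment_compact.
  by apply: continuous_subspaceT => t; apply: continuous_comp; [exact: cf|exact: norm_continuous].
have le1 : Rintegral mu `[- M, M] (fun t => `|f t|) <= Rintegral mu `[- M, M] (cst K).
  by apply: le_Rintegral intn intK _ => // t _; exact: fK.
apply: le_trans le1 _; rewrite Rintegral_cst //.
have E : fine (mu `[- M, M]) = 2 * M.
  rewrite lebesgue_measure_itv /= lte_fin.
  case: ltP => [_|MM] /=; first by rewrite opprK; lra.
  have -> : M = 0 by lra.
  by rewrite mulr0.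
by rewrite [X in K * X]E mulrC.
Qed.

(** The substitution rule on an interval containing both supports. *)
Lemma Rintegral_translation f M s : continuous f -> 0 <= M -> vanishes M f ->
  Rintegral mu setT (fun t => f (t + s)) = Rintegral mu setT f.
Proof.
move=> cf M0 vf; pose N := M + `|s|.
have vfs : vanishes N (fun t => f (t + s)).
  by move=> t Nt; apply: vf; have := lerB_normD t s; rewrite /N in Nt; lra.
have sN := ler_norm s; have sN' := ler_normr (- s) s.
rewrite (Rintegral_vanishes vfs (lexx _) (lexx _)).
rewrite (@Rintegral_vanishes f M (- N + s) (N + s)) //; first last.
- by have := ler_norm (- s); rewrite normrN /N; lra.
- by rewrite /N; lra.
congr fine.
pose F (t : R) := t + s.
have dF (t : R) : is_derive t (1 : R) F (1 : R).
  have -> : F = id + cst s by [].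
  by have := is_deriveD (is_derive_id t (1 : R)) (is_derive_cst s t (1 : R)); rewrite addr0.
have F'1 : derive1 F = cst 1.
  by apply/funext => t; rewrite derive1E; have [] := dF t.
have := @integration_by_substitution_increasing R F f (- N) N.
rewrite F'1 => ->.
- by apply: eq_integral => t _ /=; rewrite mulr1.
- by rewrite /N; have := normr_ge0 s; lra.
- by move=> x y _ _; rewrite /F ltrD2r.
- by move=> x _; exact: cst_continuous.
- by apply: is_cvg_cst.
- by apply: is_cvg_cst.
- split.
  + by move=> x _; have [] := dF x.
  + apply: cvg_at_right_filter; apply: differentiable_continuous; apply/derivable1_diffP.
    by have [] := dF (- N).
  + apply: cvg_at_left_filter; apply: differentiable_continuous; apply/derivable1_diffP.
    by have [] := dF N.
- exact: continuous_subspaceT.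
Qed.
End Integral1.

Section IntegralRow.
Context {R : realType}.
Notation mu := (@lebesgue_measure R).

Lemma entry_le_norm n (x : 'rV[R]_n) j : `|x 0 j| <= `|x|.
Proof.
rewrite [leRHS]/Num.Def.normr /= mx_normrE.
by apply/bigmax_geP; right => /=; exists (0, j).
Qed.

Lemma norm_rV_le n (x : 'rV[R]_n) K : 0 <= K -> (forall j, `|x 0 j| <= K) -> `|x| <= K.
Proof.
move=> K0 xK; rewrite [leLHS]/Num.Def.normr /= mx_normrE.
by apply: bigmax_le => // -[i j] _ /=; rewrite ord1.
Qed.

Lemma consE0 n (t : R) (v : 'rV[R]_n) : (row_mx t%:M v : 'rV_n.+1) 0 ord0 = t.
Proof.
have E : lshift n (0 : 'I_1) = ord0 by apply: val_inj.
by have := row_mxEl (t%:M : 'rV_1) v 0 (0 : 'I_1); rewrite E [t%:M _ _]mxE mulr1n.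
Qed.

Lemma consES n (t : R) (v : 'rV[R]_n) j : (row_mx t%:M v : 'rV_n.+1) 0 (lift ord0 j) = v 0 j.
Proof.
have E : rshift 1 j = lift ord0 j by apply: val_inj.
by have := row_mxEr (t%:M : 'rV_1) v 0 j; rewrite E.
Qed.

Lemma norm_cons_le n (t : R) (v : 'rV[R]_n) K : 0 <= K -> `|t| <= K -> `|v| <= K ->
  `|row_mx t%:M v : 'rV_n.+1| <= K.
Proof.
move=> K0 tK vK; apply: norm_rV_le => // j.
case: (unliftP ord0 j) => [j'|] ->; last by rewrite consE0.
by rewrite consES (le_trans (entry_le_norm _ _)).
Qed.

Lemma norm_cons_ge0 n (t : R) (v : 'rV[R]_n) : `|t| <= `|row_mx t%:M v : 'rV_n.+1|.
Proof. by rewrite -{1}(consE0 t v) entry_le_norm. Qed.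

Lemma norm_cons_geS n (t : R) (v : 'rV[R]_n) : `|v| <= `|row_mx t%:M v : 'rV_n.+1|.
Proof. by apply: norm_rV_le => // j; rewrite -(consES t v) entry_le_norm. Qed.

Lemma consB n (t s : R) (v w : 'rV[R]_n) :
  row_mx t%:M v - row_mx s%:M w = row_mx (t - s)%:M (v - w) :> 'rV_n.+1.
Proof.
have subE m (A B : 'rV[R]_m) j : (A - B) 0 j = A 0 j - B 0 j by rewrite !mxE.
apply/rowP => j; rewrite subE; case: (unliftP ord0 j) => [j'|] ->.
  by rewrite !consES subE.
by rewrite !consE0.
Qed.

Lemma consD n (t s : R) (v w : 'rV[R]_n) :
  row_mx t%:M v + row_mx s%:M w = row_mx (t + s)%:M (v + w) :> 'rV_n.+1.
Proof.
have addE m (A B : 'rV[R]_m) j : (A + B) 0 j = A 0 j + B 0 j by rewrite !mxE.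
apply/rowP => j; rewrite addE; case: (unliftP ord0 j) => [j'|] ->.
  by rewrite !consES addE.
by rewrite !consE0.
Qed.

(** Heine-Cantor on the ball of radius M + 1; two points at distance less than
    1, one of which is outside this ball, are both outside the support. *)
Lemma uniform_continuity n (f : 'rV[R]_n -> R) (M e : R) : continuous f -> vanishes M f ->
  0 < e -> exists2 d : R, 0 < d & forall x y, `|x - y| < d -> `|f x - f y| < e.
Proof.
move=> cf vf e0.
have cK : compact [set x : 'rV[R]_n | `|x| <= M + 1].
  apply: bounded_closed_compact; last first.
    by apply: (@closed_comp _ _ (fun x : 'rV[R]_n => `|x|) [set r | r <= M + 1]);
      [move=> x _; exact: norm_continuous | exact: closed_le].
  exists (M + 1); split; first exact: num_real.
  by move=> r Mr x /= xM; exact: le_trans xM (ltW Mr).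
have e20 : 0 < e / 2 by rewrite divr_gt0.
have /compact_near_coveringP/(_ R (0^'+)
  (fun d x => forall y, `|x - y| < d -> `|f x - f y| < e)) := cK.
have step x : `|x| <= M + 1 ->
    \forall x' \near x & d \near (0 : R)^'+, forall y, `|x' - y| < d -> `|f x' - f y| < e.
  move=> _; have /cvgrPdist_lt /(_ _ e20) /(nbhs_normP _ _).1 [r /= r0 Hr] := cf x.
  have r20 : 0 < r / 2 by rewrite divr_gt0.
  exists ([set x' | `|x - x'| < r / 2], [set d | d < r / 2]); last first.
    move=> [x' d] [/= xx' dr] y xy.
    have h1 : `|f x - f x'| < e / 2 by apply: Hr => /=; lra.
    have h2 : `|f x - f y| < e / 2.
      by apply: Hr => /=; have := ler_distD x' x y; lra.
    by rewrite distrC in h1; have := ler_distD (f x) (f x') (f y); lra.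
  split => /=; last exact: nbhs_right_lt.
  by apply: (nbhs_normP x _).2; exists (r / 2).
move=> /(_ _ step) near0.
have : \forall d \near (0 : R)^'+, [/\ 0 < d, d < 1 & [set x | `|x| <= M + 1] `<=`
   (fun x => forall y, `|x - y| < d -> `|f x - f y| < e)].
  near=> d; split; near: d.
  - exact: nbhs_right_gt.
  - exact: nbhs_right_lt.
  - exact: near0.
move=> /filter_ex [d [d0 d1 H]]; exists d => // x y xy.
have [xM|Mx] := leP `|x| (M + 1); first exact: H.
rewrite (vf x) ?(vf y) ?subrr ?normr0 //.
  by have := lerB_dist x y; lra.
by lra.
Unshelve. all: by end_near. Qed.

Definition slice n (f : 'rV[R]_n.+1 -> R) (t : R) (v : 'rV[R]_n) : R :=
  f (row_mx t%:M v).

Lemma cons_differentiable n t (v : 'rV[R]_n) :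
  differentiable (fun v : 'rV[R]_n => row_mx t%:M v : 'rV[R]_n.+1) v.
Proof.
have -> : (fun v : 'rV[R]_n => row_mx t%:M v : 'rV[R]_n.+1) =
    cst (row_mx t%:M 0 : 'rV[R]_n.+1) +
    \sum_(j < n) (fun v : 'rV[R]_n => v 0 j *: (delta_mx 0 (lift ord0 j) : 'rV[R]_n.+1)).
  apply/funext => w; rewrite -[RHS]/(_ + _) fct_sumE /=; apply/rowP => k.
  rewrite [in RHS]mxE summxE; case: (unliftP ord0 k) => [k'|] ->.
    rewrite !consES mxE add0r (bigD1 k') //= !mxE !eqxx /= mulr1 big1 ?addr0 //.
    by move=> j jk; rewrite !mxE (inj_eq lift_inj) eq_sym (negPf jk) mulr0.
  by rewrite !consE0 big1 ?addr0 // => j _; rewrite !mxE mulr0.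
apply: differentiableD; first exact: differentiable_cst.
apply: differentiable_sum => j; apply: differentiableZl.
exact: differentiable_coord.
Qed.

Lemma cons_continuous n t : continuous (fun v : 'rV[R]_n => row_mx t%:M v : 'rV[R]_n.+1).
Proof. by move=> v; apply: differentiable_continuous; exact: cons_differentiable. Qed.

Lemma slice_continuous n (f : 'rV[R]_n.+1 -> R) t : continuous f -> continuous (slice f t).
Proof.
move=> cf v; apply: (@continuous_comp _ _ _ (fun v => row_mx t%:M v : 'rV_n.+1) f); last exact: cf.
exact: cons_continuous.
Qed.

Lemma slice_vanishes n (f : 'rV[R]_n.+1 -> R) M t : vanishes M f -> vanishes M (slice f t).
Proof. by move=> vf v Mv; apply: vf; apply: lt_le_trans Mv (norm_cons_geS _ _). Qed.

Lemma slice_vanishes0 n (f : 'rV[R]_n.+1 -> R) M t : vanishes M f -> M < `|t| -> slice f t = fun=> 0.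
Proof. by move=> vf Mt; apply/funext => v; apply: vf; apply: lt_le_trans Mt (norm_cons_ge0 _ _). Qed.

Lemma integral_rVS n (f : 'rV[R]_n.+1 -> R) :
  integral_rV f = Rintegral mu setT (fun t => integral_rV (slice f t)).
Proof. by []. Qed.

(** The two properties of the iterated integral over a ball which its
    construction by induction on the dimension needs. *)
Definition bound_linear n (M : R) : Prop :=
  (forall (f : 'rV[R]_n -> R) (K : R), continuous f -> vanishes M f -> (forall x, `|f x| <= K) ->
     `|integral_rV f| <= (2 * M) ^+ n * K) /\
  (forall (a : R) (f g : 'rV[R]_n -> R), continuous f -> vanishes M f -> continuous g -> vanishes M g ->
     integral_rV (fun x => a * f x + g x) = a * integral_rV f + integral_rV g).

Lemma inner_vanishes n (M : R) (f : 'rV[R]_n.+1 -> R) : bound_linear n M ->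
  vanishes M f -> vanishes M (fun t => integral_rV (slice f t)).
Proof.
move=> [IHb _].
move=> vf t Mt; rewrite (slice_vanishes0 vf Mt).
apply/eqP; rewrite -normr_le0.
have c0 : continuous (fun _ : 'rV[R]_n => 0 : R) by move=> x; exact: cst_continuous.
have := IHb (fun=> 0) 0 c0 (fun _ _ => erefl).
by rewrite mulr0; apply => x; rewrite normr0.
Qed.

(** Uniform continuity of f bounds the variation of its slices, and the bound
    on integrals turns it into the continuity of the inner integral. *)
Lemma inner_continuous n (M : R) (f : 'rV[R]_n.+1 -> R) : 0 <= M -> bound_linear n M ->
  continuous f -> vanishes M f -> continuous (fun t => integral_rV (slice f t)).
Proof.
move=> M0 [IHb IHl].
move=> cf vf t; apply/cvgrPdist_lt => e e0.
pose C := (2 * M) ^+ n + 1.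
have C0 : 0 < C by rewrite ltr_wpDl // exprn_ge0 // mulr_ge0.
have eC0 : 0 < e / C by rewrite divr_gt0.
have [d d0 Hd] := uniform_continuity cf vf eC0.
have ht : \forall s \near t, `|t - s| < d.
  exact: (@cvgr_dist_lt _ _ _ (nbhs t) _ id t (@cvg_id _ _) d d0).
apply: filterS ht => s ts.
have cs u := @slice_continuous n f u cf.
have vs u := @slice_vanishes n f M u vf.
have -> : integral_rV (slice f t) - integral_rV (slice f s) =
   integral_rV (fun v => (-1) * slice f s v + slice f t v).
  by rewrite IHl // mulN1r addrC.
have cd : continuous (fun v => (-1) * slice f s v + slice f t v).
  move=> v; apply: (@continuousD _ _ _ (fun v => (-1) * slice f s v)); last exact: cs.
  by apply: (@continuousM _ _ (cst (-1)) (slice f s)); [exact: cst_continuous|exact: cs].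
have vd : vanishes M (fun v => (-1) * slice f s v + slice f t v).
  by move=> v Mv; rewrite !vs // mulr0 addr0.
apply: le_lt_trans (IHb _ (e / C) cd vd _) _.
  move=> v; rewrite mulN1r addrC; apply: ltW; apply: Hd.
  by rewrite consB subrr; apply: le_lt_trans ts; apply: norm_cons_le; rewrite ?normr0.
rewrite mulrA ltr_pdivrMr // mulrC ltr_pM2l // /C ltrDl; exact: ltr01.
Qed.

(** Bound and linearity are proved together: the continuity of the inner
    integral, needed to integrate it once more, rests on both. *)
Lemma integral_rV_bound_linear n (M : R) : 0 <= M -> bound_linear n M.
Proof.
move=> M0; elim: n => [|n IH].
  split=> [f K _ _ fK|a f g _ _ _ _]; last by [].
  by rewrite /= expr0 mul1r.
have [IHb IHl] := IH.
have sum0 f (vf : vanishes M f) := inner_vanishes IH vf.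
have sumc f (cf : continuous f) (vf : vanishes M f) := inner_continuous M0 IH cf vf.
split=> [f K cf vf fK|a f g cf vf cg vg].
  rewrite integral_rVS exprS -mulrA.
  apply: Rintegral_bound => //; [exact: sumc|exact: sum0|move=> t].
  by apply: IHb => // [|| x]; [exact: slice_continuous|exact: slice_vanishes|exact: fK].
rewrite !integral_rVS -RintegralZl //; last exact: vanishes_integrable (sumc _ cf vf) (sum0 _ vf).
rewrite -RintegralD //; first last.
- exact: vanishes_integrable (sumc _ cg vg) (sum0 _ vg).
- apply: (@vanishes_integrable _ _ M).
    move=> t; apply: (@continuousM _ _ (cst a)); first exact: cst_continuous.
    exact: sumc.
  by move=> t Mt; rewrite sum0 // mulr0.
apply: eq_Rintegral => t _; rewrite -IHl; [by []|..].
- exact: slice_continuous.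
- exact: slice_vanishes.
- exact: slice_continuous.
- exact: slice_vanishes.
Qed.
End IntegralRow.

(** * Differentiable functions with compact support *)

Section IntegralCc.
Context {R : realType}.

Lemma vanishes_le (V : normedModType R) (M N : R) (f : V -> R) :
  M <= N -> vanishes M f -> vanishes N f.
Proof. by move=> MN vf x Nx; apply: vf; exact: le_lt_trans Nx. Qed.

Lemma vanishes_derive (V : normedModType R) (M : R) (f : V -> R) v :
  vanishes M f -> vanishes M ('D_v f).
Proof.
move=> vf x Mx; rewrite (@near_eq_derive _ _ _ f (cst 0)) ?derive_cst //.
have : \forall y \near x, M < `|y|.
  by have /cvgr_gt := @norm_continuous _ V x; apply.
by apply: filterS => y; exact: vf.
Qed.

Lemma cons_surj n (x : 'rV[R]_n.+1) : exists t v, x = row_mx t%:M v.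
Proof.
exists (lsubmx (x : 'rV_(1 + n)) 0 0), (rsubmx (x : 'rV_(1 + n))).
by rewrite -mx11_scalar hsubmxK.
Qed.

Lemma integral_rV_continuous n (M : R) (f : 'rV[R]_n.+1 -> R) : 0 <= M ->
  continuous f -> vanishes M f ->
  continuous (fun t => integral_rV (slice f t)) /\
  vanishes M (fun t => integral_rV (slice f t)).
Proof.
move=> M0 cf vf; have IH := integral_rV_bound_linear n M0.
by split; [exact: (inner_continuous M0 IH)|exact: (inner_vanishes IH)].
Qed.

Lemma integral_rV_translation n (M : R) (f : 'rV[R]_n -> R) a : 0 <= M ->
  continuous f -> vanishes M f ->
  integral_rV (fun x => f (x + a)) = integral_rV f.
Proof.
move=> M0; elim: n f a => [|n IHn] f a cf vf.
  by rewrite /=; congr f; apply/rowP => -[].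
have [s [w ->]] := cons_surj a.
rewrite !integral_rVS.
have [Jc Jv] := integral_rV_continuous M0 cf vf.
rewrite -(Rintegral_translation s Jc M0 Jv).
apply: eq_Rintegral => t _.
rewrite -(IHn (slice f (t + s)) w); [|exact: slice_continuous|exact: slice_vanishes].
by congr integral_rV; apply/funext => v; rewrite /slice consD.
Qed.

(** The difference quotients (f (x + s v) - f x) / s integrate to zero by
    invariance under translations, and they converge uniformly to D_v f. *)
Lemma integral_rV_derive n (M : R) (f : 'rV[R]_n -> R) v : 0 <= M ->
  Ck 1 f -> vanishes M f -> integral_rV ('D_v f) = 0.
Proof.
move=> M0 [df cDf] vf.
have cf : continuous f by move=> x; exact: differentiable_continuous.
have vD := vanishes_derive v vf.
have cD : continuous ('D_v f) by exact: cDf.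
have N0 : 0 <= M + 1 by rewrite addr_ge0.
have [bnd lin] := integral_rV_bound_linear n N0.
apply/eqP; rewrite -normr_le0; apply/ler_addgt0Pr => e e0; rewrite add0r.
pose C := (2 * (M + 1)) ^+ n + 1.
have C0 : 0 < C by rewrite ltr_wpDl // exprn_ge0 // mulr_ge0.
have eC0 : 0 < e / C by rewrite divr_gt0.
have [d d0 Hd] := uniform_continuity cD vD eC0.
pose s := Num.min d 1 / (`|v| + 1).
have v1 : 0 < `|v| + 1 by rewrite ltr_wpDl.
have m0 : 0 < Num.min d 1 by rewrite lt_min d0 ltr01.
have s0 : 0 < s by rewrite divr_gt0.
have sv : s * `|v| < Num.min d 1.
  by rewrite /s mulrAC ltr_pdivrMr // ltr_pM2l // ltrDl.
have svd : s * `|v| < d by apply: lt_le_trans sv _; rewrite ge_min lexx.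
have sv1 : s * `|v| <= 1 by apply: ltW; apply: lt_le_trans sv _; rewrite ge_min lexx orbT.
pose fs x := f (x + s *: v).
have cfs : continuous fs.
  move=> x; apply: (@continuous_comp _ _ _ (fun x => x + s *: v) f); last exact: cf.
  by apply: differentiable_continuous.
have vfs : vanishes (M + 1) fs.
  move=> x Mx; apply: vf; have := lerB_normD x (s *: v).
  by rewrite normrZ (gtr0_norm s0); lra.
have vf1 : vanishes (M + 1) f by apply: vanishes_le vf; rewrite lerDl.
have vD1 : vanishes (M + 1) ('D_v f) by apply: vanishes_le vD; rewrite lerDl.
pose g x := (- s^-1) * f x + - 1 * 'D_v f x.
have cg : continuous (fun x => - 1 * 'D_v f x) := @Ck_scale _ _ 0 (-1) _ cD.
have vg : vanishes (M + 1) (fun x => - 1 * 'D_v f x).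
  by move=> x Mx; rewrite vD1 // mulr0.
have cg2 : continuous g := @Ck_add _ _ 0 _ _ (@Ck_scale _ _ 0 (- s^-1) _ cf) cg.
have vg2 : vanishes (M + 1) g by move=> x Mx; rewrite /g vf1 // mulr0 add0r vg.
have c0 : continuous (fun _ : 'rV[R]_n => 0 : R) by move=> x; exact: cst_continuous.
have v0 : vanishes (M + 1) (fun _ : 'rV[R]_n => 0 : R) by [].
have int0 : integral_rV (fun _ : 'rV[R]_n => 0 : R) = 0.
  by have := lin (-1) _ _ c0 v0 c0 v0; rewrite mulr0 addr0 mulN1r addNr => ->.
have E : integral_rV (fun x => s^-1 * fs x + g x) = - integral_rV ('D_v f).
  rewrite lin // /g lin // (integral_rV_translation _ N0 cf vf1).
  have -> : integral_rV (fun x => -1 * 'D_v f x) = - integral_rV ('D_v f).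
    have := lin (-1) ('D_v f) (fun=> 0) cD vD1 c0 v0; rewrite int0 addr0 mulN1r => <-.
    by congr integral_rV; apply/funext => x; rewrite addr0.
  by rewrite addrA -mulrDl subrr mul0r add0r.
rewrite -normrN -E.
have cgg : continuous (fun x => s^-1 * fs x + g x) :=
  @Ck_add _ _ 0 _ _ (@Ck_scale _ _ 0 s^-1 _ cfs) cg2.
have vgg : vanishes (M + 1) (fun x => s^-1 * fs x + g x).
  by move=> x Mx; rewrite vfs // vg2 // mulr0 addr0.
apply: (@le_trans _ _ ((2 * (M + 1)) ^+ n * (e / C))).
  apply: bnd => // x.
  have [r /andP[r0 rs] Er] := mean_value x v s0 df.
  have -> : s^-1 * fs x + g x = 'D_v f (x + r *: v) - 'D_v f x.
    have -> : s^-1 * fs x + g x = s^-1 * (fs x - f x) - 'D_v f x by rewrite /g; ring.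
    by rewrite /fs Er mulKf // gt_eqF.
  apply: ltW; apply: Hd.
  rewrite addrAC subrr add0r normrZ gtr0_norm //.
  by apply: le_lt_trans svd; apply: ler_wpM2r => //; exact: ltW.
rewrite mulrA ler_pdivrMr // mulrC ler_pM2l // /C lerDl; exact: ler01.
Qed.

Definition Cc n k (f : 'rV[R]_n -> R) : Prop :=
  Ck k f /\ exists M : R, 0 <= M /\ vanishes M f.

Section CcTheory.
Context {n : nat}.
Implicit Types f g : 'rV[R]_n -> R.

Lemma Cc_Ck k f : Cc k f -> Ck k f. Proof. by case. Qed.

Lemma Cc_le k l f : (k <= l)%N -> Cc l f -> Cc k f.
Proof. by move=> kl [Cf vf]; split=> //; exact: Ck_le kl Cf. Qed.

Lemma Cc_add k f g : Cc k f -> Cc k g -> Cc k (fun x => f x + g x).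
Proof.
move=> [Cf [M [M0 vf]]] [Cg [N [N0 vg]]]; split; first exact: Ck_add.
exists (M + N); split; first exact: addr_ge0.
move=> x MNx; rewrite (vanishes_le (_ : M <= M + N) vf) ?lerDl //.
by rewrite (vanishes_le (_ : N <= M + N) vg) ?lerDr // addr0.
Qed.

Lemma Cc_mul k f g : Ck k f -> Cc k g -> Cc k (fun x => f x * g x).
Proof.
move=> Cf [Cg [N [N0 vg]]]; split; first exact: Ck_mul.
by exists N; split=> // x Nx; rewrite vg // mulr0.
Qed.

Lemma Cc_scale k (a : R) f : Cc k f -> Cc k (fun x => a * f x).
Proof. by move=> Cf; apply: Cc_mul => //; exact: Ck_cst. Qed.

Lemma Cc_opp k f : Cc k f -> Cc k (fun x => - f x).
Proof.
move=> Cf; have -> : (fun x => - f x) = (fun x => -1 * f x).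
  by apply/funext => x; rewrite mulN1r.
exact: Cc_scale.
Qed.

Lemma Cc_sub k f g : Cc k f -> Cc k g -> Cc k (fun x => f x - g x).
Proof. by move=> Cf Cg; apply: Cc_add => //; exact: Cc_opp. Qed.

Lemma Cc0 k : Cc k (fun _ : 'rV[R]_n => 0).
Proof. by split; [exact: (@Ck_cst _ _ k 0)|exists 0]. Qed.

Lemma Cc_sum k I (r : seq I) (P : pred I) (F : I -> 'rV[R]_n -> R) :
  (forall i, Cc k (F i)) -> Cc k (fun x => \sum_(i <- r | P i) F i x).
Proof.
move=> CF; elim: r => [|i r IHr].
  by under [X in Cc k X]funext do rewrite big_nil; exact: Cc0.
under [X in Cc k X]funext do rewrite big_cons.
by case: (P i) => //; apply: Cc_add.
Qed.

Lemma Cc_derive k f v : Cc k.+1 f -> Cc k ('D_v f).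
Proof.
move=> [[_ Df] [M [M0 vf]]]; split; first exact: Df.
by exists M; split=> //; exact: vanishes_derive.
Qed.

Lemma integral_rV_linear k (a : R) f g : Cc k f -> Cc k g ->
  integral_rV (fun x => a * f x + g x) = a * integral_rV f + integral_rV g.
Proof.
move=> [/Ck_continuous cf [M [M0 vf]]] [/Ck_continuous cg [N [N0 vg]]].
have MN0 : 0 <= M + N by exact: addr_ge0.
have [_ lin] := integral_rV_bound_linear n MN0.
apply: lin => //; first by apply: vanishes_le vf; rewrite lerDl.
by apply: vanishes_le vg; rewrite lerDr.
Qed.

Lemma integral_rV0 : integral_rV (fun _ : 'rV[R]_n => 0 : R) = 0.
Proof.
have := integral_rV_linear (-1) (Cc0 0) (Cc0 0).
by under eq_fun do rewrite mulr0 addr0; rewrite mulN1r addNr.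
Qed.

Lemma integral_rVZ k (a : R) f : Cc k f -> integral_rV (fun x => a * f x) = a * integral_rV f.
Proof.
move=> Cf; have := integral_rV_linear a Cf (Cc0 k); rewrite integral_rV0 addr0 => <-.
by congr integral_rV; apply/funext => x; rewrite addr0.
Qed.

Lemma integral_rVD k f g : Cc k f -> Cc k g ->
  integral_rV (fun x => f x + g x) = integral_rV f + integral_rV g.
Proof.
move=> Cf Cg; have := integral_rV_linear 1 Cf Cg; rewrite mul1r => <-.
by congr integral_rV; apply/funext => x; rewrite mul1r.
Qed.

Lemma integral_rV_sum k I (r : seq I) (P : pred I) (F : I -> 'rV[R]_n -> R) :
  (forall i, Cc k (F i)) ->
  integral_rV (fun x => \sum_(i <- r | P i) F i x) = \sum_(i <- r | P i) integral_rV (F i).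
Proof.
move=> CF; elim: r => [|i r IHr].
  by rewrite big_nil -[RHS]integral_rV0; congr integral_rV; apply/funext => x; rewrite big_nil.
have -> : (fun x => \sum_(j <- i :: r | P j) F j x) =
  fun x => if P i then F i x + \sum_(j <- r | P j) F j x else \sum_(j <- r | P j) F j x.
  by apply/funext => x; rewrite big_cons.
rewrite big_cons; case: (P i) => //.
by rewrite (@integral_rVD k) ?IHr //; exact: Cc_sum.
Qed.

Lemma integral_rV_derive0 f v : Cc 1 f -> integral_rV ('D_v f) = 0.
Proof. by move=> [Cf [M [M0 vf]]]; exact: integral_rV_derive M0 Cf vf. Qed.

End CcTheory.

Lemma integral_rV_ge0 n (f : 'rV[R]_n -> R) : (forall x, 0 <= f x) -> 0 <= integral_rV f.
Proof.
elim: n f => [|n IHn] f f0; first exact: f0.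
by rewrite integral_rVS; apply: Rintegral_ge0 => t _; apply: IHn => v; exact: f0.
Qed.

Lemma compactly_supported_vanishes n (V : normedModType R) (h : 'rV[R]_n -> V) :
  compactly_supported h -> exists M : R, 0 <= M /\ forall x, M < `|x| -> h x = 0.
Proof.
move=> /compact_bounded [M [_ HM]]; exists (Num.max 0 (M + 1)); split.
  by rewrite le_max lexx.
move=> x xM; apply/eqP; apply/negPn/negP => hx0.
have : `|x| <= Num.max 0 (M + 1).
  apply: (HM (Num.max 0 (M + 1))); first by rewrite lt_max ltrDl ltr01 orbT.
  exact: subset_closure.
by rewrite leNgt xM.
Qed.

End IntegralCc.

(** * Left-invariant frames *)

Section Group.
Context {R : realType} {n : nat}.
Variable mul : 'rV[R]_n -> 'rV[R]_n -> 'rV[R]_n.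
Hypothesis mul_group : lie_group_law mul.
Local Notation E := (left_field mul).
Local Notation V := 'rV[R]_n.
Local Notation e_ i := (delta_mx 0 i : V).

Let mul_sm : smooth (fun p : V * V => mul p.1 p.2). Proof. by case: mul_group. Qed.
Let mulA : associative mul. Proof. by case: mul_group. Qed.
Let mul0x : left_id 0 mul. Proof. by case: mul_group. Qed.
Let mulx0 : right_id 0 mul. Proof. by case: mul_group. Qed.

Lemma mul_entry_Ck l k : Ck k (fun p : V * V => mul p.1 p.2 0 l).
Proof. exact: (@smooth_Ck _ _ _ _ (fun p : V * V => mul p.1 p.2) 0 l k mul_sm). Qed.

Lemma left_mul_Ck x l k : Ck k (fun y => mul x y 0 l).
Proof.
apply: (@Ck_comp_affine R V (V * V)%type (fun y => (x, y)) (fun v => (0, v)) k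
  (fun p : V * V => mul p.1 p.2 0 l)).
- by move=> y; apply: differentiable_pair.
- by move=> v y; exact: derive_pairr.
- exact: mul_entry_Ck.
Qed.

Lemma left_mul_differentiable x y : differentiable (mul x) y.
Proof.
have -> : mul x = (fun p : V * V => mul p.1 p.2) \o (fun y => (x, y)) by [].
apply: differentiable_comp; first exact: differentiable_pair.
exact: (@smooth_differentiable _ _ _ (fun p : V * V => mul p.1 p.2) (x, y) mul_sm).
Qed.

(** E_i is a partial derivative of the product at (x, 0), hence is smooth. *)
Lemma left_field_entry i x l : E i x 0 l = 'D_((0, e_ i) : V * V) (fun p : V * V => mul p.1 p.2 0 l) (x, 0).
Proof.
rewrite /left_field derive_entry; last exact: left_mul_differentiable.
rewrite -(@derive_pairr R V V x 0 (e_ i)) -derive_comp //.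
have [H _] := mul_entry_Ck l 1; exact: H.
Qed.

Lemma left_field_Ck i l k : Ck k (fun x => E i x 0 l).
Proof.
have -> : (fun x => E i x 0 l) = ('D_((0, e_ i) : V * V) (fun p : V * V => mul p.1 p.2 0 l)) \o (fun x => (x, 0)).
  by apply/funext => x; rewrite left_field_entry.
apply: (@Ck_comp_affine R V (V * V)%type (fun x => (x, 0)) (fun v => (v, 0)) k).
- by move=> x; apply: differentiable_pair.
- by move=> v x; exact: derive_pairl.
- by have [_ H] := mul_entry_Ck l k.+1; exact: H.
Qed.

Lemma left_field0 i : E i 0 = e_ i.
Proof.
rewrite /left_field; have -> : mul 0 = id by apply/funext => y; exact: mul0x.
by rewrite derive_id.
Qed.

(** Left translations preserve the frame, by associativity. *)
Lemma left_invariance x y i : 'D_(E i y) (mul x) y = E i (mul x y).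
Proof.
rewrite /left_field.
have -> : mul (mul x y) = mul x \o mul y by apply/funext => z; rewrite /= -mulA.
have d1 := left_mul_differentiable y 0; have d2 := left_mul_differentiable x (mul y 0).
by rewrite (derive_comp _ d1 d2) mulx0.
Qed.

Lemma derive_left_mul x w : 'D_w (mul x) 0 = \sum_k w 0 k *: E k x.
Proof.
rewrite deriveE; last exact: left_mul_differentiable.
rewrite {1}(row_sum_delta w) linear_sum; apply: eq_bigr => k _.
by rewrite linearZ /= -deriveE //; exact: left_mul_differentiable.
Qed.

(** The bracket relations hold at the identity by hypothesis and at every
    other point by left invariance: E_j (mul x y) is the image of E_j y under
    the differential of mul x, and deriving this at y = 0 along e_i leaves,
    besides the term at the identity, a second derivative of mul x, which is
    symmetric in i and j. *)
Lemma left_field_bracket c : has_lie_algebra mul c -> forall i j x l,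
  'D_(E i x) (fun y => E j y 0 l) x - 'D_(E j x) (fun y => E i y 0 l) x =
  \sum_k c i j k * E k x 0 l.
Proof.
move=> lie i j x l.
have key i' j' : 'D_(E i' x) (fun y => E j' y 0 l) x =
    \sum_k 'D_(e_ i') (fun y => E j' y 0 k) 0 * E k x 0 l +
    'D_(e_ i') ('D_(e_ j') (fun y => mul x y 0 l)) 0.
  have dE m k y : differentiable (fun y => E m y 0 k) y.
    by have [H _] := left_field_Ck m k 1; exact: H.
  have -> : 'D_(E i' x) (fun y => E j' y 0 l) x = 'D_(e_ i') ((fun y => E j' y 0 l) \o mul x) 0.
    rewrite derive_comp ?mulx0 //; exact: left_mul_differentiable.
  have -> : (fun y => E j' y 0 l) \o mul x =
      fun y => \sum_k E j' y 0 k * 'D_(e_ k) (fun y => mul x y 0 l) y.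
    apply/funext => y /=; rewrite -left_invariance derive_entry; last exact: left_mul_differentiable.
    by rewrite derive_rowE //; have [H _] := left_mul_Ck x l 1; exact: H.
  have dm k y : differentiable ('D_(e_ k) (fun y => mul x y 0 l)) y.
    by have [_ /(_ (e_ k)) [H _]] := left_mul_Ck x l 2; exact: H.
  have -> : 'D_(e_ i') (fun y => \sum_k E j' y 0 k * 'D_(e_ k) (fun y => mul x y 0 l) y) 0 =
     \sum_k (E j' 0 0 k * 'D_(e_ i') ('D_(e_ k) (fun y => mul x y 0 l)) 0 +
             'D_(e_ k) (fun y => mul x y 0 l) 0 * 'D_(e_ i') (fun y => E j' y 0 k) 0).
    rewrite derive_sum_fun => [|k]; last by apply: differentiableM.
    apply: eq_bigr => k _; rewrite (@deriveM _ _ (fun y => E j' y 0 k)) //; exact: diff_derivable.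
  rewrite big_split /= addrC; congr (_ + _).
    apply: eq_bigr => k _; rewrite mulrC; congr (_ * _).
    by rewrite -derive_entry //; exact: left_mul_differentiable.
  rewrite (bigD1 j') //= left_field0 !mxE !eqxx mul1r big1 ?addr0 // => k kj.
  by rewrite !mxE eqxx (negPf kj) mul0r.
have cancel (a b p q u v : R) : p = q -> u = a + p -> v = b + q -> u - v = a - b.
  by move=> -> -> ->; ring.
rewrite (cancel _ _ _ _ _ _ (schwarz (e_ i) (e_ j) 0 (left_mul_Ck x l 2)) (key i j) (key j i)).
rewrite -sumrB.
apply: eq_bigr => k _; rewrite -mulrBl; congr (_ * _).
have := lie i j; rewrite /vf_bracket !left_field0.
have dEv m : differentiable (E m) 0.
  apply: differentiable_entries => z b; rewrite ord1.
  by have [H _] := left_field_Ck m b 1; exact: H.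
have subE (A B : V) : (A - B) 0 k = A 0 k - B 0 k by rewrite !mxE.
move/rowP => /(_ k) vb.
have h1 := derive_entry (e_ i) 0 k (dEv j); have h2 := derive_entry (e_ j) 0 k (dEv i).
apply: etrans (etrans (esym (subE _ _)) _).
  by congr (_ - _); [exact: esym h1 | exact: esym h2].
apply: etrans vb _; rewrite summxE (bigD1 k) //= !mxE !eqxx mulr1 big1 ?addr0 // => m mk.
by rewrite !mxE eqxx eq_sym (negPf mk) mulr0.
Qed.

Lemma frame0 : frame mul 0 = 1%:M.
Proof.
by apply/row_matrixP => i; rewrite rowK left_field0 row1.
Qed.

(** The translation by the inverse of x sends the frame at x to the frame at
    the identity, the standard basis. *)
Lemma frame_unit x : \det (frame mul x) != 0.
Proof.
have [inv [_ invl _]] := mul_inv mul_group.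
suff : frame mul x \in unitmx by rewrite unitmxE unitfE.
pose J := \matrix_(k, l) ('D_(e_ k) (fun y => mul (inv x) y 0 l) x).
suff H : frame mul x *m J = 1%:M by have [] := mulmx1_unit H.
apply/matrixP => i l; rewrite mxE.
transitivity ('D_(E i x) (fun y => mul (inv x) y 0 l) x).
  rewrite derive_rowE; last by have [H _] := left_mul_Ck (inv x) l 1; exact: H.
  by apply: eq_bigr => k _; rewrite !mxE.
rewrite -derive_entry; last exact: left_mul_differentiable.
by rewrite left_invariance invl left_field0 !mxE eqxx eq_sym.
Qed.

Lemma det_Ck k (A : V -> 'M[R]_n) : (forall i j, Ck k (fun x => A x i j)) -> Ck k (fun x => \det (A x)).
Proof.
move=> CA; apply: Ck_sum => s; apply: Ck_scale; apply: Ck_prod => i; exact: CA.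
Qed.

Lemma frame_det_Ck k : Ck k (fun x => \det (frame mul x)).
Proof.
apply: det_Ck => i j; under [X in Ck k X]funext do rewrite mxE; exact: left_field_Ck.
Qed.

(** The determinant does not vanish and is 1 at the identity, so it keeps its
    sign along the segment from 0 to x. *)
Lemma frame_det_gt0 x : 0 < \det (frame mul x).
Proof.
rewrite lt_neqAle eq_sym frame_unit /= leNgt; apply/negP => neg.
pose phi (t : R) := \det (frame mul (t *: x)).
have cphi : continuous phi.
  move=> t; apply: (@continuous_comp _ _ _ (fun t : R => t *: x) (fun y => \det (frame mul y))).
    exact: scalel_continuous.
  by have /Ck_continuous := frame_det_Ck 0; apply.
have := @IVT R phi 0 1 0 ler01 (continuous_subspaceT cphi).
rewrite /phi scale0r scale1r frame0 det1.
case=> [|t _ t0]; last by have := frame_unit (t *: x); rewrite t0 eqxx.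
by rewrite ge_min (ltW neg) orbT le_max ler01.
Qed.

End Group.

Section JacobiFormula.
Context {R : realType} {V : normedModType R} {n : nat}.

Lemma derive_prod (I : eqType) (r : seq I) (F : I -> V -> R) x v : uniq r ->
  (forall i y, differentiable (F i) y) ->
  'D_v (fun y => \prod_(i <- r) F i y) x =
  \sum_(i <- r) 'D_v (F i) x * \prod_(j <- r | j != i) F j x.
Proof.
move=> ur dF; elim: r ur => [_|i r IHr /= /andP[ir ur]].
  under eq_fun do rewrite big_nil; rewrite big_nil; exact: derive_cst.
have dP y : differentiable (fun y => \prod_(j <- r) F j y) y.
  elim: (r) => [|j s IHs].
    by under eq_fun do rewrite big_nil; exact: differentiable_cst.
  by under eq_fun do rewrite big_cons; exact: differentiableM.
under eq_fun do rewrite big_cons.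
rewrite (@deriveM _ _ (F i)); [|exact: diff_derivable|exact: diff_derivable].
rewrite IHr // big_cons big_cons eqxx /= addrC; congr (_ + _).
  rewrite -[LHS]/(_ * _) mulrC; congr (_ * _).
  rewrite [LHS]big_seq_cond [RHS]big_seq_cond; apply: eq_bigl => j.
  by rewrite andbT; case: (boolP (j \in r)) => //= jr; apply/esym; apply: contraNneq ir => <-.
rewrite -[LHS]/(_ * _) mulr_sumr; apply: eq_big_seq => j jr.
rewrite big_cons; case: eqVneq => [ij|_]; first by rewrite ij jr in ir.
by rewrite mulrCA.
Qed.

(** Jacobi's formula. *)
Lemma derive_det (A : V -> 'M[R]_n) x v : (forall i j y, differentiable (fun y => A y i j) y) ->
  'D_v (fun y => \det (A y)) x =
  \sum_i \sum_j 'D_v (fun y => A y i j) x * cofactor (A x) i j.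
Proof.
move=> dA.
pose B i := \matrix_(k, j) (if k == i then 'D_v (fun y => A y k j) x else A x k j).
transitivity (\sum_i \det (B i)); last first.
  apply: eq_bigr => i _; rewrite (expand_det_row _ i); apply: eq_bigr => j _.
  rewrite mxE eqxx; congr (_ * _); rewrite /cofactor; congr (_ * \det _).
  by apply/matrixP => a b; rewrite !mxE eq_sym (negPf (neq_lift _ _)).
pose P (s : 'S_n) y := \prod_i A y i (s i).
have dP s y : differentiable (P s) y.
  rewrite /P; elim: (index_enum _) => [|j r IHr].
    by under eq_fun do rewrite big_nil; exact: differentiable_cst.
  by under eq_fun do rewrite big_cons; apply: differentiableM.
transitivity (\sum_(s : 'S_n) (-1) ^+ s * 'D_v (P s) x).
  rewrite /determinant derive_sum_fun => [|s]; last first.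
    by apply: differentiableM; [exact: differentiable_cst|exact: dP].
  apply: eq_bigr => s _; rewrite (@deriveM _ _ (cst ((-1) ^+ s)) (P s)).
  - by rewrite derive_cst scaler0 addr0.
  - exact: derivable_cst.
  - exact: diff_derivable.
rewrite exchange_big /=; apply: eq_bigr => s _; rewrite -mulr_sumr; congr (_ * _).
rewrite /P (derive_prod _ _ (index_enum_uniq _)); last by move=> i y; exact: dA.
apply: eq_bigr => i _; rewrite [RHS](bigD1 i) //= mxE eqxx; congr (_ * _).
by apply: eq_bigr => j ji; rewrite mxE (negPf ji).
Qed.

End JacobiFormula.

(** * Integration by parts on the group *)

Section Divergence.
Context {R : realType} {n : nat}.
Variable mul : 'rV[R]_n -> 'rV[R]_n -> 'rV[R]_n.
Hypothesis mul_group : lie_group_law mul.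
Local Notation E := (left_field mul).
Local Notation V := 'rV[R]_n.
Local Notation e_ i := (delta_mx 0 i : V).

(** The Riemannian volume density; the determinant being positive, the
    absolute value can be dropped. *)
Definition density (x : V) : R := (\det (frame mul x))^-1.

Lemma density_Ck k : Ck k density.
Proof. by apply: Ck_inv; [exact: frame_unit|exact: frame_det_Ck]. Qed.

Lemma density_gt0 x : 0 < density x.
Proof. by rewrite invr_gt0 frame_det_gt0. Qed.

Lemma integral_volE (f : V -> R) : integral_vol mul f = integral_rV (fun x => density x * f x).
Proof.
congr integral_rV; apply/funext => x.
by rewrite gtr0_norm ?frame_det_gt0 // mulrC.
Qed.

Section Field.
Variables (X : V -> V) (C : 'M[R]_n).
Hypothesis X_Ck : forall l, Ck 1 (fun x => X x 0 l).
Hypothesis X_bracket : forall x j l,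
  'D_(X x) (fun y => E j y 0 l) x =
  'D_(E j x) (fun y => X y 0 l) x + \sum_k C j k * E k x 0 l.

Let J x : 'M[R]_n := \matrix_(a, l) 'D_(e_ a) (fun y => X y 0 l) x.

(** By the hypothesis on brackets, the frame matrix A satisfies
    X A = A J + C A, so Jacobi's formula gives det A tr (J + C). *)
Lemma derive_frame_det x :
  'D_(X x) (fun y => \det (frame mul y)) x = \det (frame mul x) * (\tr (J x) + \tr C).
Proof.
have dA i j y : differentiable (fun y => frame mul y i j) y.
  have -> : (fun y => frame mul y i j) = fun y => E i y 0 j by apply/funext => z; rewrite mxE.
  by have [H _] := left_field_Ck mul_group i j 1; exact: H.
rewrite derive_det //.
set A := frame mul x.
have MA i j : 'D_(X x) (fun y => frame mul y i j) x = (A *m J x + C *m A) i j.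
  have -> : (fun y => frame mul y i j) = fun y => E i y 0 j by apply/funext => z; rewrite mxE.
  rewrite X_bracket derive_rowE; last by have [H _] := X_Ck j; exact: H.
  rewrite [RHS]mxE; congr (_ + _); rewrite mxE.
    by apply: eq_bigr => a _; rewrite !mxE.
  by apply: eq_bigr => k _; rewrite !mxE.
transitivity (\tr ((A *m J x + C *m A) *m \adj A)).
  apply: eq_bigr => i _; rewrite [RHS]mxE; apply: eq_bigr => j _.
  by rewrite MA [\adj A j i]mxE.
rewrite mulmxDl mxtraceD -(mulmxA C) mul_mx_adj mul_mx_scalar mxtraceZ.
rewrite mxtrace_mulC mulmxA mul_adj_mx mul_scalar_mx mxtraceZ; ring.
Qed.

Lemma derive_density x : 'D_(X x) density x = - density x * (\tr (J x) + \tr C).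
Proof.
have dd : differentiable (fun y => \det (frame mul y)) x.
  by have [H _] := frame_det_Ck mul_group 1; exact: H.
rewrite /density (@deriveV _ _ (fun y => \det (frame mul y))); first last.
- exact: diff_derivable.
- exact: frame_unit.
rewrite derive_frame_det -[LHS]/(_ * _).
move: (frame_unit mul_group x) => /= d0; field; exact: d0.
Qed.

(** By derive_density, density * X g is the Euclidean divergence of
    density * g * X plus tr C times density * g, and the divergence integrates
    to zero. *)
Lemma integral_vol_along (g : V -> R) : Cc 1 g ->
  integral_vol mul (fun x => 'D_(X x) g x) = \tr C * integral_vol mul g.
Proof.
move=> Cg; rewrite !integral_volE.
pose F k x := density x * X x 0 k * g x.
have CF k : Cc 1 (F k) by apply: Cc_mul => //; apply: Ck_mul; [exact: density_Ck|exact: X_Ck].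
have dg x : differentiable g x by have [[H _] _] := Cg; exact: H.
have dX k x : differentiable (fun y => X y 0 k) x by have [H _] := X_Ck k; exact: H.
have dd x : differentiable density x by have [H _] := density_Ck 1; exact: H.
have pw x : \sum_k 'D_(e_ k) (F k) x = density x * 'D_(X x) g x - \tr C * (density x * g x).
  have DF k : 'D_(e_ k) (F k) x = density x * (X x 0 k * 'D_(e_ k) g x) +
     density x * g x * 'D_(e_ k) (fun y => X y 0 k) x + g x * (X x 0 k * 'D_(e_ k) density x).
    rewrite /F (@deriveM _ _ (fun y => density y * X y 0 k) g); first last.
    - exact: diff_derivable.
    - by apply: diff_derivable; exact: differentiableM.
    rewrite (@deriveM _ _ density (fun y => X y 0 k)); [|exact: diff_derivable|exact: diff_derivable].
    by rewrite -![_ *: _]/(_ * _); ring.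
  under eq_bigr do rewrite DF.
  rewrite !big_split /= -!mulr_sumr -!derive_rowE // derive_density.
  have -> : \sum_k 'D_(e_ k) (fun y => X y 0 k) x = \tr (J x).
    by apply: eq_bigr => k _; rewrite mxE.
  ring.
have CDg : Cc 0 (fun x => 'D_(X x) g x).
  have -> : (fun x => 'D_(X x) g x) = fun x => \sum_k X x 0 k * 'D_(e_ k) g x.
    by apply/funext => x; rewrite derive_rowE.
  apply: Cc_sum => k; apply: Cc_mul; last exact: Cc_derive.
  by apply: CkS; exact: X_Ck.
have C1 : Cc 0 (fun x => density x * 'D_(X x) g x) by apply: Cc_mul => //; exact: density_Ck.
have C2 : Cc 0 (fun x => density x * g x).
  by apply: Cc_mul; [exact: density_Ck|apply: Cc_le Cg].
have : integral_rV (fun x => \sum_k 'D_(e_ k) (F k) x) = 0.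
  rewrite (@integral_rV_sum _ _ 0); last by move=> k; exact: Cc_derive.
  by rewrite big1 // => k _; exact: integral_rV_derive0.
under eq_fun do rewrite pw addrC -mulNr.
by rewrite (integral_rV_linear _ C2 C1) mulNr addrC => /eqP; rewrite subr_eq0 => /eqP.
Qed.

End Field.

End Divergence.

(** * The soliton vector field *)

Section Exponential.
Context {R : realType} {n : nat}.
Variable D : 'M[R]_n.

Let c i j (k : nat) : R := (D ^+ k) i j / k`!%:R.
Let B := 1 + \sum_i \sum_j `|D i j|.

Let B1 : 1 <= B.
Proof. by rewrite lerDl; apply: sumr_ge0 => i _; apply: sumr_ge0. Qed.

Lemma entry_expr_le i j k : `|(D ^+ k) i j| <= B ^+ k.
Proof.
have B0 : 0 <= B by rewrite (le_trans _ B1).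
elim: k i j => [|k IHk] i j.
  by rewrite !expr0 mxE; case: eqP; rewrite ?normr1 ?normr0.
rewrite exprSr -[_ * D]/(_ *m _) mxE (le_trans (ler_norm_sum _ _ _)) //.
apply: (@le_trans _ _ (\sum_l B ^+ k * `|D l j|)).
  by apply: ler_sum => l _; rewrite normrM ler_wpM2r.
rewrite -mulr_sumr exprSr ler_wpM2l ?exprn_ge0 //.
rewrite /B (@le_trans _ _ (\sum_l \sum_m `|D l m|)) ?lerDr //.
by apply: ler_sum => l _; rewrite (bigD1 j) //= lerDl sumr_ge0.
Qed.

Lemma cvg_exp_shift i j m : cvgn (series (fun k => (D ^+ (k + m)) i j / k`!%:R)).
Proof.
apply: normed_cvg; apply: (@series_le_cvg _ _ (fun k => B ^+ m * exp_coeff B k)).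
- by move=> k; exact: normr_ge0.
- by move=> k; rewrite mulr_ge0 ?exprn_ge0 ?exp_coeff_ge0 // (le_trans _ B1).
- move=> k /=; rewrite normrM normfV [X in _ / X]ger0_norm // /exp_coeff mulrA.
  by rewrite ler_pM2r ?invr_gt0 ?ltr0n ?fact_gt0 // -exprD addnC entry_expr_le.
- exact: (is_cvg_seriesZ (is_cvg_series_exp_coeff B)).
Qed.

(** Differentiating the exponential series shifts the powers of D. *)
Lemma diffs_exp i j m :
  pseries_diffs (fun k => (D ^+ (k + m)) i j / k`!%:R) = (fun k => (D ^+ (k + m.+1)) i j / k`!%:R).
Proof.
apply/funext => k; rewrite /pseries_diffs addSnnS factS natrM invfM.
move: (_ i j) => y; rewrite mulrCA; congr (_ * _).
by rewrite mulrA mulfV ?mul1r // pnatr_eq0.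
Qed.

Lemma scale_expr (t : R) k i j : ((t *: D) ^+ k) i j = (D ^+ k) i j * t ^+ k.
Proof.
suff -> : (t *: D) ^+ k = t ^+ k *: D ^+ k by rewrite mxE mulrC.
elim: k => [|k IHk]; first by rewrite !expr0 scale1r.
by rewrite !exprS IHk -!mulmxE -scalemxAl -scalemxAr scalerA.
Qed.

Lemma expmx_pseries i j (t : R) : expmx (t *: D) i j = limn (pseries (c i j) t).
Proof.
rewrite mxE; congr (limn _); congr series; apply/funext => k.
by rewrite scale_expr /c mulrAC.
Qed.

Lemma pseries_at0 (f : nat -> R) : limn (pseries f 0) = f 0%N.
Proof.
apply/cvg_lim => //; apply/cvgrPdist_lt => e e0; near=> m.
have m0 : (0 < m)%N by near: m; exact: nbhs_infty_gt.
rewrite /pseries /series /= big_mkord -(prednK m0) big_ord_recl /= expr0 mulr1.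
by rewrite big1 ?addr0 ?subrr ?normr0 // => k _; rewrite exprS mul0r mulr0.
Unshelve. all: by end_near. Qed.

Lemma expmx0 i j : expmx (0 *: D) i j = (i == j)%:R.
Proof. by rewrite expmx_pseries pseries_at0 /c fact0 divr1 expr0 mxE. Qed.

Lemma expmx_derive i j : is_derive (0 : R) (1 : R) (fun t : R => expmx (t *: D) i j) (D i j).
Proof.
have -> : (fun t : R => expmx (t *: D) i j) = fun t => limn (pseries (c i j) t).
  by apply/funext => t; rewrite expmx_pseries.
have c0 : c i j = (fun k => (D ^+ (k + 0)) i j / k`!%:R).
  by apply/funext => k; rewrite addn0.
have P1 m : pseries (fun k => (D ^+ (k + m)) i j / k`!%:R) 1 = series (fun k => (D ^+ (k + m)) i j / k`!%:R).
  by rewrite /pseries; congr series; apply/funext => k /=; rewrite expr1n mulr1.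
have := @pseries_snd_diffs R (c i j) 1 0.
rewrite c0 !diffs_exp !P1 normr0 normr1 => /(_ (@cvg_exp_shift i j 0) (@cvg_exp_shift i j 1) (@cvg_exp_shift i j 2) ltr01).
by rewrite pseries_at0 fact0 divr1 add0n expr1.
Qed.
End Exponential.

Section Flow.
Context {R : realType} {n : nat}.
Variable mul : 'rV[R]_n -> 'rV[R]_n -> 'rV[R]_n.
Hypothesis mul_group : lie_group_law mul.
Variables (D : 'M[R]_n) (phi : R -> 'rV[R]_n -> 'rV[R]_n).
Hypothesis phi_flow : automorphism_flow mul D phi.
Local Notation E := (left_field mul).
Local Notation V := 'rV[R]_n.
Local Notation e_ i := (delta_mx 0 i : V).
Local Notation X := (generator phi).
Let Phi l := (fun p : R^o * V => phi p.1 p.2 0 l).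

Lemma flow_entry_Ck l k : Ck k (Phi l).
Proof. exact: (@smooth_Ck _ _ _ _ (fun p : R^o * V => phi p.1 p.2) 0 l k (flow_smooth phi_flow)). Qed.

Lemma flow_time_differentiable x t : differentiable (fun t : R^o => phi t x) t.
Proof.
apply: (@differentiable_comp R R^o (R^o * V)%type V (fun t => (t, x)) (fun p : R^o * V => phi p.1 p.2)).
  exact: differentiable_pair.
exact: smooth_differentiable (flow_smooth phi_flow).
Qed.

Lemma flow_space_differentiable t x : differentiable (phi t) x.
Proof.
apply: (@differentiable_comp R V (R^o * V)%type V (fun x => (t : R^o, x)) (fun p : R^o * V => phi p.1 p.2)).
  exact: differentiable_pair.
exact: smooth_differentiable (flow_smooth phi_flow).
Qed.

Lemma generator_entry x l : X x 0 l = 'D_((1, 0) : R^o * V) (Phi l) (0, x).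
Proof.
rewrite /generator derive1E.
rewrite derive_entry; last exact: flow_time_differentiable.
have d1 : differentiable (fun t : R^o => (t, x)) 0 by exact: differentiable_pair.
have d2 : differentiable (Phi l) (0 : R^o, x) by have [H _] := flow_entry_Ck l 1; exact: H.
by have := derive_comp (1 : R^o) d1 d2; rewrite derive_pairl => <-.
Qed.

Lemma generator_Ck l k : Ck k (fun x => X x 0 l).
Proof.
have -> : (fun x => X x 0 l) = 'D_((1, 0) : R^o * V) (Phi l) \o (fun x => (0 : R^o, x)).
  by apply/funext => x; rewrite generator_entry.
apply: (@Ck_comp_affine R V (R^o * V)%type (fun x => (0 : R^o, x)) (fun v => (0, v)) k).
- by move=> x; apply: differentiable_pair.
- by move=> v x; exact: derive_pairr.
- by have [_ H] := flow_entry_Ck l k.+1; exact: H.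
Qed.

Lemma flow_fix0 t : phi t 0 = 0.
Proof.
have [inv [_ invl _]] := mul_inv mul_group.
have := flow_morph phi_flow t 0 0; rewrite (mul_0l mul_group) => H.
have := congr1 (mul (inv (phi t 0))) H.
by rewrite (mul_assoc mul_group) !invl (mul_0l mul_group).
Qed.

(* phi_t is an automorphism with differential exp(tD) at the identity. *)
(** phi_t is an automorphism with differential exp (t D) at the identity, so it
    maps E_j to the left-invariant field with value e_j exp (t D). *)
Lemma flow_left_field t x j l :
  'D_((0, E j x) : R^o * V) (Phi l) (t, x) = \sum_k expmx (t *: D) j k * E k (phi t x) 0 l.
Proof.
have dPhi p : differentiable (Phi l) p by have [H _] := flow_entry_Ck l 1; exact: H.
have d1 : differentiable (fun y : V => (t : R^o, y)) x by exact: differentiable_pair.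
transitivity (('D_(E j x) (phi t) x) 0 l).
  rewrite derive_entry; last exact: flow_space_differentiable.
  by have := derive_comp (E j x) d1 (dPhi _); rewrite derive_pairr => <-.
have dm := left_mul_differentiable mul_group.
have df := flow_space_differentiable.
have -> : 'D_(E j x) (phi t) x = 'D_(e_ j) (phi t \o mul x) 0.
  have := derive_comp (e_ j) (dm x 0) (df t (mul x 0)).
  by rewrite (mul_0r mul_group) => ->.
have -> : phi t \o mul x = mul (phi t x) \o phi t.
  by apply/funext => y; rewrite /= (flow_morph phi_flow).
have -> : 'D_(e_ j) (mul (phi t x) \o phi t) 0 = 'D_(e_ j *m expmx (t *: D)) (mul (phi t x)) 0.
  have := derive_comp (e_ j) (df t 0) (dm (phi t x) (phi t 0)).
  by rewrite flow_fix0 (flow_diff phi_flow).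
rewrite (derive_left_mul mul_group) summxE; apply: eq_bigr => k _.
by rewrite -rowE !mxE.
Qed.

(** The derivative of flow_left_field at t = 0. *)
Lemma generator_bracket x j l :
  'D_(X x) (fun y => E j y 0 l) x =
  'D_(E j x) (fun y => X y 0 l) x + \sum_k (- D) j k * E k x 0 l.
Proof.
pose G := 'D_((0, E j x) : R^o * V) (Phi l).
have CG : Ck 1 G by have [_ H] := flow_entry_Ck l 2; exact: H.
have dG p : differentiable G p by have [H _] := CG; exact: H.
have dpair t : differentiable (fun t : R^o => (t, x)) t by exact: differentiable_pair.
(* the time derivative and the space derivative commute *)
have lhs : 'D_(1 : R^o) (fun t : R^o => G (t, x)) 0 = 'D_(E j x) (fun y => X y 0 l) x.
  have -> : 'D_(1 : R^o) (fun t : R^o => G (t, x)) 0 = 'D_((1, 0) : R^o * V) G (0, x).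
    by have := derive_comp (1 : R^o) (dpair 0) (dG (0, x)); rewrite derive_pairl => <-.
  rewrite /G (schwarz ((1, 0) : R^o * V) (0, E j x) (0, x) (flow_entry_Ck l 2)).
  have d1 : differentiable (fun y : V => (0 : R^o, y)) x by exact: differentiable_pair.
  have d2 : differentiable ('D_((1, 0) : R^o * V) (Phi l)) (0, x).
    by have [_ /(_ (1, 0)) [H _]] := flow_entry_Ck l 2; exact: H.
  have E1 : (fun y => X y 0 l) = 'D_((1, 0) : R^o * V) (Phi l) \o (fun y => (0 : R^o, y)).
    by apply/funext => y; rewrite generator_entry.
  by rewrite E1; have := derive_comp (E j x) d1 d2; rewrite derive_pairr => ->.
have dE k y : differentiable (fun y => E k y 0 l) y.
  by have [H _] := left_field_Ck mul_group k l 1; exact: H.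
have dEphi k : is_derive (0 : R) (1 : R) (fun t : R => E k (phi t x) 0 l) ('D_(X x) (fun y => E k y 0 l) x).
  have gx : 'D_(1 : R^o) (fun t : R^o => phi t x) 0 = X x by rewrite /generator derive1E.
  exact: (derive_along_curve (flow_time_differentiable x 0) (flow_0 phi_flow x) gx (dE k x)).
have rhs : 'D_(1 : R^o) (fun t : R^o => G (t, x)) 0 =
    \sum_k (expmx (0 *: D) j k * 'D_(X x) (fun y => E k y 0 l) x + E k x 0 l * D j k).
  have -> : (fun t : R^o => G (t, x)) = fun t => \sum_k expmx (t *: D) j k * E k (phi t x) 0 l.
    by apply/funext => t; exact: flow_left_field.
  have dexp k : is_derive (0 : R) (1 : R) (fun t : R => expmx (t *: D) j k) (D j k).
    exact: expmx_derive.
  have d1 k : differentiable (fun t : R => expmx (t *: D) j k) 0.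
    by apply/derivable1_diffP; have [] := dexp k.
  have d2 k : differentiable (fun t : R => E k (phi t x) 0 l) 0.
    by apply/derivable1_diffP; have [] := dEphi k.
  rewrite derive_sum_fun => [|k]; last exact: differentiableM.
  apply: eq_bigr => k _.
  rewrite (@deriveM _ _ (fun t : R => expmx (t *: D) j k)); [|exact: diff_derivable|exact: diff_derivable].
  have [_ ->] := dexp k; have [_ ->] := dEphi k.
  by rewrite (flow_0 phi_flow).
have rhs2 (Q : 'I_n -> R) : \sum_k (expmx (0 *: D) j k * Q k + E k x 0 l * D j k) =
    Q j + \sum_k E k x 0 l * D j k.
  rewrite big_split /= (bigD1 j) //= expmx0 eqxx mul1r big1 ?addr0 //.
  by move=> k kj; rewrite expmx0 eq_sym (negPf kj) mul0r.
have fin (a b s s' : R) : b = a + s -> s' = - s -> a = b + s' by move=> -> ->; ring.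
apply: (fin _ _ _ _ (etrans (esym lhs) (etrans rhs (rhs2 (fun k => 'D_(X x) (fun y => E k y 0 l) x))))).
by rewrite -sumrN; apply: eq_bigr => k _; rewrite mxE; ring.
Qed.

Lemma integral_vol_generator (g : V -> R) : Cc 1 g ->
  integral_vol mul (fun x => 'D_(X x) g x) = - \tr D * integral_vol mul g.
Proof.
move=> Cg; rewrite -(raddfN mxtrace).
apply: (integral_vol_along mul_group) => //; last exact: generator_bracket.
by move=> l; exact: generator_Ck.
Qed.

Lemma generator_adE x j : frame_coord mul x (vf_bracket X (E j) x) = fun k => - D j k.
Proof.
apply/funext => k; rewrite /frame_coord.
suff -> : vf_bracket X (E j) x = row j (- D) *m frame mul x.
  rewrite mulmxK ?mxE ?mxE //.
  by rewrite unitmxE unitfE frame_unit.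
apply/rowP => l; rewrite /vf_bracket.
have subE (A B : V) : (A - B) 0 l = A 0 l - B 0 l by rewrite !mxE.
have dX : differentiable X x.
  apply: differentiable_entries => z b; rewrite ord1.
  by have [H _] := generator_Ck b 1; exact: H.
have dE : differentiable (E j) x.
  apply: differentiable_entries => z b; rewrite ord1.
  by have [H _] := left_field_Ck mul_group j b 1; exact: H.
apply: etrans (subE _ _) _.
rewrite [X in X - _](derive_entry (X x) 0 l dE) [X in _ - X](derive_entry (E j x) 0 l dX).
rewrite generator_bracket addrC addKr.
by rewrite mxE; apply: eq_bigr => b _; rewrite !mxE.
Qed.
End Flow.

(** * Covariant calculus in the frame *)

Section FrameCalculus.
Context {R : realType} {n : nat}.
Variable mul : 'rV[R]_n -> 'rV[R]_n -> 'rV[R]_n.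
Hypothesis mul_group : lie_group_law mul.
Variable c : 'I_n -> 'I_n -> 'I_n -> R.
Hypothesis mul_c : has_lie_algebra mul c.
Hypothesis c_anti : forall i j k, c i j k = - c j i k.
Hypothesis c_tr : forall i, \tr (ad_mx c i) = 0.
Local Notation E := (left_field mul).
Local Notation V := 'rV[R]_n.
Local Notation dE := (frame_deriv mul).
Local Notation vint := (integral_vol mul).
Implicit Types (F : V -> 'M[R]_n) (u : V -> R).

Definition Cc_mx k F := forall a b, Cc k (fun x => F x a b).

Lemma along_Cc (X : V -> V) k u : (forall l, Ck k (fun x => X x 0 l)) -> Cc k.+1 u ->
  Cc k (fun x => 'D_(X x) u x).
Proof.
move=> CX Cu.
have -> : (fun x => 'D_(X x) u x) = fun x => \sum_l X x 0 l * 'D_(delta_mx 0 l : V) u x.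
  by apply/funext => x; apply: derive_rowE; have [[H _] _] := Cu; exact: H.
apply: Cc_sum => l; apply: Cc_mul; first exact: CX.
exact: Cc_derive.
Qed.

Lemma dE_Cc i k u : Cc k.+1 u -> Cc k (fun x => dE i u x).
Proof. by move=> Cu; apply: along_Cc => // l; exact: left_field_Ck. Qed.

Lemma Cc_mx_form_dot k F F' : Cc_mx k F -> Cc_mx k F' -> Cc k (fun x => form_dot (F x) (F' x)).
Proof.
move=> CF CF'; apply: Cc_sum => a; apply: Cc_sum => b; apply: Cc_mul; last exact: CF'.
by apply: Cc_Ck; exact: CF.
Qed.

Lemma Cc_mx_cov_deriv k F i : Cc_mx k.+1 F -> Cc_mx k (cov_deriv mul c F i).
Proof.
move=> CF a b.
have CF0 a' b' : Cc k (fun x => F x a' b') by apply: Cc_le (CF a' b').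
have -> : (fun x => cov_deriv mul c F i x a b) = fun x => dE i (fun y => F y a b) x
   - \sum_l connection c i a l * F x l b - \sum_l connection c i b l * F x a l.
  by apply/funext => x; rewrite mxE.
apply: Cc_sub; last by apply: Cc_sum => l; exact: Cc_scale.
apply: Cc_sub; first exact: dE_Cc.
by apply: Cc_sum => l; exact: Cc_scale.
Qed.

Lemma Cc_mx_curvature_op k F : Cc_mx k F -> Cc_mx k (fun x => curvature_op c (F x)).
Proof.
move=> CF a b.
have -> : (fun x => curvature_op c (F x) a b) =
    fun x => \sum_p \sum_q riemann c a p q b * F x p q by apply/funext => x; rewrite mxE.
by apply: Cc_sum => p; apply: Cc_sum => q; exact: Cc_scale.
Qed.

Lemma Cc_diff k u x : Cc k.+1 u -> differentiable u x.
Proof. by move=> [[H _] _]; exact: H. Qed.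

Lemma dE_sum I (r : seq I) (f : I -> V -> R) i x : (forall k, Cc 1 (f k)) ->
  dE i (fun y => \sum_(k <- r) f k y) x = \sum_(k <- r) dE i (f k) x.
Proof. by move=> Cf; apply: derive_sum_fun => k; exact: Cc_diff (Cf k). Qed.

Lemma dE_sub u u' i x : Cc 1 u -> Cc 1 u' ->
  dE i (fun y => u y - u' y) x = dE i u x - dE i u' x.
Proof.
move=> Cu Cu'; rewrite /frame_deriv.
by apply: deriveB; apply: diff_derivable; [exact: Cc_diff Cu|exact: Cc_diff Cu'].
Qed.

Lemma dE_scale a u i x : Cc 1 u -> dE i (fun y => a * u y) x = a * dE i u x.
Proof.
by move=> Cu; rewrite /frame_deriv; apply: deriveZ; apply: diff_derivable; exact: Cc_diff Cu.
Qed.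

Lemma dE_mul u u' i x : Cc 1 u -> Cc 1 u' ->
  dE i (fun y => u y * u' y) x = dE i u x * u' x + u x * dE i u' x.
Proof.
move=> Cu Cu'; rewrite /frame_deriv.
rewrite (@deriveM _ _ u u'); first last.
- by apply: diff_derivable; exact: Cc_diff Cu'.
- by apply: diff_derivable; exact: Cc_diff Cu.
by rewrite -![_ *: _]/(_ * _) addrC [u' x * _]mulrC.
Qed.

(** Left-invariant fields are divergence-free since tr (ad e_i) = 0. *)
Lemma integral_dE i u : Cc 1 u -> vint (dE i u) = 0.
Proof.
move=> Cu.
have B x j l : 'D_(E i x) (fun y => E j y 0 l) x =
    'D_(E j x) (fun y => E i y 0 l) x + \sum_k ad_mx c i j k * E k x 0 l.
  under eq_bigr do rewrite mxE.
  by rewrite -(left_field_bracket mul_group mul_c) addrC subrK.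
have := integral_vol_along mul_group (fun l => left_field_Ck mul_group i l 1) B Cu.
by rewrite c_tr mul0r.
Qed.

(** The second derivatives of u cancel by symmetry and the brackets of the
    frame remain. *)
Lemma frame_commutator i j u x : Cc 2 u ->
  dE i (dE j u) x - dE j (dE i u) x = \sum_k c i j k * dE k u x.
Proof.
move=> Cu.
have C1 a : Cc 1 ('D_(delta_mx 0 a : V) u) by exact: Cc_derive.
have dEE k : dE k u = fun y => \sum_a E k y 0 a * 'D_(delta_mx 0 a : V) u y.
  by apply/funext => y; apply: derive_rowE; exact: Cc_diff Cu.
have expand k l : dE k (dE l u) x = \sum_a 'D_(E k x) (fun y => E l y 0 a) x * 'D_(delta_mx 0 a : V) u x
    + \sum_a \sum_b E k x 0 b * E l x 0 a * 'D_(delta_mx 0 b : V) ('D_(delta_mx 0 a : V) u) x.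
  have dEl a : differentiable (fun y => E l y 0 a) x.
    by have [H _] := left_field_Ck mul_group l a 1; exact: H.
  have du a : differentiable ('D_(delta_mx 0 a : V) u) x by exact: Cc_diff (C1 a).
  rewrite (dEE l) /frame_deriv derive_sum_fun; last by move=> a; exact: differentiableM.
  rewrite -big_split /=; apply: eq_bigr => a _.
  rewrite (@deriveM _ _ (fun y => E l y 0 a) ('D_(delta_mx 0 a : V) u)); first last.
  - exact: diff_derivable.
  - exact: diff_derivable.
  rewrite -![_ *: _]/(_ * _) (derive_rowE _ (du a)) mulr_sumr addrC mulrC.
  by congr (_ + _); apply: eq_bigr => b _; ring.
have dd_sym (w w' : V) : \sum_a \sum_b w 0 b * w' 0 a * 'D_(delta_mx 0 b : V) ('D_(delta_mx 0 a : V) u) x =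
    \sum_a \sum_b w' 0 b * w 0 a * 'D_(delta_mx 0 b : V) ('D_(delta_mx 0 a : V) u) x.
  have S a b := schwarz (delta_mx 0 b : V) (delta_mx 0 a : V) x (Cc_Ck Cu).
  pose dd (a b : 'I_n) := 'D_(delta_mx 0 b : V) ('D_(delta_mx 0 a : V) u) x.
  have {}S a b : dd a b = dd b a by exact: S.
  rewrite -[LHS]/(\sum_a \sum_b w 0 b * w' 0 a * dd a b).
  rewrite -[RHS]/(\sum_a \sum_b w' 0 b * w 0 a * dd a b).
  move: dd S => dd S; rewrite exchange_big /=; apply: eq_bigr => a _; apply: eq_bigr => b _.
  by rewrite S [w 0 a * _]mulrC.
have sym : \sum_a \sum_b E i x 0 b * E j x 0 a * 'D_(delta_mx 0 b : V) ('D_(delta_mx 0 a : V) u) x =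
    \sum_a \sum_b E j x 0 b * E i x 0 a * 'D_(delta_mx 0 b : V) ('D_(delta_mx 0 a : V) u) x.
  exact: dd_sym.
have cancel (a b d d' : R) : d = d' -> (a + d) - (b + d') = a - b by move=> ->; ring.
rewrite (expand i j) (expand j i) (cancel _ _ _ _ sym) -sumrB.
transitivity (\sum_a (\sum_k c i j k * E k x 0 a) * 'D_(delta_mx 0 a : V) u x).
  by apply: eq_bigr => a _; rewrite -(left_field_bracket mul_group mul_c) mulrBl.
under eq_bigr do rewrite mulr_suml.
rewrite exchange_big; apply: eq_bigr => k _; rewrite dEE mulr_sumr.
by apply: eq_bigr => a _; rewrite mulrA.
Qed.

Definition frame_deriv_mx i F x : 'M[R]_n := \matrix_(a, b) dE i (fun y => F y a b) x.

Lemma cov_derivE F i x :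
  cov_deriv mul c F i x = frame_deriv_mx i F x - connection_mx c i *m F x - F x *m (connection_mx c i)^T.
Proof.
apply/matrixP => a b.
have subE (A B C : 'M[R]_n) : (A - B - C) a b = A a b - B a b - C a b by rewrite !mxE.
rewrite subE [LHS]mxE [frame_deriv_mx _ _ _ _ _]mxE; congr (_ - _ - _).
- by rewrite mxE; apply: eq_bigr => l _; rewrite mxE.
- by rewrite mxE; apply: eq_bigr => l _; rewrite !mxE mulrC.
Qed.

(** The connection terms cancel because the connection forms are skew. *)
Lemma metric_compatibility F F' i x : Cc_mx 1 F -> Cc_mx 1 F' ->
  dE i (fun y => form_dot (F y) (F' y)) x =
  form_dot (cov_deriv mul c F i x) (F' x) + form_dot (F x) (cov_deriv mul c F' i x).
Proof.
move=> CF CF'.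
have -> : dE i (fun y => form_dot (F y) (F' y)) x =
    form_dot (frame_deriv_mx i F x) (F' x) + form_dot (F x) (frame_deriv_mx i F' x).
  rewrite /form_dot dE_sum; last first.
    by move=> a; apply: Cc_sum => b; apply: Cc_mul; [exact: Cc_Ck (CF a b)|exact: CF'].
  rewrite -big_split /=; apply: eq_bigr => a _.
  rewrite dE_sum; last by move=> b; apply: Cc_mul; [exact: Cc_Ck (CF a b)|exact: CF'].
  rewrite -big_split /=; apply: eq_bigr => b _.
  by rewrite (dE_mul _ _ (CF a b) (CF' a b)) !mxE.
rewrite !cov_derivE (connection_mx_skew c_anti) !form_dotE !(raddfB (@trmx R n n)) /= !trmx_mul.
rewrite !(raddfN (@trmx R n n)) /= (connection_mx_skew c_anti).
move: (frame_deriv_mx i F x) (frame_deriv_mx i F' x) (F x) (F' x) (connection_mx c i) => A A' B B' M.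
rewrite !(mulmxN, mulNmx, mulmxBl, mulmxBr, mulmxDl, mulmxDr, opprK) !mulmxA.
rewrite !(raddfD (@mxtrace R n), raddfN (@mxtrace R n)) /= .
rewrite -(mxtrace_mulC M (B *m B'^T)) mulmxA; ring.
Qed.

Lemma frame_deriv_mx_cov_deriv F i k x : Cc_mx 2 F ->
  frame_deriv_mx k (cov_deriv mul c F i) x =
  frame_deriv_mx k (frame_deriv_mx i F) x - connection_mx c i *m frame_deriv_mx k F x
    - frame_deriv_mx k F x *m (connection_mx c i)^T.
Proof.
move=> CF; apply/matrixP => a b.
have CF1 a' b' : Cc 1 (fun x => F x a' b') by apply: Cc_le (CF a' b').
have subE (A B C : 'M[R]_n) : (A - B - C) a b = A a b - B a b - C a b by rewrite !mxE.
rewrite subE [LHS]mxE.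
have -> : (fun y => cov_deriv mul c F i y a b) = fun y => dE i (fun z => F z a b) y
   - \sum_l connection c i a l * F y l b - \sum_l connection c i b l * F y a l.
  by apply/funext => y; rewrite mxE.
have CS1 : Cc 1 (fun y => \sum_l connection c i a l * F y l b).
  by apply: Cc_sum => l; exact: Cc_scale.
have CS2 : Cc 1 (fun y => \sum_l connection c i b l * F y a l).
  by apply: Cc_sum => l; exact: Cc_scale.
have CS0 : Cc 1 (dE i (fun z => F z a b)) by exact: dE_Cc.
rewrite dE_sub //; last exact: Cc_sub.
rewrite dE_sub // !dE_sum; try by move=> l; exact: Cc_scale.
congr (_ - _ - _).
- rewrite mxE; congr (dE k _ x); apply/funext => y; by rewrite mxE.
- by rewrite mxE; apply: eq_bigr => l _; rewrite !mxE dE_scale.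
- by rewrite mxE; apply: eq_bigr => l _; rewrite !mxE dE_scale // mulrC.
Qed.

Lemma cov_deriv_commutator F x : Cc_mx 2 F -> forall k i,
  cov_deriv mul c (cov_deriv mul c F i) k x - cov_deriv mul c (cov_deriv mul c F k) i x =
  \sum_l c k i l *: cov_deriv mul c F l x
    - curvature_mx c k i *m F x - F x *m (curvature_mx c k i)^T.
Proof.
move=> CF.
have com k i : frame_deriv_mx k (frame_deriv_mx i F) x - frame_deriv_mx i (frame_deriv_mx k F) x =
    \sum_l c k i l *: frame_deriv_mx l F x.
  apply/matrixP => a b.
  have subE (A B : 'M[R]_n) : (A - B) a b = A a b - B a b by rewrite !mxE.
  have ent p q : frame_deriv_mx p (frame_deriv_mx q F) x a b = dE p (dE q (fun y => F y a b)) x.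
    rewrite mxE; congr (dE p _ x); apply/funext => y; by rewrite mxE.
  rewrite subE.
  apply: (etrans (congr2 (fun s t : R => s - t) (ent k i) (ent i k))).
  rewrite summxE.
  apply: (etrans (frame_commutator k i x (CF a b))).
  by apply: eq_bigr => l _; rewrite !mxE.
have := ricci_identity c_anti (F x) com.
move=> /= H k i; rewrite ![cov_deriv mul c (cov_deriv mul c F _) _ x]cov_derivE.
rewrite !frame_deriv_mx_cov_deriv // !(cov_derivE F) H.
by under [in RHS]eq_bigr do rewrite cov_derivE.
Qed.

Let G_trace l : \sum_k connection c k k l = 0.
Proof. by apply: connection_trace. Qed.

(** The vector field whose divergence bounds |nabla h|^2 from below. *)
Definition bochner_field F k x : R :=
  \sum_i \sum_j (F x i j * cov_deriv mul c F i x k j - F x k j * cov_deriv mul c F i x i j).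

Lemma bochner_field_Cc F k : Cc_mx 2 F -> Cc 1 (bochner_field F k).
Proof.
move=> CF; have CF1 a b : Ck 1 (fun x => F x a b) by apply: Cc_Ck; apply: Cc_le (CF a b).
apply: Cc_sum => i; apply: Cc_sum => j.
by apply: Cc_sub; apply: Cc_mul => //; exact: Cc_mx_cov_deriv.
Qed.

Lemma bochner_field_divergence_le F x : Cc_mx 2 F -> (F x)^T = F x ->
  \sum_k dE k (bochner_field F k) x <=
  \sum_k form_dot (cov_deriv mul c F k x) (cov_deriv mul c F k x)
  + \tr (ricci c *m F x *m F x) - form_dot (curvature_op c (F x)) (F x).
Proof.
move=> CF FT.
have CF1 : Cc_mx 1 F by move=> a b; apply: Cc_le (CF a b).
have CT i : Cc_mx 1 (cov_deriv mul c F i) by exact: Cc_mx_cov_deriv.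
have CP a b i p q : Cc 1 (fun x => F x a b * cov_deriv mul c F i x p q).
  by apply: Cc_mul; [exact: Cc_Ck (CF1 a b)|exact: CT].
have -> : \sum_k dE k (bochner_field F k) x = \sum_k \sum_i \sum_j
    (frame_deriv_mx k F x i j * cov_deriv mul c F i x k j + F x i j * frame_deriv_mx k (cov_deriv mul c F i) x k j
     - frame_deriv_mx k F x k j * cov_deriv mul c F i x i j - F x k j * frame_deriv_mx k (cov_deriv mul c F i) x i j).
  apply: eq_bigr => k _; rewrite dE_sum; last by move=> i; apply: Cc_sum => j; exact: Cc_sub.
  apply: eq_bigr => i _; rewrite dE_sum; last by move=> j; exact: Cc_sub.
  apply: eq_bigr => j _; rewrite dE_sub // (dE_mul _ _ (CF1 _ _) (CT _ _ _)) (dE_mul _ _ (CF1 _ _) (CT _ _ _)).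
  by rewrite ![frame_deriv_mx _ _ _ _ _]mxE opprD addrA.
rewrite (@bochner_divergence _ _ c c_anti G_trace (F x) (fun i => cov_deriv mul c F i x)
  (fun k i => cov_deriv mul c (cov_deriv mul c F i) k x)
  (fun k => frame_deriv_mx k F x) (fun k i => frame_deriv_mx k (cov_deriv mul c F i) x)) //.
- have mono (a s t f : R) : a <= s -> a + t - f <= s + t - f by lra.
  by apply: mono; exact: bochner_le.
- by move=> k; rewrite cov_derivE addrAC subrK subrK.
- by move=> k i; rewrite [cov_deriv _ _ (cov_deriv _ _ _ _) _ _]cov_derivE addrAC subrK subrK.
- exact: cov_deriv_commutator.
Qed.

(** The correction by nabla_(nabla_p E_p) in the second covariant derivative
    sums to zero, because sum_p nabla_p E_p = 0. *)
Lemma rough_laplacian_dot F x : Cc_mx 2 F ->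
  form_dot (rough_laplacian mul c F x) (F x) =
  \sum_p dE p (fun y => form_dot (cov_deriv mul c F p y) (F y)) x
  - \sum_p form_dot (cov_deriv mul c F p x) (cov_deriv mul c F p x).
Proof.
move=> CF.
have CF1 : Cc_mx 1 F by move=> a b; apply: Cc_le (CF a b).
have CT i : Cc_mx 1 (cov_deriv mul c F i) by exact: Cc_mx_cov_deriv.
have -> : rough_laplacian mul c F x = \sum_p cov_deriv mul c (cov_deriv mul c F p) p x.
  rewrite /rough_laplacian /cov_deriv2 sumrB exchange_big /=.
  rewrite [X in _ - X]big1 ?subr0 // => l _.
  by rewrite -scaler_suml G_trace scale0r.
rewrite -sumrB form_dotE mulmx_suml raddf_sum /=; apply: eq_bigr => p _.
by rewrite -form_dotE metric_compatibility // addrK.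
Qed.

End FrameCalculus.

(** * The integrated stability inequality *)

Section VolumeIntegral.
Context {R : realType} {n : nat}.
Variable mul : 'rV[R]_n -> 'rV[R]_n -> 'rV[R]_n.
Hypothesis mul_group : lie_group_law mul.
Local Notation V := 'rV[R]_n.
Local Notation vint := (integral_vol mul).

Let Cc_density u : Cc 0 u -> Cc 0 (fun x : V => density mul x * u x).
Proof. by move=> Cu; apply: Cc_mul => //; exact: density_Ck. Qed.

Lemma integral_volD u u' : Cc 0 u -> Cc 0 u' -> vint (fun x => u x + u' x) = vint u + vint u'.
Proof.
move=> Cu Cu'; rewrite !(integral_volE mul_group).
rewrite -(integral_rVD (Cc_density Cu) (Cc_density Cu')).
by congr integral_rV; apply/funext => x; rewrite mulrDr.
Qed.

Lemma integral_volZ a u : Cc 0 u -> vint (fun x => a * u x) = a * vint u.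
Proof.
move=> Cu; rewrite !(integral_volE mul_group) -(integral_rVZ a (Cc_density Cu)).
by congr integral_rV; apply/funext => x; rewrite mulrCA.
Qed.

Lemma integral_vol_sum I (r : seq I) (f : I -> V -> R) : (forall i, Cc 0 (f i)) ->
  vint (fun x => \sum_(i <- r) f i x) = \sum_(i <- r) vint (f i).
Proof.
move=> Cf; under [RHS]eq_bigr do rewrite (integral_volE mul_group).
rewrite integral_volE // -(integral_rV_sum r xpredT (fun i => Cc_density (Cf i))).
by congr integral_rV; apply/funext => x; rewrite mulr_sumr.
Qed.

Lemma integral_vol_le u u' : Cc 0 u -> Cc 0 u' -> (forall x, u x <= u' x) -> vint u <= vint u'.
Proof.
move=> Cu Cu' le; rewrite -subr_ge0.
have <- : vint (fun x => u' x + -1 * u x) = vint u' - vint u.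
  by rewrite integral_volD //; [rewrite integral_volZ // mulN1r|exact: Cc_scale].
rewrite integral_volE //; apply: integral_rV_ge0 => x.
by apply: mulr_ge0; [exact/ltW/density_gt0|rewrite mulN1r subr_ge0].
Qed.

End VolumeIntegral.

Section Stability.
Context {R : realType} {n : nat}.
Variable c : 'I_n -> 'I_n -> 'I_n -> R.
Hypothesis c_anti : forall i j k, c i j k = - c j i k.
Hypothesis c_tr : forall i, \tr (ad_mx c i) = 0.
Variables (lambda : R) (D : 'M[R]_n).
Hypothesis c_soliton : nilsoliton c lambda D.
Variable mul : 'rV[R]_n -> 'rV[R]_n -> 'rV[R]_n.
Hypothesis mul_group : lie_group_law mul.
Hypothesis mul_c : has_lie_algebra mul c.
Variable phi : R -> 'rV[R]_n -> 'rV[R]_n.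
Hypothesis phi_flow : automorphism_flow mul D phi.
Local Notation V := 'rV[R]_n.
Local Notation X := (generator phi).
Local Notation vint := (integral_vol mul).
Local Notation T F i := (cov_deriv mul c F i).

Let D_sym : D^T = D. Proof. by case: c_soliton. Qed.

(** As [X, E_j] = - sum_k D_jk E_k, the components of L_X h are
    X h + D h + h D. *)
Lemma lie_deriv_dot (F : V -> 'M[R]_n) x : (forall k, Cc_mx k F) -> (F x)^T = F x ->
  form_dot (lie_deriv mul X F x) (F x) =
  2^-1 * 'D_(X x) (fun y => form_dot (F y) (F y)) x + 2 * \tr (D *m F x *m F x).
Proof.
move=> CF FT.
pose DF : 'M[R]_n := \matrix_(a, b) 'D_(X x) (fun y => F y a b) x.
have -> : lie_deriv mul X F x = DF + D *m F x + F x *m D^T.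
  pose Lie (adX : 'I_n -> 'I_n -> R) : 'M[R]_n := \matrix_(j, k) (DF j k
    - \sum_l adX j l * F x l k - \sum_l adX k l * F x j l).
  have adE : (fun j => frame_coord mul x (vf_bracket X (left_field mul j) x)) = fun j k => - D j k.
    by apply/funext => j; exact: generator_adE.
  transitivity (Lie (fun j k => - D j k)).
    rewrite -adE; apply/matrixP => a b; rewrite [LHS]mxE [RHS]mxE.
    by rewrite [DF a b]mxE.
  rewrite /Lie; move: (DF) => A {Lie}; apply/matrixP => a b; rewrite [LHS]mxE.
  rewrite [RHS]mxE [(A + _) a b]mxE; congr (_ + _ + _).
  - by rewrite -sumrN mxE; apply: eq_bigr => l _; rewrite mulNr opprK.
  - by rewrite -sumrN mxE; apply: eq_bigr => l _; rewrite mulNr opprK mxE mulrC.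
have -> : 'D_(X x) (fun y => form_dot (F y) (F y)) x = 2 * form_dot DF (F x).
  have dF a b : differentiable (fun y => F y a b) x by exact: Cc_diff (CF 1%N a b).
  have dFF a b : differentiable (fun y => F y a b * F y a b) x by exact: differentiableM.
  have dS a : differentiable (fun y => \sum_b F y a b * F y a b) x.
    by apply: differentiable_sum_fun.
  rewrite /form_dot (derive_sum_fun _ _ dS) mulr_sumr; apply: eq_bigr => a _.
  rewrite (derive_sum_fun _ _ (dFF a)) mulr_sumr; apply: eq_bigr => b _.
  rewrite (@deriveM _ _ (fun y => F y a b) (fun y => F y a b)); first last.
  - exact: diff_derivable.
  - exact: diff_derivable.
  rewrite mxE -![_ *: _]/(_ * _); ring.
rewrite mulrA mulVf // mul1r !form_dotE !mulmxDl !mxtraceD FT D_sym -addrA; congr (_ + _).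
by rewrite -[F x *m D *m _]mulmxA mxtrace_mulC mulr_natl mulr2n.
Qed.

(** The zero-order terms - 2 tr (Ric h h) of the Lichnerowicz Laplacian,
    2 lambda |h|^2 and 2 tr (D h h) cancel, as Ric = lambda + D. *)
Lemma soliton_op_dot (F : V -> 'M[R]_n) x : (forall k, Cc_mx k F) -> (F x)^T = F x ->
  form_dot (soliton_op mul c lambda X F x) (F x) =
  \sum_p frame_deriv mul p (fun y => form_dot (T F p y) (F y)) x
  - \sum_p form_dot (T F p x) (T F p x)
  + 2 * form_dot (curvature_op c (F x)) (F x)
  + 2^-1 * 'D_(X x) (fun y => form_dot (F y) (F y)) x.
Proof.
move=> CF FT.
have [ricE _ _] := c_soliton.
have formD (A B C : 'M[R]_n) : form_dot (A + B) C = form_dot A C + form_dot B C.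
  by rewrite !form_dotE mulmxDl mxtraceD.
have formN (A C : 'M[R]_n) : form_dot (- A) C = - form_dot A C.
  by rewrite !form_dotE mulNmx raddfN.
have formZ (a : R) (A C : 'M[R]_n) : form_dot (a *: A) C = a * form_dot A C.
  by rewrite !form_dotE -scalemxAl mxtraceZ.
have ricr : \matrix_(i, j) (\sum_k ricci c i k * F x k j) = ricci c *m F x.
  by apply/matrixP => i j; rewrite !mxE.
have ricl : \matrix_(i, j) (\sum_k ricci c j k * F x k i) = (ricci c *m F x)^T.
  by apply/matrixP => i j; rewrite !mxE.
rewrite /soliton_op /lichnerowicz ricr ricl !(formD, formN, formZ).
rewrite (rough_laplacian_dot mul_group c_anti c_tr _ (CF 2%N)) (lie_deriv_dot CF FT).
have -> : form_dot (ricci c *m F x)^T (F x) = form_dot (ricci c *m F x) (F x).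
  by rewrite !form_dotE -mxtrace_tr trmx_mul trmxK trmxK FT mxtrace_mulC.
have -> : form_dot (ricci c *m F x) (F x) = lambda * form_dot (F x) (F x) + \tr (D *m F x *m F x).
  rewrite !form_dotE FT ricE !mulmxDl mxtraceD mul_scalar_mx -scalemxAl mxtraceZ //.
move: (\sum_p frame_deriv _ _ _ _) (\sum_p form_dot _ _) (form_dot (curvature_op _ _) _) => a b d.
move: ('D__ _ _) (form_dot _ _) (\tr _) => f g t; ring.
Qed.

(** The Bochner inequality replaces - |nabla h|^2 by a divergence and a
    zero-order term. *)
Lemma soliton_op_dot_le (F : V -> 'M[R]_n) x : (forall k, Cc_mx k F) -> (F x)^T = F x ->
  form_dot (soliton_op mul c lambda X F x) (F x) <=
  \sum_p frame_deriv mul p (fun y => form_dot (T F p y) (F y) - bochner_field mul c F p y) x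
  + 2^-1 * 'D_(X x) (fun y => form_dot (F y) (F y)) x
  + (form_dot (curvature_op c (F x)) (F x) + lambda * form_dot (F x) (F x) + \tr (D *m F x *m F x)).
Proof.
move=> CF FT; rewrite soliton_op_dot //.
have [ricE _ _] := c_soliton.
have CT p : Cc 1 (fun y => form_dot (T F p y) (F y)).
  by apply: Cc_mx_form_dot; [exact: (Cc_mx_cov_deriv mul_group c p (CF 2%N))|exact: (CF 1%N)].
have -> : \sum_p frame_deriv mul p (fun y => form_dot (T F p y) (F y) - bochner_field mul c F p y) x =
    \sum_p frame_deriv mul p (fun y => form_dot (T F p y) (F y)) x
    - \sum_p frame_deriv mul p (bochner_field mul c F p) x.
  rewrite -sumrB; apply: eq_bigr => p _.
  by rewrite (dE_sub mul p x (CT p) (bochner_field_Cc mul_group c p (CF 2%N))).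
have := bochner_field_divergence_le mul_group mul_c c_anti c_tr (CF 2%N) FT.
have -> : \tr (ricci c *m F x *m F x) = lambda * form_dot (F x) (F x) + \tr (D *m F x *m F x).
  by rewrite !form_dotE FT ricE !mulmxDl mxtraceD mul_scalar_mx -scalemxAl mxtraceZ.
move: (\sum_p frame_deriv _ _ _ _) (\sum_p frame_deriv _ _ _ _) (\sum_k form_dot _ _) => a b d.
move: (form_dot (curvature_op _ _) _) ('D__ _ _) (lambda * _) (\tr _) => f g t u; lra.
Qed.

(** The divergences integrate to zero, and X |h|^2 integrates to
    - tr D ||h||^2. *)
Lemma soliton_op_stable eps :
  (forall h : 'M[R]_n, h^T = h ->
    form_dot (curvature_op c h) h + lambda * form_dot h h + \tr (D *m h *m h)
      <= (\tr D / 2 - eps) * form_dot h h) ->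
  forall F : V -> 'M[R]_n, smooth F -> compactly_supported F -> (forall x, (F x)^T = F x) ->
    L2_dot mul (soliton_op mul c lambda X F) F <= - eps * L2_dot mul F F.
Proof.
move=> bound F Fsm Fcs FT.
have CF k : Cc_mx k F.
  move=> a b; split; first exact: smooth_Ck.
  have [M [M0 FM]] := compactly_supported_vanishes Fcs.
  by exists M; split=> // x /FM ->; rewrite mxE.
have CX l k : Ck k (fun x => X x 0 l) by exact: (generator_Ck phi_flow).
pose q x := form_dot (F x) (F x).
pose w p x := form_dot (T F p x) (F x).
pose W p x := w p x - bochner_field mul c F p x.
have Cq k : Cc k q by exact: (Cc_mx_form_dot (CF k) (CF k)).
have CT p k : Cc_mx k (T F p) by exact: (Cc_mx_cov_deriv mul_group c p (CF k.+1)).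
have Cw p : Cc 1 (w p) by exact: (Cc_mx_form_dot (CT p 1%N) (CF 1%N)).
have CW p : Cc 1 (W p) by apply: Cc_sub => //; exact: (bochner_field_Cc mul_group c p (CF 2%N)).
have CdW : Cc 0 (fun x => \sum_p frame_deriv mul p (W p) x) by apply: Cc_sum => p; exact: dE_Cc.
have CXq : Cc 0 (fun x => 2^-1 * 'D_(X x) q x) by apply: Cc_scale; exact: along_Cc.
have Cbq a : Cc 0 (fun x => a * q x) by exact: Cc_scale.
rewrite /L2_dot.
have -> : - eps * vint q = vint (fun x => \sum_p frame_deriv mul p (W p) x
    + 2^-1 * 'D_(X x) q x + (\tr D / 2 - eps) * q x).
  rewrite (integral_volD mul_group); [|exact: Cc_add|exact: Cbq].
  rewrite (integral_volD mul_group CdW CXq) (integral_volZ mul_group _ (Cq 0%N)).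
  rewrite (integral_vol_sum mul_group); last by move=> p; exact: dE_Cc.
  rewrite big1; last by move=> p _; exact: (integral_dE mul_group mul_c c_tr).
  rewrite (integral_volZ mul_group); last exact: along_Cc.
  rewrite (integral_vol_generator mul_group phi_flow (Cq 1%N)).
  move: (vint q) (\tr D) => v t; lra.
apply: (integral_vol_le mul_group).
- have -> : (fun x => form_dot (soliton_op mul c lambda X F x) (F x)) =
     fun x => \sum_p frame_deriv mul p (w p) x - \sum_p form_dot (T F p x) (T F p x)
       + 2 * form_dot (curvature_op c (F x)) (F x) + 2^-1 * 'D_(X x) q x.
    by apply/funext => x; rewrite soliton_op_dot.
  apply: Cc_add => //; apply: Cc_add; last first.
    by apply: Cc_scale; apply: Cc_mx_form_dot => //; exact: Cc_mx_curvature_op.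
  apply: Cc_sub; first by apply: Cc_sum => p; exact: dE_Cc.
  by apply: Cc_sum => p; exact: Cc_mx_form_dot.
- by apply: Cc_add => //; exact: Cc_add.
- move=> x; apply: (le_trans (soliton_op_dot_le CF (FT x))).
  by apply: lerD => //; exact: bound.
Qed.

End Stability.

(** * Strict linear stability of the nilsoliton *)

Lemma char_poly_root_ge0 (R : realType) n (D : 'M[R]_n) (d : 'I_n -> R) :
  char_poly D = \prod_(i < n) ('X - (d i)%:P) ->
  (forall (v : 'rV[R]_n) a, v != 0 -> v *m D = a *: v -> 0 <= a) ->
  forall i, 0 <= d i.
Proof.
move=> Dd eig_ge0 i.
have : eigenvalue D (d i).
  by rewrite eigenvalue_root_char Dd /root horner_prod (bigD1 i) //= hornerXsubC subrr mul0r.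
by case/eigenvalueP => v vD v0; exact: eig_ge0 v0 vD.
Qed.

Theorem proposition1p9 (R : realType) (V : vectType R)
    (br : {bilinear V -> V -> V}) (nn : {vspace V})
    (br_lie : lie_bracket br)
    (br_solvable : lie_solvable br fullv)
    (nn_nilradical : nilradical br nn)
    (nn_derived : nn = lie_prod br fullv fullv)
    (nn_codim1 : \dim {:V} = (\dim nn).+1)
    (ip : {dot V for idfun}) (lambda : R)
    (m : nat) (f : m.-tuple V) (f_onb : orthonormal_basis ip fullv f)
    (s_einstein : einstein (structure_constants br ip f) lambda)
    (s_curv : forall h : 'M[R]_m, h^T = h -> h != 0 ->
       form_dot (curvature_op (structure_constants br ip f) h) h
         < - lambda * form_dot h h)
    (n : nat) (e : n.-tuple V) (e_onb : orthonormal_basis ip nn e)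
    (D : 'M[R]_n)
    (D_def : ricci (structure_constants br ip e) = lambda%:M + D)
    (d : 'I_n -> R)
    (d_eigen : char_poly D = \prod_(i < n) ('X - (d i)%:P))
    (d_max : forall i, d i < (2 + Num.sqrt 2)^-1 * \tr D) :
  strictly_linearly_stable (structure_constants br ip e) lambda D.
Proof.
have s_curv_le (h : 'M[R]_m) : h^T = h ->
    form_dot (curvature_op (structure_constants br ip f) h) h <= - lambda * form_dot h h.
  move=> hT; have [->|h0] := eqVneq h 0; last exact/ltW/s_curv.
  by rewrite !form_dotE trmx0 !mulmx0 mxtrace0 mulr0.
set c := structure_constants br ip e.
have [c_soliton eig_ge0 [S [DS trD curv_le]]] :=
  einstein_nilradical br_lie nn_nilradical nn_derived nn_codim1 f_onb s_einstein s_curv_le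
    e_onb D_def.
have c_anti i j k : c i j k = - c j i k by exact: nilradical_anti.
have c_tr i : \tr (ad_mx c i) = 0.
  exact (nilradical_tr nn_nilradical nn_derived e_onb i).
have [_ DT _] := c_soliton.
have [eps eps_gt0 eps_le] := stability_quadratic_form DT d_eigen
  (char_poly_root_ge0 d_eigen eig_ge0) d_max DS trD.
split=> // mul phi mul_group mul_c phi_flow; exists eps => //.
apply: (soliton_op_stable c_anti c_tr c_soliton mul_group mul_c phi_flow) => h hT.
have := curv_le h hT; have := eps_le h hT; lra.
Qed.
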